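(* Let $\psi\colon\{2,3,4,\ldots\}\to\mathbb R$ be an arithmetic function (i.e. a non-constant function). For any interval $J\subset\mathbb R$ of positive length which intersects the open interval $(c_\psi,d_\psi)$, $$\lim_{n\to\infty}\frac{1}{n}\log\lambda\left\{x\in[0,1)\colon\frac{1}{n}\sum_{j=1}^n\psi(b_j(x))\in J\right\}=-\inf_{\alpha\in J} I_{\psi\circ b_1}(\alpha).$$
   Context: $\lambda$ denotes Lebesgue measure on $[0,1]$. The R\'enyi map $T\colon[0,1)\to[0,1)$ is $Tx=\frac{1}{1-x}-\left\lfloor\frac{1}{1-x}\right\rfloor$. The digits of the backward continued fraction expansion of $x\in[0,1)$ are the integers $b_n(x)=\left\lfloor\frac{1}{1-T^{n-1}(x)}\right\rfloor+1\geq2$, $n\geq1$. $\mathcal M(T)$ is the set of $T$-invariant Borel probability measures on $[0,1)$; $\phi=-\log T'$ (where $T'(x)=(1-x)^{-2}$, one-sided derivative at branch endpoints); $\mathcal M_\phi(T)$ is the set of $\mu\in\mathcal M(T)$ for which $\phi$ is $\mu$-integrable. For $\mu\in\mathcal M_\phi(T)$, $\chi(\mu)=-\int\phi\,d\mu\geq0$, $h(\mu)$ is the Kolmogorov-Sinai entropy of $\mu$ with respect to $T$, and $F(\mu)=h(\mu)-\chi(\mu)$. An arithmetic function is a non-constant function $\psi\colon\{2,3,4,\ldots\}\to\mathbb R$. Its rate function $I_{\psi\circ b_1}\colon\mathbb R\to[0,\infty]$ is $$I_{\psi\circ b_1}(\alpha)=-\lim_{\epsilon\to0}\sup\left\{F(\mu)\colon\mu\in\mathcal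 M_\phi(T),\ \psi\circ b_1\in L^1(\mu),\ \int \psi\circ b_1\,d\mu\in(\alpha-\epsilon,\alpha+\epsilon)\right\},$$ with $\sup\emptyset=-\infty$. Also $$c_\psi=\inf_{x\in[0,1)}\liminf_{n\to\infty}\frac{1}{n}\sum_{j=1}^n\psi(b_j(x)),\qquad d_\psi=\sup_{x\in[0,1)}\limsup_{n\to\infty}\frac{1}{n}\sum_{j=1}^n\psi(b_j(x)),$$ so that $-\infty\leq c_\psi<d_\psi\leq\infty$. Convention: $\log 0=-\infty$. *)

(* Defs.v *)
From HB Require Import structures.
From mathcomp Require Import all_boot all_order all_algebra.
From mathcomp Require Import all_classical all_reals all_analysis.

Set Implicit Arguments.
Unset Strict Implicit.
Unset Printing Implicit Defensive.

Import Order.TTheory GRing.Theory Num.Theory.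
Import numFieldNormedType.Exports.

Local Open Scope classical_set_scope.
Local Open Scope ring_scope.

Section KolmogorovSinaiEntropy.
Context {d : measure_display} {X : measurableType d} {R : realType}.
(* The phase space of the dynamical system is the subset [D] of [X], with
   [T] mapping [D] to [D] and [mu] a probability measure carried by [D]. *)
Variables (D : set X) (T : X -> X) (mu : set X -> \bar R).

(* Atoms are allowed to be empty. *)
Definition is_partition (I : finType) (P : I -> set X) : Prop :=
  [/\ forall i, measurable (P i), trivIset setT P & \bigcup_i P i = D].

(* The convention 0 log 0 = 0 is automatic. *)
Definition partition_entropy (I : finType) (P : I -> set X) : R :=
  - \sum_(i : I) fine (mu (P i)) * ln (fine (mu (P i))).

(* The atoms of the join of the partitions T^-j P, 0 <= j < n, each atom being
   labelled by its itinerary [w]. *)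
Definition refined_partition (I : finType) (P : I -> set X) (n : nat)
    (w : {ffun 'I_n -> I}) : set X :=
  [set x | D x /\ forall j : 'I_n, P (w j) (iter j T x)].

Definition entropy_of_partition (I : finType) (P : I -> set X) : \bar R :=
  limn (fun n => (n%:R^-1 * partition_entropy (refined_partition P (n := n)))%:E).

Definition ks_entropy : \bar R :=
  ereal_sup [set h | exists k (P : 'I_k -> set X),
    is_partition P /\ h = entropy_of_partition P].

End KolmogorovSinaiEntropy.

Section BackwardContinuedFractions.
Context {R : realType}.
Implicit Types (x alpha : R) (psi : nat -> R).
Implicit Types mu : probability (measurableTypeR R) R.

Definition I01 : set R := `[0, 1[%classic.

Definition renyi x : R := (1 - x)^-1 - (Num.floor (1 - x)^-1)%:~R.

(* [digit n x] is the n-th digit, for n >= 1; [Num.truncn] is the floor, as a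
   natural number, of a nonnegative real. *)
Definition digit (n : nat) x : nat :=
  (Num.truncn (1 - iter n.-1 renyi x)^-1).+1.

Lemma renyi_itv x : renyi x \in `[0, 1[.
Proof.
have /andP[fl fu] := floor_itv (1 - x)^-1.
by rewrite in_itv /= /renyi subr_ge0 fl /= ltrBlDl -intrD1.
Qed.

Lemma digit_ge2 (n : nat) x : x \in `[0, 1[ -> (2 <= digit n x)%N.
Proof.
move=> x01; have : iter n.-1 renyi x \in `[0, 1[.
  by case: n.-1 => [//|m]; rewrite iterS renyi_itv.
rewrite in_itv /= => /andP[y0 y1].
by rewrite /digit ltnS truncn_gt0 invf_ge1 ?subr_gt0// lerBlDr lerDl.
Qed.

(* An arithmetic function {2, 3, ...} -> R is represented by any extension
   [psi : nat -> R]; in view of [digit_ge2] the values of [psi] at 0 and 1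
   play no role. *)
Definition arithmetic_function psi : Prop :=
  exists m n : nat, [/\ (2 <= m)%N, (2 <= n)%N & psi m != psi n].

Definition digit_average psi (n : nat) x : R :=
  n%:R^-1 * \sum_(1 <= j < n.+1) psi (digit j x).

(* The derivative of [renyi], one-sided at the branch endpoints. *)
Definition renyi_deriv x : R := (1 - x) ^- 2.

Definition phi x : R := - ln (renyi_deriv x).

(* Borel probability measures on [0, 1) are represented by Borel probability
   measures on R giving full mass to [0, 1). *)
Definition invariant_measures : set (probability (measurableTypeR R) R) :=
  [set mu : probability (measurableTypeR R) R | mu I01 = 1%E /\
    forall A : set (measurableTypeR R), measurable A -> A `<=` I01 ->
      mu (I01 `&` renyi @^-1` A) = mu A].

Definition invariant_measures_phi : set (probability (measurableTypeR R) R) :=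
  [set mu : probability (measurableTypeR R) R | invariant_measures mu /\ mu.-integrable I01 (EFin \o phi)].

Definition lyapunov mu : \bar R := (- \int[mu]_(x in I01) (phi x)%:E)%E.

Definition free_energy mu : \bar R :=
  (ks_entropy I01 renyi mu - lyapunov mu)%E.

Definition local_sup_free_energy psi alpha (e : R) : \bar R :=
  ereal_sup [set free_energy mu | mu in
    [set mu : probability (measurableTypeR R) R | [/\ invariant_measures_phi mu,
      mu.-integrable I01 (fun x => (psi (digit 1 x))%:E),
      ((alpha - e)%:E < \int[mu]_(x in I01) (psi (digit 1 x))%:E)%E &
      (\int[mu]_(x in I01) (psi (digit 1 x))%:E < (alpha + e)%:E)%E]]].

Definition rate_function psi alpha : \bar R :=
  (- lim (local_sup_free_energy psi alpha e @[e --> 0^'+]))%E.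

Definition average_inf psi : \bar R :=
  ereal_inf [set limn_einf (fun n => (digit_average psi n x)%:E) |
    x in I01].

Definition average_sup psi : \bar R :=
  ereal_sup [set limn_esup (fun n => (digit_average psi n x)%:E) |
    x in I01].

End BackwardContinuedFractions.

(* Main.v *)
Require Import Defs.
From mathcomp Require Import all_boot all_order all_algebra.
From mathcomp Require Import all_classical all_reals all_analysis.
From mathcomp Require Import measurable_realfun lra ring zify.
Set Implicit Arguments.
Unset Strict Implicit.
Unset Printing Implicit Defensive.
Import Order.TTheory GRing.Theory Num.Theory.
Import numFieldNormedType.Exports.
Local Open Scope classical_set_scope.
Local Open Scope ring_scope.

(** An n-cylinder, i.e. the set of points whose first n digits form a given word
    w, is an interval of length [len w], and the Lebesgue measure in the theorem
    is the sum of [len w] over the words w of length n whose average of [psi]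
    lies in J.  The map has a neutral fixed point at 0, so it is not uniformly
    expanding and its distortion is unbounded; but the derivative of an n-step
    inverse branch varies by a factor at most (n + 1)^2 ([den_distortion]).  Being
    subexponential, this is invisible here: up to terms of size log n, [- ln (len w)]
    is the Birkhoff sum of log T' along any orbit starting in the cylinder of w, and
    [len (u ++ v)] is at least [len u * len v] ([len_cat]).  Everything below rests
    on these two facts about words.

    Upper bound ([measure_of_avg_set]).  Finitely many letters carry at least half
    of the measure Z of the set.  Under the probability proportional to [len]
    on the words that remain, the weak law of large numbers yields, for large k, a
    family of K concatenations of k such words, all of about the same length
    exp(- B), with ln K - B close to k ln Z ([typical_blocks]).  Digit sequences made
    of independent uniform choices from this family, averaged over one period, form
    an invariant measure ([block_measure]) whose entropy is at least ln K per
    period, whose exponent is at most B + O(log) per period and which gives [psi]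
    an integral lying in J by convexity.  Hence its free energy is at least
    ln Z / n up to a vanishing error, and this free energy is at most - I(alpha)
    for an alpha in J.

    Lower bound ([avg_set_lower_rate]).  Let mu be an invariant measure with
    F(mu) > v and integral of [psi] close to a point alpha of J.  If p is the
    distribution under mu of the first N digits, cut off at finitely many
    words, then (1/N) sum_w p(w) (ln (len w) - ln p(w)) is at least v up to an error
    that vanishes as N grows, and the average of [psi] under p is close to alpha
    ([free_energy_words]).  This needs that the entropy of mu, a supremum over
    all finite partitions, is seen by the digits: cylinders generate the Borel sets
    because their length is at most 1/(n + 1) ([len_le_size]), and replacing a
    partition by a close function of the digits costs little entropy
    ([entropy_code_lower]).  Conversely, for any probability p on words of
    length N, independent words of law p are typically concatenated into words of
    length n whose cylinders together have measure at least exp(n (g - e)), where g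
    is the above sum for p and e > 0 is arbitrary ([avg_set_lower]).  The point alpha may be an endpoint of J; but since J
    has positive length and meets (c_psi, d_psi), some two words have averages on
    either side of an interior point of J, and giving a small weight to these
    two words moves the average inside J at an arbitrarily small cost ([gain_mix]). *)

(** * Inverse branches and the lengths of cylinders *)

Section Branches.
Context {R : realType}.
Implicit Types (x y s t : R) (a : nat) (u v w : seq nat).

(** The letter a stands for the digit a + 2, so that letters range over all the
    natural numbers; [branch a] is the inverse of the branch of the map on which the
    first digit is a + 2. *)
Definition branch a y : R := 1 - (a.+1%:R + y)^-1.

Definition word_map w y : R := foldr branch y w.

(** The derivative of [word_map w] at y is [(den w y) ^- 2]; this is the chain
    rule, the derivative of [branch a] being [(a.+1%:R + y) ^- 2]. *)
Fixpoint den w y : R :=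
  if w is a :: w' then (a.+1%:R + word_map w' y) * den w' y else 1.

Definition len w : R := (den w 0 * den w 1)^-1.

Lemma word_map_cat u v y : word_map (u ++ v) y = word_map u (word_map v y).
Proof. exact: foldr_cat. Qed.

Lemma branch_den_gt0 a y : 0 <= y -> 0 < a.+1%:R + y.
Proof. by move=> y0; rewrite ltr_wpDr. Qed.

Lemma branch_ge0 a y : 0 <= y -> 0 <= branch a y.
Proof.
move=> y0; rewrite /branch subr_ge0 invf_le1 ?branch_den_gt0//.
by rewrite -[leLHS]addr0 lerD// ler1n.
Qed.

Lemma branch_lt1 a y : 0 <= y -> branch a y < 1.
Proof. by move=> y0; rewrite /branch gtrBl invr_gt0 branch_den_gt0. Qed.

Lemma branch_le a b y : (a < b)%N -> 0 <= y <= 1 -> branch a y <= 1 - b.+1%:R^-1.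
Proof.
move=> ab /andP[y0 y1]; rewrite /branch lerD2l lerN2 lef_pV2 ?posrE//.
  by rewrite -[b.+1%:R]natr1 lerD// ler_nat.
exact: branch_den_gt0.
Qed.

Lemma word_map_ge0 w y : 0 <= y -> 0 <= word_map w y.
Proof. by move=> y0; elim: w => //= a w; exact: branch_ge0. Qed.

Lemma word_map_le1 w y : 0 <= y -> y <= 1 -> word_map w y <= 1.
Proof.
by move=> y0 y1; case: w => //= a w; exact/ltW/branch_lt1/word_map_ge0.
Qed.

Lemma den_ge1 w y : 0 <= y -> 1 <= den w y.
Proof.
move=> y0; elim: w => //= a w IH; rewrite mulr_ege1//.
by rewrite -[leLHS]addr0 lerD ?ler1n ?word_map_ge0.
Qed.

Lemma den_gt0 w y : 0 <= y -> 0 < den w y.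
Proof. by move=> y0; rewrite (lt_le_trans ltr01)// den_ge1. Qed.

(** The exact formula for the increments of a Moebius map, which makes [len w]
    the length of the cylinder of w and turns distortion estimates into estimates
    on [den]. *)
Lemma word_map_sub w s t : 0 <= s -> 0 <= t ->
  word_map w s - word_map w t = (s - t) / (den w s * den w t).
Proof.
move=> s0 t0; elim: w => [|a w IH]/=; first by rewrite mul1r divr1.
have ds := den_gt0 w s0; have dt := den_gt0 w t0.
have fs := branch_den_gt0 a (word_map_ge0 w s0).
have ft := branch_den_gt0 a (word_map_ge0 w t0).
rewrite /branch; set A := (_ + word_map w s) in fs *.
set B := (_ + word_map w t) in ft *.
have -> : 1 - A^-1 - (1 - B^-1) = (A - B) / (A * B).
  by field; rewrite (gt_eqF fs) (gt_eqF ft).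
have -> : A - B = (s - t) / (den w s * den w t) by rewrite -IH /A /B; ring.
by field; rewrite !gt_eqF.
Qed.

Lemma len_gt0 w : 0 < len w.
Proof. by rewrite invr_gt0 mulr_gt0 ?den_gt0. Qed.

Lemma lenE w : len w = word_map w 1 - word_map w 0.
Proof. by rewrite word_map_sub// subr0 mul1r mulrC. Qed.

Lemma len_le1 w : len w <= 1.
Proof. by rewrite invf_le1 ?mulr_gt0 ?den_gt0// mulr_ege1 ?den_ge1. Qed.

Lemma word_map_ltr w s t : 0 <= s -> s < t -> word_map w s < word_map w t.
Proof.
move=> s0 st; have t0 := le_trans s0 (ltW st).
by rewrite -subr_gt0 word_map_sub// divr_gt0 ?subr_gt0// mulr_gt0 ?den_gt0.
Qed.

Lemma word_map_ler w s t : 0 <= s -> s <= t -> word_map w s <= word_map w t.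
Proof.
by move=> s0; rewrite le_eqVlt => /predU1P[->//|/(word_map_ltr w s0)/ltW].
Qed.

Lemma den_ler w s t : 0 <= s -> s <= t -> den w s <= den w t.
Proof.
move=> s0 st; have t0 := le_trans s0 st; elim: w => //= a w IH.
rewrite ler_pM// ?lerD2l ?word_map_ler//; last exact/ltW/den_gt0.
exact/ltW/branch_den_gt0/word_map_ge0.
Qed.

(** Polynomial distortion.  One more letter adds to [den] a term bounded by the
    increment of [word_map w] times [den w y], which is at most 1 by
    [word_map_sub]: each letter costs one unit, even near the neutral fixed point. *)
Lemma den_distortion w y : 0 <= y -> y <= 1 -> den w y <= (size w).+1%:R * den w 0.
Proof.
move=> y0 y1; elim: w => [|a w IH]/=; first by rewrite mul1r.
have d0 := den_ge1 w (lexx 0); have dy := den_gt0 w y0.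
have d00 := den_gt0 w (lexx 0).
have -> : word_map w y = word_map w 0 + y / (den w y * den w 0).
  by rewrite -[X in X / _]subr0 -word_map_sub//; ring.
set c := a.+1%:R + word_map w 0.
have c1 : 1 <= c by rewrite -[leLHS]addr0 lerD ?ler1n ?word_map_ge0.
rewrite addrA -/c mulrDl.
have -> : y / (den w y * den w 0) * den w y = y / den w 0.
  by field; rewrite !gt_eqF.
have h1 : y / den w 0 <= 1 by rewrite ler_pdivrMr// mul1r (le_trans y1).
have h2 : c * den w y <= c * ((size w).+1%:R * den w 0).
  by rewrite ler_pM2l// (lt_le_trans ltr01).
have h3 : 1 <= c * den w 0 by rewrite mulr_ege1.
rewrite -(natr1 (size w).+1); set n := (size w).+1%:R in h2 *.
rewrite (_ : (n + 1) * _ = c * (n * den w 0) + c * den w 0); last by ring.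
by rewrite lerD// (le_trans h1).
Qed.

(** The numerator of the fraction [word_map w y] is nondecreasing along the
    recursion; this is what forces [den w 1] to grow by one with each letter. *)
Lemma den_num_ge w y : 0 <= y -> y <= word_map w y * den w y.
Proof.
move=> y0; elim: w => [|a w IH]/=; first by rewrite mulr1.
have fw := branch_den_gt0 a (word_map_ge0 w y0).
have dw := den_gt0 w y0.
rewrite /branch; set c := _ + _ in fw *.
have -> : (1 - c^-1) * (c * den w y) = (c - 1) * den w y.
  by field; rewrite gt_eqF.
rewrite (le_trans IH)// ler_pM2r// /c -natr1.
by have := ler0n R a; lra.
Qed.

Lemma den1_ge w : (size w).+1%:R <= den w 1.
Proof.
elim: w => //= a w IH; rewrite -natr1 (le_trans (lerD IH (lexx 1)))//.
have h := den_num_ge w (@ler01 R); rewrite mulrDl lerD//.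
by rewrite ler_peMl ?ler1n// ltW ?den_gt0.
Qed.

(** The slowest contraction is along the letter 0, whose branch is tangent to the
    identity at its fixed point 0; cylinders shrink nevertheless uniformly in the word, and
    therefore generate the Borel sets. *)
Lemma len_le_size w : len w <= (size w).+1%:R^-1.
Proof.
rewrite lef_pV2 ?posrE ?mulr_gt0 ?den_gt0//.
by rewrite (le_trans (den1_ge w))// ler_peMl ?den_ge1// ltW ?den_gt0.
Qed.

Lemma den_sqr_le w y : 0 <= y -> y <= 1 ->
  den w y ^+ 2 <= (size w).+1%:R / len w.
Proof.
move=> y0 y1; rewrite /len invrK expr2 mulrA.
rewrite ler_pM//; try exact/ltW/den_gt0.
- exact: den_distortion.
- exact: den_ler.
Qed.

Lemma len_inv_le w y : 0 <= y -> y <= 1 ->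
  (len w)^-1 <= (size w).+1%:R * den w y ^+ 2.
Proof.
move=> y0 y1; rewrite /len invrK expr2 mulrA mulrC.
have d0 w' := ltW (den_gt0 w' (lexx 0)); have dy w' := ltW (den_gt0 w' y0).
rewrite ler_pM//; first exact/ltW/den_gt0.
  rewrite (le_trans (den_distortion _ _ _))// ler_wpM2l//.
  exact: den_ler.
exact: den_ler.
Qed.

Lemma len_cat u v : len u * len v / (size u).+1%:R <= len (u ++ v).
Proof.
have a0 := word_map_ge0 v (lexx 0); have b0 := word_map_ge0 v (@ler01 R).
rewrite [leRHS]lenE !word_map_cat word_map_sub// -lenE.
have d0 := den_gt0 u a0; have d1 := den_gt0 u b0; have dd0 := den_gt0 u (lexx 0).
have n0 : 0 < (size u).+1%:R :> R by rewrite ltr0n.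
rewrite mulrAC mulrC ler_pM2l ?len_gt0// ler_pdivrMr// /len -ler_pdivrMl ?invr_gt0 ?mulr_gt0//.
rewrite invrK ler_pdivrMr ?mulr_gt0//.
  rewrite mulrA [leRHS]mulrC ler_pM//; try exact: ltW.
    by rewrite den_ler// word_map_le1.
  by rewrite den_distortion// word_map_le1.
exact: den_gt0.
Qed.

Lemma den_bounded L w y : 0 <= y -> y <= 1 -> all (fun a => a < L)%N w ->
  den w y <= L.+1%:R ^+ size w.
Proof.
move=> y0 y1; elim: w => //= a w IH /andP[aL wL].
rewrite exprS ler_pM ?IH//.
- exact/ltW/branch_den_gt0/word_map_ge0.
- exact/ltW/den_gt0.
- by rewrite -[L.+1%:R]natr1 lerD ?word_map_le1// ler_nat.
Qed.

Lemma len_bounded L w : all (fun a => a < L)%N w ->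
  (L.+1%:R ^+ size w * L.+1%:R ^+ size w)^-1 <= len w.
Proof.
move=> wL; rewrite lef_pV2 ?posrE ?mulr_gt0 ?den_gt0 ?exprn_gt0//.
by rewrite ler_pM ?den_bounded// ltW ?den_gt0.
Qed.

(** * Digits and cylinders *)

Definition letter x : nat := (Num.truncn (1 - x)^-1).-1.

Definition itin n x : seq nat := [seq letter (iter j renyi x) | j <- iota 0 n].

Definition cyl w : set R := [set x | I01 x /\ itin (size w) x = w].

Lemma I01E x : I01 x <-> (0 <= x) && (x < 1).
Proof. by rewrite /I01/= in_itv/=. Qed.

Lemma renyi_I01 x : I01 (renyi x).
Proof. exact: renyi_itv. Qed.

Lemma iter_renyi_I01 n x : I01 x -> I01 (iter n renyi x).
Proof. by case: n => // n _; rewrite iterS; exact: renyi_I01. Qed.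

Lemma digitE n x : I01 x -> digit n.+1 x = (letter (iter n renyi x)).+2.
Proof.
move=> /(iter_renyi_I01 n)/I01E/andP[x0 x1]; rewrite /digit /letter/= prednK//.
by rewrite truncn_gt0 invf_ge1 ?subr_gt0// lerBlDr lerDl.
Qed.

Lemma branch_I01 a y : I01 y -> I01 (branch a y).
Proof. by move=> /I01E/andP[y0 y1]; apply/I01E; rewrite branch_ge0 ?branch_lt1. Qed.

Lemma word_map_I01 w y : I01 y -> I01 (word_map w y).
Proof. by move=> y01; elim: w => //= a w; exact: branch_I01. Qed.

Lemma branch_inv a y : (1 - branch a y)^-1 = a.+1%:R + y.
Proof. by rewrite /branch opprB addrC subrK invrK. Qed.

Lemma letter_branch a y : I01 y -> letter (branch a y) = a.
Proof.
move=> /I01E/andP[y0 y1]; rewrite /letter branch_inv (@truncn_def _ _ a.+1)//.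
by rewrite lerDl y0 -[a.+2%:R]natr1 ltrD2l.
Qed.

Lemma renyi_branch a y : I01 y -> renyi (branch a y) = y.
Proof.
move=> /I01E/andP[y0 y1]; rewrite /renyi branch_inv (@floor_def _ _ a.+1)//.
  by rewrite addrC addKr.
by rewrite pmulrn lerDl y0 /= -pmulrn intrD1 // ltrD2l.
Qed.

Lemma branch_letter x : I01 x -> branch (letter x) (renyi x) = x.
Proof.
move=> /I01E/andP[x0 x1].
have y1 : 1 <= (1 - x)^-1 by rewrite invf_ge1 ?subr_gt0// lerBlDr lerDl.
rewrite /branch /letter /renyi prednK ?truncn_gt0//.
rewrite truncn_floor (le_trans ler01 y1) natr_absz ger0_norm; last first.
  by rewrite floor_ge0 (le_trans ler01 y1).
by rewrite subrKC invrK; ring.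
Qed.

Lemma size_itin n x : size (itin n x) = n.
Proof. by rewrite size_map size_iota. Qed.

Lemma itinS n x : itin n.+1 x = letter x :: itin n (renyi x).
Proof.
rewrite /itin/=; congr cons; rewrite -add1n iotaDl -map_comp.
by apply: eq_map => j /=; rewrite -iterSr.
Qed.

Lemma itinD m n x : itin (m + n) x = itin m x ++ itin n (iter m renyi x).
Proof. by elim: m x => // m IH x; rewrite addSn !itinS IH -iterSr. Qed.

Lemma word_map_itin n x : I01 x -> word_map (itin n x) (iter n renyi x) = x.
Proof.
elim: n x => // n IH x x01; rewrite itinS iterSr /= IH ?branch_letter//.
exact: renyi_I01.
Qed.

Lemma itin_word_map w y : I01 y -> itin (size w) (word_map w y) = w.
Proof.
move=> y01; elim: w => //= a w IH; have h := word_map_I01 w y01.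
by rewrite itinS letter_branch// renyi_branch// IH.
Qed.

Lemma iter_word_map w y : I01 y -> iter (size w) renyi (word_map w y) = y.
Proof.
move=> y01; elim: w => // a w IH; have h := word_map_I01 w y01.
by rewrite [size _]/= iterSr [word_map _ _]/= renyi_branch.
Qed.

Lemma word_map_surj w s t x : 0 <= s -> s < t ->
  word_map w s <= x < word_map w t -> exists2 y, s <= y < t & x = word_map w y.
Proof.
move=> s0 st; elim: w x => [|a w IH] x /=; first by exists x.
have t0 := ltW (le_lt_trans s0 st).
have A0 := branch_den_gt0 a (word_map_ge0 w s0).
have B0 := branch_den_gt0 a (word_map_ge0 w t0).
rewrite {1 2}/branch => /andP[h1 h2].
have x1 : 0 < 1 - x by rewrite subr_gt0 (lt_trans h2)// gtrBl invr_gt0.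
have [|y yst xE] := IH ((1 - x)^-1 - a.+1%:R).
  rewrite lerBrDl ltrBlDl -[X in X <= _]invrK -[X in _ < X]invrK.
  rewrite lef_pV2 ?ltf_pV2 ?posrE ?invr_gt0//.
  by apply/andP; split; lra.
by exists y => //; rewrite -xE /branch subrKC invrK; ring.
Qed.

(** Each branch is full, so a cylinder is the whole image of [0, 1) under an
    increasing map. *)
Lemma cylE w : cyl w = `[word_map w 0, word_map w 1[%classic.
Proof.
apply/seteqP; split => x /=; rewrite in_itv/=.
  move=> [x01 xw]; have /I01E/andP[y0 y1] := iter_renyi_I01 (size w) x01.
  have := word_map_itin (size w) x01; rewrite xw => <-.
  by rewrite word_map_ler// word_map_ltr.
move=> /(word_map_surj (lexx 0) ltr01)[y /I01E y01 ->]; split.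
  exact: word_map_I01.
exact: itin_word_map.
Qed.

Lemma measurable_cyl w : measurable (cyl w).
Proof. by rewrite cylE; exact: measurable_itv. Qed.

Lemma lebesgue_cyl w : lebesgue_measure (cyl w) = (len w)%:E.
Proof.
rewrite cylE lebesgue_measure_itv/= lte_fin word_map_ltr// -EFinB -lenE//.
Qed.

End Branches.

(** * Entropy of finite-valued functions *)

Lemma gibbs_inequality {R : realType} (A : finType) (p q : A -> R) :
  (forall a, 0 <= p a) -> (forall a, 0 <= q a) ->
  (forall a, 0 < p a -> 0 < q a) -> \sum_a q a <= \sum_a p a ->
  - (\sum_a p a * ln (p a)) <= - \sum_a p a * ln (q a).
Proof.
move=> p0 q0 pq qp; rewrite lerN2 -subr_le0 -sumrB.
apply: (@le_trans _ _ (\sum_a (q a - p a))); last by rewrite sumrB subr_le0.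
apply: ler_sum => a _; have := p0 a; rewrite le_eqVlt => /predU1P[<-|pa].
  by rewrite !mul0r subrr subr0.
have qa := pq _ pa; rewrite -mulrBr -ln_div ?posrE//.
have -> : q a - p a = p a * (q a / p a - 1) by field; rewrite gt_eqF.
rewrite ler_pM2l// -[X in ln X](subrK 1) addrC le_ln1Dx//.
by rewrite ltrBrDl subrr divr_gt0.
Qed.

Lemma measure_bigcup_fin d (X : measurableType d) (R : realType)
    (mu : {measure set X -> \bar R}) (A : finType) (P : pred A) (F : A -> set X) :
  (forall a, measurable (F a)) -> trivIset [set: A] F ->
  mu (\bigcup_(a in [set` P]) F a) = (\sum_(a | P a) mu (F a))%E.
Proof.
move=> mF tF; rewrite measure_fin_bigcup//; last exact: sub_trivIset tF.
rewrite -[RHS](big_filter (index_enum A)).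
rewrite [RHS]fsbig_seq ?filter_uniq ?index_enum_uniq//.
rewrite [in RHS](_ : [set` _] = [set` P])//; apply/seteqP.
by split=> a /=; rewrite mem_filter mem_index_enum andbT.
Qed.

Lemma measure_bigcup_le d (X : measurableType d) (R : realType)
    (mu : {measure set X -> \bar R}) (A : finType) (F : A -> set X) (c : R) :
  (forall a, measurable (F a)) -> (forall a, (mu (F a) <= c%:E)%E) ->
  (mu (\bigcup_a F a) <= (#|A|%:R * c)%:E)%E.
Proof.
move=> mF Fc; rewrite (_ : \bigcup_a F a = \big[setU/set0]_(a <- enum A) F a); last first.
  rewrite -bigcup_seq; apply/seteqP; split => x [a _ Fa]; exists a => //=.
  by rewrite mem_enum.
rewrite cardE; elim: (enum A) => [|a s IH]; first by rewrite big_nil measure0 mul0r.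
rewrite big_cons (le_trans (measureU2 _ _ _))//.
  by apply: bigsetU_measurable.
by rewrite /= -natr1 mulrDl mul1r EFinD addeC leeD.
Qed.

Section FiniteValued.
Context d (X : measurableType d) (R : realType) (mu : probability X R).
Variable D : set X.
Hypothesis muD : mu D = 1%E.
Implicit Types A B : finType.

Definition fibers_measurable (A : Type) (f : X -> A) : Prop :=
  forall a, measurable (D `&` f @^-1` [set a]).

(** The law of a finite-valued function is used in place of the partition into
    its fibers: joins become pairs and coarser partitions become compositions. *)
Definition law (A : Type) (f : X -> A) (a : A) : R :=
  fine (mu (D `&` f @^-1` [set a])).

Definition entropy A (f : X -> A) : R := - \sum_a law f a * ln (law f a).

Lemma law_ge0 (A : Type) (f : X -> A) a : 0 <= law f a.
Proof. exact/fine_ge0. Qed.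

Lemma eq_law (A : Type) (f g : X -> A) : {in D, f =1 g} -> law f =1 law g.
Proof.
move=> fg a; rewrite /law; congr (fine (mu _)); apply/seteqP; split => x /= [Dx <-].
  by split=> //; rewrite fg// inE.
by split=> //; rewrite fg// inE.
Qed.

Lemma eq_entropy A (f g : X -> A) : {in D, f =1 g} -> entropy f = entropy g.
Proof.
by move=> /eq_law fg; rewrite /entropy; under eq_bigr do rewrite fg.
Qed.

Lemma eq_fibers (A : Type) (f g : X -> A) : {in D, f =1 g} ->
  fibers_measurable f -> fibers_measurable g.
Proof.
move=> fg mf a; suff <- : D `&` f @^-1` [set a] = D `&` g @^-1` [set a] by [].
by apply/seteqP; split => x /= [Dx <-]; split=> //; rewrite fg// inE.
Qed.

Lemma preimage_pred A (f : X -> A) (P : pred A) : D `&` [set x | P (f x)] =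
  \bigcup_(a in [set` P]) (D `&` f @^-1` [set a]).
Proof.
apply/seteqP; split => [x [Dx Pfx]|x [a Pa [Dx fx]]]; first by exists (f x).
by split=> //; rewrite /= fx.
Qed.

Lemma measurable_preimage_pred A (f : X -> A) (P : pred A) :
  fibers_measurable f -> measurable (D `&` [set x | P (f x)]).
Proof.
move=> mf; rewrite preimage_pred; apply: fin_bigcup_measurable => // a _.
Qed.

Lemma measure_preimage_pred A (f : X -> A) (P : pred A) : fibers_measurable f ->
  mu (D `&` [set x | P (f x)]) = (\sum_(a | P a) law f a)%:E.
Proof.
move=> mf; rewrite preimage_pred measure_bigcup_fin//.
  by rewrite -sumEFin; apply: eq_bigr => a _; rewrite /law fineK// fin_num_measure.
by move=> a b _ _ [x [[_ /= fa] [_ /= fb]]]; rewrite -fa -fb.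
Qed.

Lemma sum_law A (f : X -> A) : fibers_measurable f -> \sum_a law f a = 1.
Proof.
move=> mf; apply: EFin_inj; rewrite -muD -(measure_preimage_pred xpredT mf).
by congr (mu _); apply/seteqP; split=> x; [case|].
Qed.

Lemma law_le1 A (f : X -> A) a : fibers_measurable f -> law f a <= 1.
Proof.
move=> mf; rewrite -(sum_law mf) (bigD1 a)//= lerDl.
by apply: sumr_ge0 => b _; exact: law_ge0.
Qed.

Lemma fibers_comp A B (f : X -> A) (g : A -> B) :
  fibers_measurable f -> fibers_measurable (g \o f).
Proof.
by move=> mf b; have := measurable_preimage_pred (fun a => `[< g a = b >]) mf;
  congr (measurable (_ `&` _)); apply/seteqP; split => x /= /asboolP.
Qed.

Lemma law_comp A B (f : X -> A) (g : A -> B) b : fibers_measurable f ->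
  law (g \o f) b = \sum_(a | g a == b) law f a.
Proof.
move=> mf; apply: EFin_inj; rewrite -measure_preimage_pred//.
rewrite /law fineK ?fin_num_measure//; last exact: fibers_comp.
by congr (mu (_ `&` _)); apply/seteqP; split => x /= /eqP.
Qed.

Lemma sum_law_comp A B (f : X -> A) (g : A -> B) (h : B -> R) :
  fibers_measurable f ->
  \sum_b law (g \o f) b * h b = \sum_a law f a * h (g a).
Proof.
move=> mf; rewrite (partition_big g xpredT)//=; apply: eq_bigr => b _.
by rewrite law_comp// mulr_suml; apply: eq_bigr => a /eqP ->.
Qed.

Lemma law_le_comp A B (f : X -> A) (g : A -> B) a : fibers_measurable f ->
  law f a <= law (g \o f) (g a).
Proof.
move=> mf; rewrite law_comp// (bigD1 a)//= lerDl.
by apply: sumr_ge0 => b _; exact: law_ge0.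
Qed.

Lemma entropy_comp A B (f : X -> A) (g : A -> B) : fibers_measurable f ->
  entropy (g \o f) <= entropy f.
Proof.
move=> mf; rewrite /entropy lerN2 (sum_law_comp g (fun b => ln (law (g \o f) b)) mf).
apply: ler_sum => a _; have := law_ge0 f a.
rewrite le_eqVlt => /predU1P[<-|p0]; first by rewrite !mul0r.
rewrite ler_pM2l// ler_ln ?posrE ?law_le_comp//.
exact: lt_le_trans (law_le_comp g a mf).
Qed.

Lemma entropy_le_cross A (f : X -> A) (q : A -> R) : fibers_measurable f ->
  (forall a, 0 <= q a) -> (forall a, 0 < law f a -> 0 < q a) -> \sum_a q a <= 1 ->
  entropy f <= - \sum_a law f a * ln (q a).
Proof.
by move=> mf q0 fq q1; apply: gibbs_inequality; rewrite ?sum_law//; exact: law_ge0.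
Qed.

Lemma entropy_ge0 A (f : X -> A) : fibers_measurable f -> 0 <= entropy f.
Proof.
move=> mf; rewrite oppr_ge0; apply: sumr_le0 => a _.
by rewrite mulr_ge0_le0 ?law_ge0// ln_le0// law_le1.
Qed.

Lemma fibers_pair A B (f : X -> A) (g : X -> B) :
  fibers_measurable f -> fibers_measurable g ->
  fibers_measurable (fun x => (f x, g x)).
Proof.
move=> mf mg [a b]; have := measurableI _ _ (mf a) (mg b).
congr (measurable _); apply/seteqP; split => x /=; first by case=> -[? <-] [? <-].
by case=> Dx [<- <-].
Qed.

(** Compare with the product of the two marginal laws in [entropy_le_cross]. *)
Lemma entropy_pair A B (f : X -> A) (g : X -> B) :
  fibers_measurable f -> fibers_measurable g ->
  entropy (fun x => (f x, g x)) <= entropy f + entropy g.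
Proof.
move=> mf mg; have mfg := fibers_pair mf mg.
set h := fun x => _ in mfg *.
have pf c : law h c <= law f c.1 by exact: (law_le_comp fst).
have pg c : law h c <= law g c.2 by exact: (law_le_comp snd).
have := @entropy_le_cross _ h (fun c => law f c.1 * law g c.2) mfg.
move=> /(_ (fun c => mulr_ge0 (law_ge0 _ _) (law_ge0 _ _))) /(_ _ _)/wrap[].
- by move=> c c0; rewrite mulr_gt0// (lt_le_trans c0).
- rewrite -(pair_bigA _ (fun a b => law f a * law g b))/=.
  by under eq_bigr do rewrite -mulr_sumr sum_law// mulr1; rewrite sum_law.
move=> /le_trans; apply; rewrite -opprD lerN2.
have -> : \sum_a law f a * ln (law f a) = \sum_c law h c * ln (law f c.1).
  exact: (sum_law_comp fst (fun a => ln (law f a)) mfg).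
have -> : \sum_a law g a * ln (law g a) = \sum_c law h c * ln (law g c.2).
  exact: (sum_law_comp snd (fun a => ln (law g a)) mfg).
rewrite -big_split/=; apply: ler_sum => c _; rewrite -mulrDr.
have := law_ge0 h c; rewrite le_eqVlt => /predU1P[<-|c0]; first by rewrite !mul0r.
by rewrite lnM// posrE (lt_le_trans c0).
Qed.

End FiniteValued.

Lemma entropy_ge_max d (X : measurableType d) (R : realType) (mu : probability X R)
    (D : set X) (A : finType) (f : X -> A) (c : R) :
  mu D = 1%E -> fibers_measurable D f -> 0 < c -> (forall a, law mu D f a <= c) ->
  - ln c <= entropy mu D f.
Proof.
move=> muD mf c0 fc; rewrite /entropy lerN2 -[leRHS]mul1r -(sum_law muD mf) mulr_suml.
apply: ler_sum => a _; have := law_ge0 mu D f a.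
rewrite le_eqVlt => /predU1P[<-|p0]; first by rewrite !mul0r.
by rewrite ler_pM2l// ler_ln ?posrE.
Qed.

(** * Subadditivity and the Kolmogorov-Sinai entropy *)

(** Fekete's lemma; the limit is also a lower bound, which makes the entropy of a
    partition usable at every finite time. *)
Lemma fekete {R : realType} (u : nat -> R) : (forall n, 0 <= u n) ->
  (forall m n, u (m + n)%N <= u m + u n) ->
  exists2 l : R, n%:R^-1 * u n @[n --> \oo] --> l & forall n, n%:R * l <= u n.
Proof.
move=> u0 usub; pose S := [set n.+1%:R^-1 * u n.+1 | n in setT].
have S0 : has_inf S.
  split; first by exists (1^-1 * u 1%N), 0%N.
  by exists 0 => _ [n _ <-]; rewrite mulr_ge0.
have lu n : n%:R * inf S <= u n.
  case: n => [|n]; first by rewrite mul0r.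
  by rewrite -ler_pdivlMl//; apply: ge_inf; [exact: S0.2|exists n].
have umul q k : u (q * k)%N <= q%:R * u k + u 0%N.
  elim: q => [|q IH]; first by rewrite mul0n mul0r add0r.
  rewrite mulSn (le_trans (usub _ _))// -natr1 mulrDl mul1r.
  by rewrite [_ * _ + u k]addrC -addrA lerD2l.
exists (inf S) => //; apply/cvgrPdist_le => e e0.
have [_ [k _ <-] kS] := inf_adherent (divr_gt0 e0 (ltr0Sn R 1)) S0.
set l := inf S in lu kS *.
pose C := k.+1%:R * u 1%N + 2 * u 0%N.
near=> n.
have n0 : (0 < n)%N by near: n; exists 1%N.
have n0R : 0 < n%:R :> R by rewrite ltr0n.
rewrite ler_distlC; apply/andP; split.
  rewrite lerBlDr (@le_trans _ _ (n%:R^-1 * u n))//; last by rewrite lerDl ltW.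
  by rewrite ler_pdivlMl.
rewrite ler_pdivrMl// {1}(divn_eq n k.+1) (le_trans (usub _ _))//.
set q := (n %/ k.+1)%N; set r := (n %% k.+1)%N.
have h1 := umul q k.+1.
have h2 : u r <= k.+1%:R * u 1%N + u 0%N.
  have := umul r 1%N; rewrite muln1 => /le_trans; apply; rewrite lerD2r.
  by rewrite ler_wpM2r// ler_nat ltnW// ltn_mod.
have h3 : q%:R * u k.+1 <= n%:R * (l + e / 2).
  apply: (@le_trans _ _ (q%:R * (k.+1%:R * (l + e / 2)))).
    by rewrite ler_wpM2l// -ler_pdivrMl// ltW.
  rewrite mulrA -natrM ler_wpM2r//; last by rewrite ler_nat leq_trunc_div.
  by rewrite (le_trans _ (ltW kS))// mulr_ge0.
have h4 : C <= n%:R * (e / 2).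
  rewrite -ler_pdivrMr ?divr_gt0//; near: n; exact: nbhs_infty_ger.
rewrite (le_trans (lerD h1 h2))//; move: h3 h4; rewrite /C; lra.
Unshelve. all: by end_near. Qed.

Section Dynamics.
Context d (X : measurableType d) (R : realType) (mu : probability X R).
Variables (D : set X) (T : X -> X).
Hypotheses (mD : measurable D) (muD : mu D = 1%E).
Hypotheses (TD : forall x, D x -> D (T x))
  (mT : forall B, measurable B -> measurable (D `&` T @^-1` B))
  (invT : forall B, measurable B -> B `<=` D -> mu (D `&` T @^-1` B) = mu B).
Implicit Types A B : finType.

Lemma iterTD n x : D x -> D (iter n T x).
Proof. by move=> Dx; elim: n => //= n; exact: TD. Qed.

Lemma preimage_T (B : set X) : D `&` T @^-1` B = D `&` T @^-1` (D `&` B).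
Proof.
by apply/seteqP; split => x [Dx /= Bx]; split=> //; [split=> //; exact: TD|case: Bx].
Qed.

Lemma fibers_T (A : Type) (f : X -> A) : fibers_measurable D f -> fibers_measurable D (f \o T).
Proof. by move=> mf a; have := mT (mf a); rewrite -preimage_T. Qed.

Lemma law_T (A : Type) (f : X -> A) : fibers_measurable D f ->
  law mu D (f \o T) = law mu D f.
Proof.
move=> mf; apply/funext => a; rewrite /law; congr fine.
by rewrite -[RHS]invT// -preimage_T.
Qed.

Lemma fibers_iterT (A : Type) (f : X -> A) n :
  fibers_measurable D f -> fibers_measurable D (f \o iter n T).
Proof.
move=> mf; elim: n => // n IH; apply: eq_fibers (fibers_T IH) => x _ /=.
by rewrite -iterSr.
Qed.

Lemma law_iterT (A : Type) (f : X -> A) n : fibers_measurable D f ->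
  law mu D (f \o iter n T) = law mu D f.
Proof.
move=> mf; elim: n => // n IH; rewrite -[RHS]IH -[RHS]law_T; last exact: fibers_iterT.
by congr law; apply/funext => x /=; rewrite -iterSr.
Qed.

(** The name of a point records its f-itinerary; the fibers of [name f n] are the
    atoms of the refined partition. *)
Definition name A (f : X -> A) n x : {ffun 'I_n -> A} :=
  [ffun j : 'I_n => f (iter j T x)].

Definition glue A m n (c : {ffun 'I_m -> A} * {ffun 'I_n -> A}) : {ffun 'I_(m + n) -> A} :=
  [ffun j : 'I_(m + n) => match fintype.split j with inl i => c.1 i | inr i => c.2 i end].

Lemma nameD A (f : X -> A) m n x :
  name f (m + n) x = glue (name f m x, name f n (iter m T x)).
Proof.
apply/ffunP => j; rewrite !ffunE/=; case: splitP => i ji; rewrite !ffunE ji//.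
by rewrite addnC iterD.
Qed.

Lemma fibers_name A (f : X -> A) n : fibers_measurable D f ->
  fibers_measurable D (name f n).
Proof.
move=> mf; elim: n => [|n IH].
  move=> w; rewrite (_ : _ @^-1` _ = setT) ?setIT//.
  by apply/seteqP; split => // x _ /=; apply/ffunP => -[].
have m1 : fibers_measurable D (name f 1).
  apply: (@eq_fibers _ _ _ _ ((fun a => [ffun _ => a] : {ffun 'I_1 -> A}) \o f)).
    by move=> x _; apply/ffunP => j; rewrite !ffunE ord1.
  exact: fibers_comp.
have := fibers_comp (@glue A 1 n) (fibers_pair m1 (fibers_T IH)).
by apply: eq_fibers => x _; rewrite /= -nameD.
Qed.

Lemma entropy_nameD A (f : X -> A) m n : fibers_measurable D f ->
  entropy mu D (name f (m + n)) <= entropy mu D (name f m) + entropy mu D (name f n).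
Proof.
move=> mf; have mm : fibers_measurable D (name f m) := fibers_name mf.
have mn : fibers_measurable D (name f n) := fibers_name mf.
have mn' := fibers_iterT m mn.
have -> : entropy mu D (name f n) = entropy mu D (name f n \o iter m T).
  by rewrite /entropy law_iterT.
apply: le_trans (entropy_pair muD mm mn').
have := entropy_comp mu (@glue A m n) (fibers_pair mm mn').
by apply: le_trans; rewrite (@eq_entropy _ _ _ _ _ _ _ (name f (m + n)))// => x _ /=; rewrite -nameD.
Qed.

Lemma entropy_name_le A (f : X -> A) n : fibers_measurable D f ->
  entropy mu D (name f n) <= n%:R * entropy mu D f.
Proof.
move=> mf.
have h1 : entropy mu D (name f 1) <= entropy mu D f.
  have := entropy_comp mu (fun a => [ffun _ => a] : {ffun 'I_1 -> A}) mf.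
  apply: le_trans; rewrite le_eqVlt; apply/orP; left; apply/eqP.
  by apply: eq_entropy => x _; apply/ffunP => j; rewrite !ffunE ord1.
elim: n => [|n IH].
  rewrite mul0r /entropy (_ : law mu D _ = fun=> 1); last first.
    apply/funext => w; rewrite /law (_ : _ @^-1` _ = setT) ?setIT ?muD//.
    by apply/seteqP; split => // x _ /=; apply/ffunP => -[].
  by rewrite ln1; under eq_bigr do rewrite mulr0; rewrite big1// oppr0.
rewrite -add1n (le_trans (entropy_nameD _ _ mf))// natrD mulrDl mul1r.
exact: lerD.
Qed.

Lemma entropy_name_cvg A (f : X -> A) : fibers_measurable D f ->
  exists2 l : R, n%:R^-1 * entropy mu D (name f n) @[n --> \oo] --> l &
    forall n, n%:R * l <= entropy mu D (name f n).
Proof.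
move=> mf; apply: fekete => [n|m n]; last exact: entropy_nameD.
exact/entropy_ge0/fibers_name.
Qed.

Lemma refined_partitionE A (P : A -> set X) (f : X -> A) n (w : {ffun 'I_n -> A}) :
  (forall x i, D x -> P i x <-> f x = i) ->
  refined_partition D T P w = D `&` name f n @^-1` [set w].
Proof.
move=> Pf; apply/seteqP; split => x [Dx /= xw]; split=> //.
  by apply/ffunP => j; rewrite ffunE; apply/Pf => //; exact: iterTD.
by move=> j; rewrite -xw; apply/Pf; [exact: iterTD|rewrite ffunE].
Qed.

Lemma entropy_of_partitionE A (P : A -> set X) (f : X -> A) (l : R) :
  (forall x i, D x -> P i x <-> f x = i) ->
  n%:R^-1 * entropy mu D (name f n) @[n --> \oo] --> l ->
  entropy_of_partition D T mu P = l%:E.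
Proof.
move=> Pf fl; have Pn n : partition_entropy mu (refined_partition D T P (n := n)) =
    entropy mu D (name f n).
  rewrite /partition_entropy /entropy; congr (- _); apply: eq_bigr => w _.
  by rewrite (refined_partitionE _ Pf).
rewrite /entropy_of_partition; under eq_fun do rewrite Pn.
by apply/cvg_lim => //; apply: cvg_EFin => //; exact: nearW.
Qed.

Lemma partition_label k (P : 'I_k -> set X) : is_partition D P ->
  exists f : X -> 'I_k, fibers_measurable D f /\
    (forall x i, D x -> P i x <-> f x = i).
Proof.
move=> [mP tP PD].
have [x0 Dx0] : exists x, D x.
  apply: contrapT => /forallNP D0; move: muD.
  rewrite (_ : D = set0) ?measure0; last by rewrite -subset0 => x /D0.
  by move=> /eqP; rewrite lt_eqF ?lte01.
have [i0 _ _] : exists2 i, [set: 'I_k] i & P i x0 by move: Dx0; rewrite -PD.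
pose f x := odflt i0 [pick i | x \in P i].
have Pf x i : D x -> P i x <-> f x = i.
  move=> Dx; have [j _ Pjx] : exists2 j, [set: 'I_k] j & P j x by move: Dx; rewrite -PD.
  rewrite /f; case: pickP => [i' /set_mem Pi'|/(_ j)] /=.
    by split=> [Pix|<-//]; apply: (tP i' i I I); exists x.
  by rewrite mem_set.
exists f; split=> // i; rewrite (_ : _ `&` _ = P i)//.
apply/seteqP; split => x /=; first by case=> Dx /Pf; apply.
move=> Pix; have Dx : D x by rewrite -PD; exists i.
by split=> //; exact/Pf.
Qed.

Lemma ks_entropy_gt (v : R) : (v%:E < ks_entropy D T mu)%E ->
  exists k (f : X -> 'I_k), fibers_measurable D f /\
    forall n, n%:R * v <= entropy mu D (name f n).
Proof.
move=> /ereal_sup_gt[_ [k [P [partP ->]]] vP].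
have [f [mf Pf]] := partition_label partP; exists k, f; split=> // n.
have [l fl ln] := entropy_name_cvg mf.
move: vP; rewrite (entropy_of_partitionE Pf fl) lte_fin => /ltW vl.
by rewrite (le_trans _ (ln n))// ler_wpM2l.
Qed.

(** The lower bound on the entropy of names may be checked along an increasing
    subsequence and up to a constant, since the limit over all times exists. *)
Lemma ks_entropy_ge k (f : X -> 'I_k) (a : nat -> nat) (v C : R) :
  fibers_measurable D f -> (forall m, m < a m)%N -> 0 <= C ->
  (forall m, (a m)%:R * v - C <= entropy mu D (name f (a m))) ->
  (v%:E <= ks_entropy D T mu)%E.
Proof.
move=> mf ma C0 va; have [l fl ln] := entropy_name_cvg mf.
have Pf x i : D x -> (D `&` f @^-1` [set i]) x <-> f x = i.
  by move=> Dx; split=> [[]|].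
apply: (@le_trans _ _ l%:E); last first.
  apply: ereal_sup_ubound; exists k, (fun i => D `&` f @^-1` [set i]).
  split; last by rewrite (entropy_of_partitionE Pf fl).
  split=> //; first by move=> i j _ _ [x [[_ /= <-] [_ /= <-]]].
  by apply/seteqP; split=> [x [i _ []]//|x Dx]; exists (f x).
rewrite lee_fin.
have h1 : (v - C * m.+1%:R^-1) @[m --> \oo] --> v.
  rewrite -[X in _ --> X]subr0 -(mulr0 C); apply: cvgB; first exact: cvg_cst.
  by apply: cvgM; [exact: cvg_cst|exact: cvg_harmonic].
have h2 : (a m)%:R^-1 * entropy mu D (name f (a m)) @[m --> \oo] --> l.
  apply: (cvg_comp a (fun n => n%:R^-1 * entropy mu D (name f n)) _ fl).
  by move=> A [N _ NA]; exists N => // m /= Nm; apply: NA => /=; exact: leq_trans (ltnW (ma m)).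
rewrite -(cvg_lim (@Rhausdorff R) h1) -(cvg_lim (@Rhausdorff R) h2).
apply: ler_lim (cvgP _ h1) (cvgP _ h2) _; near=> m.
have am : 0 < (a m)%:R :> R by rewrite ltr0n (leq_ltn_trans _ (ma m)).
rewrite ler_pdivlMl// (le_trans _ (va m))// mulrBr lerD2l lerN2.
by rewrite mulrCA ler_peMr// ler_pdivlMr// mul1r ler_nat.
Unshelve. all: by end_near. Qed.

End Dynamics.

(** * Weak law of large numbers on finite products *)

Section WeakLaw.
Context {R : realType} (T : finType) (p : T -> R).
Hypotheses (p0 : forall t, 0 <= p t) (p1 : \sum_t p t = 1).
Implicit Types f g h : T -> R.

Definition mean f : R := \sum_t p t * f t.

Definition prodp k (w : {ffun 'I_k -> T}) : R := \prod_i p (w i).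

Lemma prodp_ge0 k (w : {ffun 'I_k -> T}) : 0 <= prodp w.
Proof. exact: prodr_ge0. Qed.

Lemma sum_prodp k : \sum_(w : {ffun 'I_k -> T}) prodp w = 1.
Proof.
by rewrite -(bigA_distr_bigA (fun _ : 'I_k => p)) big1// => i _; exact: p1.
Qed.

Lemma prod_at k (i : 'I_k) (x : 'I_k -> R) :
  \prod_l (if l == i then x l else 1) = x i.
Proof. by rewrite -big_mkcond/= big_pred1_eq. Qed.

(** The sum over w factors by independence, and off the diagonal one of the factors is
    the mean of h. *)
Lemma mean_pair k h (i j : 'I_k) : mean h = 0 ->
  \sum_(w : {ffun 'I_k -> T}) prodp w * (h (w i) * h (w j)) =
  if i == j then mean (fun t => h t ^+ 2) else 0.
Proof.
move=> h0.
pose F (l : 'I_k) t := p t * ((if l == i then h t else 1) * (if l == j then h t else 1)).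
have -> : \sum_(w : {ffun 'I_k -> T}) prodp w * (h (w i) * h (w j)) =
    \prod_l \sum_t F l t.
  rewrite bigA_distr_bigA; apply: eq_bigr => w _; rewrite /F !big_split/=.
  by rewrite (prod_at i (fun l => h (w l))) (prod_at j (fun l => h (w l))).
have [ij|ij] := eqVneq i j.
  rewrite (bigD1 i)//= [X in _ * X]big1 ?mulr1; last first.
    move=> l li; rewrite -[RHS]p1; apply: eq_bigr => t _.
    by rewrite /F -ij (negbTE li) !mulr1.
  by rewrite /mean; apply: eq_bigr => t _; rewrite /F -ij eqxx expr2.
rewrite (bigD1 i)//= [X in X * _](_ : _ = 0) ?mul0r// -[RHS]h0 /mean.
by apply: eq_bigr => t _; rewrite /F eqxx (negbTE ij) mulr1.
Qed.

Lemma variance_sum k h : mean h = 0 ->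
  \sum_(w : {ffun 'I_k -> T}) prodp w * (\sum_i h (w i)) ^+ 2 =
  k%:R * mean (fun t => h t ^+ 2).
Proof.
move=> h0; transitivity (\sum_(w : {ffun 'I_k -> T}) \sum_i \sum_j
    prodp w * (h (w i) * h (w j))).
  apply: eq_bigr => w _; rewrite expr2 mulr_suml mulr_sumr; apply: eq_bigr => i _.
  by rewrite mulr_sumr mulr_sumr.
rewrite exchange_big/=; under eq_bigr do rewrite exchange_big/=.
under eq_bigr => i _ do under eq_bigr => j _ do rewrite (mean_pair i j h0).
rewrite (eq_bigr (fun=> mean (fun t => h t ^+ 2))) => [|i _].
  by rewrite sumr_const card_ord mulr_natl.
by rewrite -big_mkcond/= (big_pred1 i)// => j; rewrite eq_sym.
Qed.

Definition near_mean f k (e : R) (w : {ffun 'I_k -> T}) : bool :=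
  `|\sum_i f (w i) - k%:R * mean f| <= k%:R * e.

Lemma chebyshev_prodp f k (e : R) : (0 < k)%N -> 0 < e ->
  \sum_(w : {ffun 'I_k -> T} | ~~ near_mean f e w) prodp w <=
  mean (fun t => (f t - mean f) ^+ 2) / (k%:R * e ^+ 2).
Proof.
move=> k0 e0; set h := fun t => f t - mean f.
have h0 : mean h = 0.
  rewrite /mean /h; under eq_bigr do rewrite mulrBr.
  by rewrite sumrB -mulr_suml p1 mul1r subrr.
have kR : 0 < k%:R :> R by rewrite ltr0n.
have ke : 0 < k%:R * e by rewrite mulr_gt0.
have hk : 0 < k%:R * e ^+ 2 by rewrite mulr_gt0// exprn_gt0.
rewrite ler_pdivlMr// -(ler_pM2l kR) -variance_sum//.
have kke : k%:R * (k%:R * e ^+ 2) = (k%:R * e) ^+ 2 by ring.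
rewrite [leLHS]mulrCA kke.
rewrite mulr_suml big_mkcond/=; apply: ler_sum => w _.
case: ifPn => [|_]; last by rewrite mulr_ge0 ?prodp_ge0 ?sqr_ge0.
rewrite /near_mean -ltNge => far; rewrite ler_wpM2l ?prodp_ge0//.
have -> : \sum_i h (w i) = \sum_i f (w i) - k%:R * mean f.
  by rewrite /h sumrB sumr_const card_ord mulr_natl.
rewrite -[leRHS]real_normK ?num_real// ler_pXn2r ?nnegrE ?normr_ge0 ?(ltW far)//.
exact: ltW.
Qed.

Lemma weak_law f (e c : R) : 0 < e -> 0 < c -> \forall k \near \oo,
  \sum_(w : {ffun 'I_k -> T} | ~~ near_mean f e w) prodp w <= c.
Proof.
move=> e0 c0; pose V := mean (fun t => (f t - mean f) ^+ 2).
near=> k.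
have k0 : (0 < k)%N by near: k; exists 1%N.
rewrite (le_trans (chebyshev_prodp _ k0 e0))// ler_pdivrMr; last first.
  by rewrite mulr_gt0 ?ltr0n// exprn_gt0.
rewrite mulrCA -ler_pdivrMr ?mulr_gt0 ?exprn_gt0//.
near: k; exact: nbhs_infty_ger.
Unshelve. all: by end_near. Qed.

(** The bound 1/2 could be any number below 1: a constant factor has no effect on
    exponential rates. *)
Lemma weak_law2 f g (e : R) : 0 < e -> \forall k \near \oo,
  1 / 2 <= \sum_(w : {ffun 'I_k -> T} | near_mean f e w && near_mean g e w) prodp w.
Proof.
move=> e0; have c0 : 0 < 1 / 4 :> R by rewrite divr_gt0.
near=> k.
have hf : \sum_(w : {ffun 'I_k -> T} | ~~ near_mean f e w) prodp w <= 1 / 4.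
  by near: k; exact: weak_law.
have hg : \sum_(w : {ffun 'I_k -> T} | ~~ near_mean g e w) prodp w <= 1 / 4.
  by near: k; exact: weak_law.
have := sum_prodp k; rewrite (bigID (fun w => near_mean f e w && near_mean g e w))/=.
have : \sum_(w : {ffun 'I_k -> T} | ~~ (near_mean f e w && near_mean g e w)) prodp w
    <= \sum_(w : {ffun 'I_k -> T} | ~~ near_mean f e w) prodp w +
       \sum_(w : {ffun 'I_k -> T} | ~~ near_mean g e w) prodp w.
  rewrite big_mkcond [X in _ <= X + _]big_mkcond [X in _ <= _ + X]big_mkcond.
  rewrite -big_split/=; apply: ler_sum => w _; have := prodp_ge0 w.
  by case: near_mean; case: near_mean => /=; lra.
move: hf hg; set a := \sum_(w | _ && _) _; lra.
Unshelve. all: by end_near. Qed.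

End WeakLaw.

(** * Words, averages and blocks *)

Section WordAverages.
Context {R : realType}.
Implicit Types (psi : nat -> R) (w u v : seq nat) (J : interval R).

Definition word_sum psi w : R := \sum_(a <- w) psi a.+2.

Lemma word_sum_cat psi u v : word_sum psi (u ++ v) = word_sum psi u + word_sum psi v.
Proof. exact: big_cat. Qed.

Lemma digit_averageE psi n x : I01 x ->
  digit_average psi n x = n%:R^-1 * word_sum psi (itin n x).
Proof.
move=> x01; congr (_ * _); rewrite /word_sum /itin big_map -{2}[n]subn0 -/(index_iota 0 n).
rewrite big_add1/=; apply: eq_bigr => j _; congr psi.
exact: digitE.
Qed.

Lemma sum_digit_fun psi n (x : R) : I01 x ->
  \sum_(j < n) psi (digit 1 (iter j renyi x)) = word_sum psi (itin n x).
Proof.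
move=> x01; rewrite /word_sum /itin big_map.
have -> : iota 0 n = index_iota 0 n by rewrite /index_iota subn0.
rewrite big_mkord; apply: eq_bigr => j _; congr psi; rewrite (digitE 0)//.
exact: iter_renyi_I01.
Qed.

Definition avg_set psi J n : set R := [set x : R | I01 x /\ digit_average psi n x \in J].

(** Countability of the set of words gives measurability of the average set. *)
Lemma avg_setE psi J n : avg_set psi J n =
  \bigcup_w (if (size w == n) && (n%:R^-1 * word_sum psi w \in J) then cyl w else set0).
Proof.
apply/seteqP; split => [x [x01 xJ]|x [w _]].
  by exists (itin n x) => //; rewrite size_itin eqxx/= -digit_averageE// xJ; split=> //; rewrite size_itin.
case: ifPn => // /andP[/eqP wn wJ] [x01 xw]; split=> //.
by rewrite digit_averageE// -wn xw wn.
Qed.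

Lemma measurable_avg_set psi J n : measurable (avg_set psi J n).
Proof.
rewrite avg_setE; apply: countable_bigcupT_measurable; first exact: countableP.
by move=> w; case: ifP => // _; exact: measurable_cyl.
Qed.

Lemma cyl_disjoint u v : size u = size v -> (cyl u : set R) `&` cyl v !=set0 -> u = v.
Proof. by move=> uv [x [[_ xu] [_ xv]]]; rewrite -xu -xv uv. Qed.

Section Blocks.
Variables N L : nat.
Implicit Types (t : N.-tuple 'I_L) (s : seq (N.-tuple 'I_L)).

Definition tword t : seq nat := [seq nat_of_ord i | i <- t].

Lemma size_tword t : size (tword t) = N.
Proof. by rewrite size_map size_tuple. Qed.

Lemma tword_inj : injective tword.
Proof. by move=> t t' /inj_map-/(_ val_inj)/val_inj. Qed.

Lemma tword_bounded t : all (fun a => a < L)%N (tword t).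
Proof. by apply/allP => _ /mapP[i _ ->]. Qed.

Definition blocks s : seq nat := flatten [seq tword t | t <- s].

Lemma size_blocks s : size (blocks s) = (size s * N)%N.
Proof.
elim: s => //= t s IH; rewrite /blocks/= size_cat size_tword -/(blocks s) IH.
by rewrite mulSn.
Qed.

Lemma blocks_bounded s : all (fun a => a < L)%N (blocks s).
Proof.
by elim: s => //= t s IH; rewrite /blocks/= all_cat tword_bounded.
Qed.

Lemma blocks_inj s s' : size s = size s' -> blocks s = blocks s' -> s = s'.
Proof.
elim: s s' => [|t s IH] [|t' s']//= [ss'] /eqP.
by rewrite /blocks/= eqseq_cat ?size_tword// => /andP[/eqP/tword_inj -> /eqP/(IH _ ss') ->].
Qed.

Lemma word_sum_blocks psi s :
  word_sum psi (blocks s) = \sum_(t <- s) word_sum psi (tword t).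
Proof.
elim: s => [|t s IH]; first by rewrite /word_sum !big_nil.
by rewrite big_cons -IH -word_sum_cat.
Qed.

(** Quasi-multiplicativity of [len]: each concatenation costs a factor N + 1,
    hence a rate (1/N) ln (N + 1) that disappears for long blocks. *)
Lemma len_blocks s v :
  \prod_(t <- s) (len (tword t) / N.+1%:R) * len v <= len (blocks s ++ v) :> R.
Proof.
elim: s => [|t s IH]; first by rewrite big_nil mul1r.
rewrite big_cons /blocks/= -catA (le_trans _ (len_cat _ _))// size_tword.
rewrite -mulrA [leRHS]mulrAC ler_wpM2l// divr_ge0// ltW ?len_gt0//.
Qed.

Definition ffun_seq k (w : {ffun 'I_k -> N.-tuple 'I_L}) : seq (N.-tuple 'I_L) :=
  [seq w i | i <- enum 'I_k].

Lemma size_ffun_seq k (w : {ffun 'I_k -> N.-tuple 'I_L}) : size (ffun_seq w) = k.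
Proof. by rewrite size_map size_enum_ord. Qed.

Lemma ffun_seq_inj k : injective (@ffun_seq k).
Proof.
move=> w w' /eq_in_map ww'; apply/ffunP => i; apply: ww'.
by rewrite mem_enum.
Qed.

Lemma big_ffun_seq (S : Type) (idx : S) (op : Monoid.com_law idx) k
    (w : {ffun 'I_k -> N.-tuple 'I_L}) (f : N.-tuple 'I_L -> S) :
  \big[op/idx]_(t <- ffun_seq w) f t = \big[op/idx]_i f (w i).
Proof. by rewrite big_map big_enum. Qed.

End Blocks.

Lemma tword_surj N L w : size w = N -> all (fun a => a < L)%N w ->
  exists t : N.-tuple 'I_L, tword t = w.
Proof.
move=> <-{N}; elim: w => [_|a w IH /= /andP[aL /IH[t tw]]]; first by exists [tuple].
by exists [tuple of Ordinal aL :: t]; rewrite /tword/= -/(tword t) tw.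
Qed.

End WordAverages.

(** * Measure of an average set from a distribution on words *)

Section LowerBound.
Context {R : realType}.
Variables (psi : nat -> R) (N L : nat).
Hypothesis N0 : (0 < N)%N.
Implicit Types (t : N.-tuple 'I_L) (J : interval R).

(** The mean of [gain p] under p is the entropy of p minus its mean
    energy [- ln (len w)], up to the distortion term ln (N + 1): a finite version of
    the free energy. *)
Definition gain (p : N.-tuple 'I_L -> R) t : R :=
  ln (len (tword t) / N.+1%:R) - ln (p t).

(** A word of length n made of k blocks of length N; the gap, shorter than N, is
    filled with the letter 0. *)
Definition padded k n (w : {ffun 'I_k -> N.-tuple 'I_L}) : seq nat :=
  blocks (ffun_seq w) ++ nseq (n - k * N) 0%N.

Lemma size_padded k n (w : {ffun 'I_k -> N.-tuple 'I_L}) : (k * N <= n)%N ->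
  size (padded n w) = n.
Proof.
by move=> kn; rewrite size_cat size_nseq size_blocks size_ffun_seq subnKC.
Qed.

Lemma measure_padded k n (V : pred {ffun 'I_k -> N.-tuple 'I_L}) : (k * N <= n)%N ->
  lebesgue_measure (\bigcup_(w in [set` V]) (cyl (padded n w) : set R)) =
  (\sum_(w | V w) len (padded n w))%:E.
Proof.
move=> kn; rewrite measure_bigcup_fin//; last 2 first.
- by move=> w; exact: measurable_cyl.
- move=> w w' _ _ /cyl_disjoint; rewrite !size_padded// => /(_ erefl)/eqP.
  rewrite eqseq_cat ?size_blocks ?size_ffun_seq// => /andP[/eqP + _].
  by move=> /blocks_inj; rewrite !size_ffun_seq => /(_ erefl)/ffun_seq_inj.
by rewrite -sumEFin; apply: eq_bigr => w _; exact: lebesgue_cyl.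
Qed.

Variable p : N.-tuple 'I_L -> R.
Hypotheses (p0 : forall t, 0 <= p t) (p1 : \sum_t p t = 1).

Lemma prodp_le_len k n (w : {ffun 'I_k -> N.-tuple 'I_L}) :
  prodp p w * expR (\sum_i gain p (w i)) * len (nseq (n - k * N) 0%N) <= len (padded n w).
Proof.
apply: le_trans (len_blocks _ _); rewrite big_ffun_seq ler_wpM2r//.
  exact/ltW/len_gt0.
rewrite expR_sum -big_split/=; apply: ler_prod => i _.
rewrite mulr_ge0 ?expR_ge0//=; have := p0 (w i).
have l0 : 0 < len (tword (w i)) / N.+1%:R :> R by rewrite divr_gt0 ?len_gt0.
rewrite le_eqVlt => /predU1P[<-|pw]; first by rewrite mul0r ltW.
by rewrite /gain expRB !lnK ?posrE// mulrCA mulfV ?gt_eqF// mulr1.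
Qed.

(** Among k independent blocks of law p, with probability at least 1/2 both the
    sum of [psi] and the sum of the gains are close to k times their mean.  Each
    such block word has length at least its probability times the exponential of
    its gain, so together the corresponding cylinders have measure at least about
    exp(k mean gain), and the average of [psi] on them is in J. *)
Lemma avg_set_lower J (r e : R) : 0 < r -> 0 < e ->
  (forall x, `|x - N%:R^-1 * mean p (word_sum psi \o @tword N L)| < r -> x \in J) ->
  \forall n \near \oo, ((expR (n%:R * (N%:R^-1 * mean p (gain p) - e)))%:E <=
    lebesgue_measure (avg_set psi J n))%E.
Proof.
move=> r0 e0 Jr; set f := word_sum psi \o @tword N L in Jr *.
set m := mean p f in Jr; set G := mean p (gain p).
pose a := Num.min (r / 4) (e / 2).
have a0 : 0 < a by rewrite /a lt_min !divr_gt0.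
have [k0 _ Hk] := weak_law2 p0 p1 f (gain p) a0.
have NR : 0 < N%:R :> R by rewrite ltr0n.
pose C := ln 2 + N%:R * ln 4 + `|G|.
near=> n.
pose k := (n %/ N)%N.
have kn : (k * N <= n)%N by exact: leq_trunc_div.
have nk : (n - k * N < N)%N by rewrite {1}(divn_eq n N) addKn ltn_mod.
have n0 : 0 < n%:R :> R by rewrite ltr0n; near: n; exists 1%N.
pose V := [pred w : {ffun 'I_k -> N.-tuple 'I_L} | near_mean p f a w && near_mean p (gain p) a w].
have V12 : 1 / 2 <= \sum_(w | V w) prodp p w.
  apply: Hk; rewrite /= leq_divRL//; near: n.
  by exists (k0 * N)%N.
(* q letters are left over after k blocks; they are too few to matter. *)
pose q := (n - k * N)%N; have qE : n%:R = k%:R * N%:R + q%:R :> R.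
  by rewrite -natrM -natrD subnKC.
have qN : q%:R <= N%:R :> R by rewrite ler_nat ltnW.
have kn' : k%:R <= n%:R :> R.
  by rewrite ler_nat leq_div.
have sub : \bigcup_(w in [set` V]) (cyl (padded n w) : set R) `<=` avg_set psi J n.
  move=> x [w Vw]; rewrite /cyl/= size_padded// => -[x01 xw]; split=> //.
  apply: Jr; rewrite digit_averageE// xw word_sum_cat word_sum_blocks big_ffun_seq.
  move: Vw => /= /andP[+ _]; rewrite /near_mean/= -/m -/f -/q.
  set S := \sum_i _ => Sm.
  have -> : word_sum psi (nseq q 0%N) = q%:R * psi 2%N.
    by rewrite /word_sum big_nseq -Monoid.iteropE -[iterop _ _ _ _]/(psi 2%N *+ q) mulr_natl.
  have -> : n%:R^-1 * (S + q%:R * psi 2%N) - N%:R^-1 * m =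
      n%:R^-1 * ((S - k%:R * m) + q%:R * (psi 2%N - m / N%:R)).
    have nn : n%:R != 0 :> R by rewrite gt_eqF.
    rewrite -[X in _ - X](mulKf nn) -mulrBr [X in _ - X * _]qE; congr (_ * _).
    by field; rewrite gt_eqF.
  rewrite normrM ger0_norm ?invr_ge0// ltr_pdivrMl//.
  rewrite (le_lt_trans (ler_normD _ _))// normrM [`|q%:R|]ger0_norm//.
  have h1 : k%:R * a <= n%:R * (r / 4).
    by rewrite ler_pM ?(ltW a0)// /a ge_min lexx.
  have h2 : q%:R * `|psi 2%N - m / N%:R| <= n%:R * (r / 4).
    rewrite (@le_trans _ _ (N%:R * `|psi 2%N - m / N%:R|)) ?ler_wpM2r//.
    rewrite -ler_pdivrMr ?divr_gt0//; near: n; exact: nbhs_infty_ger.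
  have h3 : 0 < n%:R * r by rewrite mulr_gt0.
  move: Sm h1 h2 h3; lra.
apply: (@le_trans _ _ (lebesgue_measure (\bigcup_(w in [set` V]) (cyl (padded n w) : set R)))); last first.
  apply: le_measure => //; rewrite inE; last exact: measurable_avg_set.
  by apply: fin_bigcup_measurable => // w _; exact: measurable_cyl.
rewrite measure_padded// lee_fin.
have lq : expR (- (N%:R * ln 4)) <= len (nseq q 0%N) :> R.
  have := @len_bounded R 1 (nseq q 0%N); rewrite all_nseq orbT => /(_ isT).
  apply: le_trans; rewrite size_nseq expRN lef_pV2 ?posrE ?expR_gt0 ?mulr_gt0 ?exprn_gt0//.
  rewrite -exprMn -natrM expRM_natl lnK ?posrE//.
  by rewrite ler_weXn2l ?ler1n// ltnW.
apply: (@le_trans _ _ (\sum_(w | V w) prodp p w *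
    (expR (k%:R * G - k%:R * a) * expR (- (N%:R * ln 4))))); last first.
  apply: ler_sum => w /andP[_ Vw]; apply: le_trans (prodp_le_len n w).
  rewrite -mulrA ler_wpM2l ?prodp_ge0// ler_pM ?expR_ge0// ler_expR.
  by move: Vw; rewrite /near_mean ler_distl -/G => /andP[].
rewrite -mulr_suml.
apply: (@le_trans _ _ (expR (- ln 2) * (expR (k%:R * G - k%:R * a) * expR (- (N%:R * ln 4))))).
  rewrite -!expRD ler_expR.
  have h1 : k%:R * a <= n%:R * (e / 2).
    by rewrite ler_pM ?(ltW a0)// /a ge_min lexx orbT.
  have h2 : C <= n%:R * (e / 2).
    rewrite -ler_pdivrMr ?divr_gt0//; near: n; exact: nbhs_infty_ger.
  have h3 : n%:R * (N%:R^-1 * G) <= k%:R * G + `|G|.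
    rewrite qE mulrDl -mulrA mulVKf ?gt_eqF// lerD2l mulrA.
    rewrite (le_trans (ler_norm _))// normrM ler_piMl// ger0_norm; last first.
      by rewrite divr_ge0.
    by rewrite ler_pdivrMr// mul1r.
  move: h1 h2 h3; rewrite /C; lra.
rewrite ler_wpM2r ?mulr_ge0 ?expR_ge0// expRN lnK ?posrE//.
by rewrite -div1r.
Unshelve. all: by end_near. Qed.

End LowerBound.

(** * Measurability *)

Section Measurability.
Context {R : realType}.
Implicit Types (x y : R).

Lemma measurable_I01 : measurable (@I01 R).
Proof. exact: measurable_itv. Qed.

Lemma lebesgue_I01 : lebesgue_measure (@I01 R) = 1%E.
Proof. by rewrite /I01 lebesgue_measure_itv/= lte_fin ltr01 oppr0 adde0. Qed.

Lemma inv_sub_le x y : I01 x -> I01 y -> x <= y -> (1 - x)^-1 <= (1 - y)^-1.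
Proof.
move=> /I01E/andP[x0 x1] /I01E/andP[y0 y1] xy.
by rewrite lef_pV2 ?posrE ?subr_gt0// lerD2l lerN2.
Qed.

(** Measurability of the map and of [phi] on [0, 1) follows from this, both being
    combinations of monotone functions of x. *)
Lemma monotone_measurable (f : R -> R) :
  (forall x y, I01 x -> I01 y -> x <= y -> f x <= f y) -> measurable_fun I01 f.
Proof.
move=> f_nd _; apply: (measurability (@RGenCInfty.G R)) measurable_I01.
  exact: RGenCInfty.measurableE.
move=> _ [_ [r ->] <-]; apply: is_interval_measurable => s t/=.
move=> [sI fs] [tI _] u /andP[su ut].
rewrite /= in_itv/= andbT in fs.
have uI : I01 u.
  move/I01E : sI => /andP[s0 _]; move/I01E : tI => /andP[_ t1]; apply/I01E.
  by rewrite (le_trans s0 su) (le_lt_trans ut t1).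
by split=> //; rewrite in_itv/= andbT (le_trans fs)// f_nd.
Qed.

Lemma measurable_renyi : measurable_fun I01 (@renyi R).
Proof.
apply: measurable_funB; apply: monotone_measurable => x y x01 y01 xy.
  exact: inv_sub_le.
by rewrite ler_int le_floor// inv_sub_le.
Qed.

Lemma measurable_phi : measurable_fun I01 (@phi R).
Proof.
apply: measurable_funN; apply: measurableT_comp; first exact: measurable_ln.
apply: monotone_measurable => x y x01 y01 xy; rewrite /renyi_deriv -!exprVn.
rewrite ler_pXn2r ?nnegrE ?invr_ge0 ?subr_ge0 ?inv_sub_le//.
  by move/I01E : x01 => /andP[_ /ltW].
by move/I01E : y01 => /andP[_ /ltW].
Qed.

Lemma renyi_preimage (B : set R) : measurable B -> measurable (I01 `&` @renyi R @^-1` B).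
Proof. by move=> mB; exact: (measurable_renyi measurable_I01). Qed.

Lemma letter_cyl a : I01 `&` @letter R @^-1` [set a] = cyl [:: a].
Proof.
apply/seteqP; split => x /=; rewrite /cyl/= itinS /=.
  by case=> x01 <-.
by case=> x01 [].
Qed.

Lemma fibers_letter : fibers_measurable I01 (@letter R).
Proof. by move=> a; rewrite letter_cyl; exact: measurable_cyl. Qed.

Lemma fibers_letter_comp (A : eqType) (h : nat -> A) :
  fibers_measurable I01 (fun x => h (letter x)).
Proof.
move=> a; rewrite (_ : _ `&` _ = \bigcup_n (if h n == a then
    I01 `&` @letter R @^-1` [set n] else set0)).
  apply: countable_bigcupT_measurable; first exact: countableP.
  by move=> n; case: ifP => // _; exact: fibers_letter.
apply/seteqP; split => [x [x01 /= xa]|x [n _]].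
  by exists (letter x) => //; rewrite xa eqxx.
by case: eqP => // ha [x01 /= xn]; split=> //=; rewrite xn.
Qed.

(** All letters from M on are merged, which gives a finite partition. *)
Definition letter_trunc M x : 'I_M.+1 := inord (minn (letter x) M).

Lemma fibers_letter_trunc M : fibers_measurable I01 (letter_trunc M : R -> _).
Proof. exact: (fibers_letter_comp (fun l => inord (minn l M) : 'I_M.+1)). Qed.

Lemma fibers_digit : fibers_measurable I01 (@digit R 1).
Proof.
apply: eq_fibers (fibers_letter_comp (fun l => l.+2)) => x /set_mem x01.
by rewrite (digitE 0).
Qed.

Lemma measurable_fun_fibers (A : countType) (f : R -> A) (g : A -> R) :
  fibers_measurable I01 f -> measurable_fun I01 (g \o f).
Proof.
move=> mf _ B mB; rewrite (_ : _ `&` _ =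
   \bigcup_a (if `[< B (g a) >] then I01 `&` f @^-1` [set a] else set0)).
  apply: countable_bigcupT_measurable; first exact: countableP.
  by move=> a; case: ifP.
apply/seteqP; split => [x [x01 /= Bx]|x [a _]].
  by exists (f x) => //; case: asboolP.
by case: asboolP => // Bga [x01 /= fx]; split=> //=; rewrite fx.
Qed.

Lemma measurable_digit_fun (psi : nat -> R) : measurable_fun I01 (fun x => psi (digit 1 x)).
Proof. exact: (measurable_fun_fibers psi fibers_digit). Qed.

Lemma measurable_word_map w : measurable_fun I01 (@word_map R w).
Proof.
apply: monotone_measurable => x y /I01E/andP[x0 _] _; exact: word_map_ler.
Qed.

End Measurability.

(** * Coding by the expanding map u |-> K u mod 1 *)

(** The canonical measure structure of [pushforward m f], given a name in order to
    be usable as an argument. *)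
Definition image_measure d d' (X : measurableType d) (Y : measurableType d')
    (R : realType) (m : {measure set X -> \bar R}) (f : X -> Y)
    (mf : measurable_fun setT f) : {measure set Y -> \bar R} :=
  measure_function_pushforward__canonical__measure_function_Measure m mf.

Lemma measurable_affine {R : realType} (c b : R) :
  measurable_fun setT (fun u : R => c * u - b).
Proof. by apply: measurable_funB => //; exact: mulrl_measurable. Qed.

(** Uniqueness of Lebesgue measure, checked on intervals. *)
Lemma lebesgue_affine {R : realType} (c b : R) (B : set R) : 0 < c -> measurable B ->
  lebesgue_measure ((fun u : R => c * u - b) @^-1` B) = (c^-1%:E * lebesgue_measure B)%E.
Proof.
move=> c0 mB; pose f : R -> R := fun u => c * u - b.
have mf : measurable_fun setT (f : measurableTypeR R -> measurableTypeR R).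
  exact: measurable_affine.
pose m : {measure set (measurableTypeR R) -> \bar R} :=
  mscale (NngNum (ltW c0)) (image_measure lebesgue_measure mf).
have -> : lebesgue_measure B = m B.
  apply: lebesgue_measure_unique => // _ [[x y] _ <-].
  rewrite /m/= /mscale/= /pushforward.
  rewrite (_ : f @^-1` _ = `](x + b) / c, (y + b) / c]%classic); last first.
    apply/seteqP; split => u /=; rewrite !in_itv/= /f ltr_pdivrMr// ler_pdivlMr// ![_ * c]mulrC => /andP[h1 h2]; apply/andP; split; lra.
  rewrite !lebesgue_measure_itv/= !lte_fin ltr_pM2r ?invr_gt0// ltrD2r.
  case: ifPn => _; last by rewrite mule0.
  by rewrite -!EFinB -EFinM; congr EFin; field; rewrite gt_eqF.
rewrite /m/= /mscale/= muleA -EFinM mulVf ?gt_eqF// mul1e.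
by [].
Qed.

(** A point u of [0, 1) distributed according to Lebesgue measure has independent
    uniform digits in base K + 1.  Reading the word W i for each digit i turns these
    into the backward continued fraction expansion of [code u], and [expand],
    the shift on base K + 1 digits, becomes the N-th iterate of the map. *)
Section Coding.
Context {R : realType} (N L K : nat) (W : 'I_K.+1 -> N.-tuple 'I_L).
Hypotheses (N0 : (0 < N)%N) (Winj : injective W).
Implicit Types u x y : R.

Definition block_index u : 'I_K.+1 := inord (Num.truncn (K.+1%:R * u)).

Definition expand u : R := K.+1%:R * u - (block_index u)%:R.

Definition block_word u : seq nat := tword (W (block_index u)).

(** [code] is obtained as the limit of finite expansions ended by 0; they increase
    with n because [word_map] is increasing and 0 is the least value. *)
Fixpoint code_approx n u : R :=
  if n is n'.+1 then word_map (block_word u) (code_approx n' (expand u)) else 0.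

Definition code u : R := limn (code_approx ^~ u).

Lemma code_approx_ge0 n u : 0 <= code_approx n u.
Proof. by elim: n u => //= n IH u; exact: word_map_ge0. Qed.

(** A bound away from 1 is needed, for the limit to stay in [0, 1); it holds because
    the first letter of a block is smaller than L. *)
Lemma code_approx_le n u : code_approx n u <= 1 - L.+1%:R^-1.
Proof.
have L1 : L.+1%:R^-1 <= 1 :> R by rewrite invf_le1// ler1n.
elim: n u => [|n IH] u /=; first by rewrite subr_ge0.
have c0 := code_approx_ge0 n (expand u).
have c1 : code_approx n (expand u) <= 1 by rewrite (le_trans (IH _))// gerBl.
rewrite /block_word; have := tword_bounded (W (block_index u)).
have := size_tword (W (block_index u)).
case: (tword _) => [/= N0'|a w _ /= /andP[aL _]]; first by move: N0; rewrite -N0'.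
by rewrite branch_le// word_map_ge0//= word_map_le1.
Qed.

Lemma code_approx_nd u : nondecreasing_seq (code_approx ^~ u).
Proof.
apply/nondecreasing_seqP => n; elim: n u => [|n IH] u; first exact: code_approx_ge0.
rewrite [code_approx n.+2 u]/= [code_approx n.+1 u]/=.
by rewrite word_map_ler// ?code_approx_ge0.
Qed.

Lemma code_cvg u : code_approx ^~ u @ \oo --> code u.
Proof.
apply: nondecreasing_is_cvgn; first exact: code_approx_nd.
by exists (1 - L.+1%:R^-1) => _ [n _ <-]; exact: code_approx_le.
Qed.

Arguments code_cvg : clear implicits.

Lemma code_I01 u : I01 (code u).
Proof.
have cu := code_cvg u.
apply/I01E; apply/andP; split.
  by apply: limr_ge; [exact: cvgP cu|near=> n; exact: code_approx_ge0].
apply: (@le_lt_trans _ _ (1 - L.+1%:R^-1)); last by rewrite gtrBl invr_gt0.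
by apply: limr_le; [exact: cvgP cu|near=> n; exact: code_approx_le].
Unshelve. all: by end_near. Qed.

(** Pass to the limit in the recursion; [word_map] is 1-Lipschitz on [0, 1) by
    [word_map_sub], since [den] is at least 1. *)
Lemma codeE u : code u = word_map (block_word u) (code (expand u)).
Proof.
have c1 : code_approx ^~ u @ \oo --> code u := code_cvg u.
have c2 := code_cvg (expand u).
move: c1; rewrite -(cvg_shiftS (code_approx ^~ u)).
move=> /(@cvg_unique _ (@Rhausdorff R)); apply.
have /I01E/andP[e0 _] := code_I01 (expand u).
apply/cvgrPdist_le => e e_gt0; move/cvgrPdist_le : c2 => /(_ e e_gt0).
apply: filterS => n /= h; have c0 := code_approx_ge0 n (expand u).
rewrite word_map_sub// normrM (le_trans _ h)// ler_piMr// normfV.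
rewrite ger0_norm ?mulr_ge0 ?(ltW (den_gt0 _ _))//.
by rewrite invf_le1 ?mulr_gt0 ?den_gt0// mulr_ege1// den_ge1.
Qed.

Lemma size_block_word u : size (block_word u) = N.
Proof. exact: size_tword. Qed.

Lemma itin_code u : itin N (code u) = block_word u.
Proof. by rewrite codeE -{1}(size_block_word u) itin_word_map//; exact: code_I01. Qed.

Lemma iter_code u : iter N renyi (code u) = code (expand u).
Proof. by rewrite {1}codeE -{1}(size_block_word u) iter_word_map//; exact: code_I01. Qed.

Definition block_indices m u := [seq block_index (iter l expand u) | l <- iota 0 m].

Lemma block_indicesS m u :
  block_indices m.+1 u = block_index u :: block_indices m (expand u).
Proof.
rewrite /block_indices/=; congr cons; rewrite (iotaDl 1 0 m) -map_comp.
by apply: eq_map => j /=; rewrite -iterSr.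
Qed.

Lemma itin_code_blocks m u :
  itin (m * N) (code u) = blocks (map W (block_indices m u)).
Proof.
elim: m u => // m IH u; rewrite mulSn itinD itin_code iter_code IH.
by rewrite block_indicesS.
Qed.

(** Because all blocks have the same length N, the digits determine the blocks once
    the position of the first block is known. *)
Lemma block_indices_inj m u v : itin (m * N) (code u) = itin (m * N) (code v) ->
  block_indices m u = block_indices m v.
Proof.
rewrite !itin_code_blocks => /blocks_inj; rewrite !size_map => /(_ erefl).
exact: inj_map.
Qed.

Lemma measurable_block_index i : measurable (block_index @^-1` [set i]).
Proof.
rewrite (_ : _ @^-1` _ = \bigcup_n (if inord n == i :> 'I_K.+1 then
    (fun u => (Num.truncn (K.+1%:R * u))%:R : R) @^-1` [set n%:R] else set0)).
  apply: countable_bigcupT_measurable; first exact: countableP.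
  move=> n; case: ifP => // _; rewrite -[X in measurable X]setTI.
  apply: nondecreasing_measurable => // u v uv.
  by rewrite ler_nat le_truncn// ler_pM2l.
apply/seteqP; split => [u /= <-|u [n _]].
  by exists (Num.truncn (K.+1%:R * u)) => //; rewrite eqxx.
by case: eqP => // ni /= /eqP; rewrite eqr_nat /block_index => /eqP ->.
Qed.

Lemma measurable_code_approx n : measurable_fun setT (code_approx n : R -> R).
Proof.
elim: n => [|n IH]; first exact: measurable_cst.
move=> _ B mB; rewrite setTI.
rewrite (_ : _ @^-1` _ = \bigcup_i (block_index @^-1` [set i] `&`
   (fun u => word_map (tword (W i)) (code_approx n (K.+1%:R * u - i%:R))) @^-1` B)).
  apply: fin_bigcup_measurable => // i _; apply: measurableI.
    exact: measurable_block_index.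
  rewrite -[X in measurable X]setTI.
  have mc : measurable_fun setT
    (word_map (tword (W i)) \o (code_approx n \o (fun u : R => K.+1%:R * u - i%:R))).
    apply: (@measurable_comp _ _ _ _ _ _ I01).
    - exact: measurable_I01.
    - move=> _ [u _ <-] /=; apply/I01E; rewrite code_approx_ge0/=.
      by rewrite (le_lt_trans (code_approx_le _ _))// gtrBl invr_gt0.
    - exact: measurable_word_map.
    - apply: (measurableT_comp IH).
      exact: measurable_affine.
  exact: mc.
apply/seteqP; split => [u /= Bu|u [i _ [/= ui]]].
  by exists (block_index u).
by rewrite /block_word ui /expand ui.
Qed.

Lemma measurable_code : measurable_fun setT code.
Proof.
apply: (measurable_fun_cvg (h := code_approx)) => [n|u _].
  exact: measurable_code_approx.
exact: code_cvg.
Qed.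

Lemma block_indexP u (i : 'I_K.+1) : I01 u ->
  block_index u = i <-> I01 (K.+1%:R * u - i%:R).
Proof.
move=> /I01E/andP[u0 u1].
have Ku0 : 0 <= K.+1%:R * u by rewrite mulr_ge0.
have KuK : (Num.truncn (K.+1%:R * u) < K.+1)%N.
  by rewrite truncn_lt_nat// gtr_pMr.
have -> : I01 (K.+1%:R * u - i%:R) <-> Num.truncn (K.+1%:R * u) == i :> nat.
  by rewrite truncn_eq// I01E subr_ge0 ltrBlDr -[i.+1%:R]natr1 [1 + _]addrC.
rewrite /block_index; split => [<-|/eqP ui]; first by rewrite inordK.
by rewrite ui inord_val.
Qed.

Lemma expand_I01 u : I01 u -> I01 (expand u).
Proof. by move=> u01; apply/block_indexP. Qed.

Lemma lebesgue_expand i (B : set R) : measurable B -> B `<=` I01 ->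
  lebesgue_measure (I01 `&` [set u | block_index u = i /\ B (expand u)]) =
  (K.+1%:R^-1%:E * lebesgue_measure B)%E.
Proof.
move=> mB B01; rewrite -(@lebesgue_affine _ K.+1%:R i%:R)//.
congr lebesgue_measure; apply/seteqP; split => u /=.
  by case=> u01 [ui]; rewrite /expand ui.
move=> Bu; have /I01E/andP[h0 h1] := B01 _ Bu.
have u01 : I01 u.
  apply/I01E; apply/andP; split.
    by rewrite -(pmulr_rge0 _ (ltr0Sn R K)) (le_trans _ (_ : i%:R <= _))// -subr_ge0.
  rewrite -(ltr_pM2l (ltr0Sn R K)) mulr1 -[ltLHS](subrK i%:R).
  rewrite (lt_le_trans (_ : _ < 1 + i%:R))// ?ltrD2r// addrC natr1 ler_nat.
  exact: ltn_ord.
have ui : block_index u = i by apply/block_indexP => //; exact: B01.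
by split=> //; split=> //; rewrite /expand ui.
Qed.

Lemma measurable_expand (B : set R) : measurable B ->
  measurable [set u | B (expand u)].
Proof.
move=> mB; rewrite (_ : [set u | _] = \bigcup_i (block_index @^-1` [set i] `&`
   (fun u => K.+1%:R * u - i%:R) @^-1` B)).
  apply: fin_bigcup_measurable => // i _; apply: measurableI.
    exact: measurable_block_index.
  rewrite -[X in measurable X]setTI.
  exact: measurable_affine.
apply/seteqP; split => [u /= Bu|u [i _ [/= ui]]].
  by exists (block_index u).
by rewrite /expand ui.
Qed.

Lemma lebesgue_expand_inv (B : set R) : measurable B ->
  lebesgue_measure (I01 `&` [set u | B (expand u)]) = lebesgue_measure (I01 `&` B).
Proof.
move=> mB; have mIB : measurable (I01 `&` B).
  by apply: measurableI => //; exact: measurable_I01.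
rewrite (_ : _ `&` _ = \bigcup_(i in [set` predT])
   (I01 `&` [set u | block_index u = i /\ (I01 `&` B) (expand u)])); last first.
  apply/seteqP; split => [u [u01 Bu]|u [i _ [u01 [_ [_ Bu]]]]] //.
  by exists (block_index u) => //; do 2! split=> //; split=> //; exact: expand_I01.
rewrite measure_bigcup_fin; last 2 first.
- move=> i; apply: measurableI; first exact: measurable_I01.
  apply: measurableI; first exact: measurable_block_index.
  exact: measurable_expand.
- by move=> i j _ _ [u [[_ [/= <- _]] [_ [/= <- _]]]].
have IBfin : lebesgue_measure (I01 `&` B) \is a fin_num.
  rewrite ge0_fin_numE// (@le_lt_trans _ _ 1%E) ?ltry// -(@lebesgue_I01 R).
  by apply: le_measure; rewrite ?inE//; exact: measurable_I01.
rewrite (eq_bigr (fun=> (K.+1%:R^-1%:E * lebesgue_measure (I01 `&` B))%E)); last first.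
  by move=> i _; apply: lebesgue_expand => //; exact: subIsetl.
rewrite -(fineK IBfin) -EFinM sumEFin sumr_const card_ord -mulrnAl -mulr_natl.
by rewrite divff// mul1r.
Qed.

Lemma measurable_block_indices m (s : seq 'I_K.+1) :
  measurable [set u | block_indices m u = s].
Proof.
elim: m s => [|m IH] [|i s].
- by rewrite (_ : mkset _ = setT)//; apply/seteqP.
- by rewrite (_ : mkset _ = set0)//; apply/seteqP; split.
- by rewrite (_ : mkset _ = set0)//; apply/seteqP; split => u //=; rewrite block_indicesS.
- rewrite (_ : mkset _ = block_index @^-1` [set i] `&`
    [set u | [set v | block_indices m v = s] (expand u)]).
    apply: measurableI; first exact: measurable_block_index.
    exact: measurable_expand.
  by apply/seteqP; split => u /=; rewrite block_indicesS => -[-> ->].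
Qed.

Lemma lebesgue_block_indices (s : seq 'I_K.+1) :
  lebesgue_measure (I01 `&` [set u | block_indices (size s) u = s]) =
  (K.+1%:R ^- size s)%:E.
Proof.
elim: s => [|i s IH].
  by rewrite (_ : mkset _ = setT) ?setIT ?lebesgue_I01 ?invr1//; apply/seteqP.
rewrite (_ : _ `&` _ = I01 `&` [set u | block_index u = i /\
    (I01 `&` [set v | block_indices (size s) v = s]) (expand u)]).
  rewrite (@lebesgue_expand i (I01 `&` _))// ?IH ?exprS ?invfM//.
  apply: measurableI; first exact: measurable_I01.
  exact: measurable_block_indices.
apply/seteqP; split => u [u01]; rewrite [size _]/= /= block_indicesS.
  by move=> [-> us]; split=> //; split=> //; split=> //; exact: expand_I01.
by move=> [-> [_ ->]].
Qed.

End Coding.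

(** * Invariant measures built from a family of words *)

Section BlockMeasure.
Context {R : realType} (N L K : nat) (W : 'I_K.+1 -> N.-tuple 'I_L).
Hypotheses (N0 : (0 < N)%N) (Winj : injective W).
Implicit Types u x y : R.

Notation code := (@code R N L K W).

Lemma measurable_iter_code j : measurable_fun setT
    ((fun u => iter j renyi (code u)) : measurableTypeR R -> measurableTypeR R).
Proof.
elim: j => [|j IH]; first exact: measurable_code.
apply: (@measurable_comp _ _ _ _ _ _ I01 renyi) => //.
- exact: measurable_I01.
- by move=> _ [u _ <-]; apply: iter_renyi_I01; exact: code_I01.
- exact: measurable_renyi.
Qed.

Definition unit_measure : {measure set (measurableTypeR R) -> \bar R} :=
  mrestr lebesgue_measure measurable_I01.

Lemma unit_measureT : unit_measure setT = 1%E.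
Proof. by rewrite /unit_measure/= /mrestr setTI lebesgue_I01. Qed.

Lemma invn_ge0 : 0 <= N%:R^-1 :> R.
Proof. by rewrite invr_ge0. Qed.

(** The law of [code u] is invariant under the N-th iterate of the map only; averaging
    its first N images makes it invariant under the map. *)
Definition block_measure0 : {measure set (measurableTypeR R) -> \bar R} :=
  mscale (NngNum invn_ge0)
   (msum (fun j => image_measure unit_measure (measurable_iter_code j)) N).

Lemma block_measure0E (A : set R) : block_measure0 A =
  (N%:R^-1%:E * \sum_(j < N)
    lebesgue_measure (I01 `&` [set u | A (iter j renyi (code u))]))%E.
Proof.
rewrite /block_measure0/= /mscale/= /msum; congr (_ * _)%E.
by apply: eq_bigr => j _; rewrite /= /pushforward /unit_measure/= /mrestr setIC.
Qed.

Lemma block_measure0T : block_measure0 setT = 1%E.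
Proof.
rewrite block_measure0E (eq_bigr (fun=> 1%E)) => [|j _].
  rewrite sumEFin -EFinM sumr_const card_ord mulVf// pnatr_eq0 -lt0n//.
by rewrite -(@lebesgue_I01 R); congr lebesgue_measure; apply/seteqP; split => u //= [].
Qed.

(** The normalization changes nothing, since the total mass is already 1; it provides
    the structure of a probability measure. *)
Definition block_measure : probability (measurableTypeR R) R :=
  mnormalize block_measure0 (\d_ (0 : measurableTypeR R)).

Lemma block_measureE (A : set R) : block_measure A =
  (N%:R^-1%:E * \sum_(j < N)
    lebesgue_measure (I01 `&` [set u | A (iter j renyi (code u))]))%E.
Proof.
rewrite /block_measure/= /mnormalize block_measure0T/= onee_eq0/=.
by rewrite invr1 mule1 block_measure0E.
Qed.

Lemma block_measure_I01 : block_measure I01 = 1%E.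
Proof.
transitivity (block_measure0 setT); last exact: block_measure0T.
rewrite block_measureE block_measure0E.
congr (_ * _)%E; apply: eq_bigr => j _; congr lebesgue_measure; congr setI.
by apply/seteqP; split => // u _ /=; apply: iter_renyi_I01; exact: code_I01.
Qed.

(** Applying the map shifts the average by one term, and the N-th term equals the
    0-th one because [expand] preserves Lebesgue measure. *)
Lemma block_measure_inv (B : set R) : measurable B -> B `<=` I01 ->
  block_measure (I01 `&` renyi @^-1` B) = block_measure B.
Proof.
move=> mB B01; rewrite !block_measureE; congr (_ * _)%E.
pose F j := lebesgue_measure (I01 `&` [set u | B (iter j renyi (code u))]).
transitivity (\sum_(j < N) F j.+1)%E.
  apply: eq_bigr => j _; congr lebesgue_measure; congr setI.
  apply/seteqP; split => u /=; first by case.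
  by split=> //; apply: iter_renyi_I01; exact: code_I01.
have FN : F N = F 0%N.
  rewrite /F -(@lebesgue_expand_inv R K [set u | B (code u)])/=.
    by congr lebesgue_measure; congr setI; apply/seteqP; split => u /=; rewrite iter_code.
  rewrite -[X in measurable X]setTI.
  by have mc := @measurable_code R N L K W N0; exact: (mc measurableT _ mB).
have Fshift n : F n = F 0%N -> (\sum_(j < n) F j.+1 = \sum_(j < n) F j)%E.
  by case: n => [|n Fn]; rewrite ?big_ord0// big_ord_recr/= Fn big_ord_recl/= addeC.
exact: Fshift.
Qed.

Lemma ge0_integral_block (f : R -> \bar R) :
  measurable_fun I01 f -> (forall x, I01 x -> (0 <= f x)%E) ->
  (\int[block_measure]_(x in I01) f x =
   N%:R^-1%:E * \sum_(j < N) \int[unit_measure]_u f (iter j renyi (code u)))%E.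
Proof.
move=> mf f0; have m01 := @measurable_I01 R.
rewrite (@eq_measure_integral _ _ _ _ block_measure0) => [|A mA A01]; last first.
  exact: (etrans (block_measureE A) (esym (block_measure0E A))).
rewrite ge0_integral_mscale// ge0_integral_measure_sum//; congr (_ * _)%E.
apply: eq_bigr => j _; rewrite ge0_integral_pushforward//; last first.
- by move=> x /set_mem; exact: f0.
- exact: measurable_iter_code.
rewrite (_ : _ @^-1` _ = setT)//; apply/seteqP; split => // u _ /=.
by apply: iter_renyi_I01; exact: code_I01.
Qed.

End BlockMeasure.

Section BlockMeasureTheory.
Context {R : realType} (N L K : nat) (W : 'I_K.+1 -> N.-tuple 'I_L).
Hypotheses (N0 : (0 < N)%N) (Winj : injective W).
Implicit Types u x y : R.

Notation code := (@code R N L K W).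
Notation mu := (@block_measure R N L K W N0).

(** The integral of f is that of its average over the first N points of the orbit
    of [code u].  As f is bounded on the orbits that carry the measure only, it
    is first truncated, then made nonnegative by adding M. *)
Lemma block_integral_bounds (f : R -> R) (M lo hi : R) :
  measurable_fun I01 f ->
  (forall u j, `|f (iter j renyi (code u))| <= M) ->
  (forall u, lo <= N%:R^-1 * \sum_(j < N) f (iter j renyi (code u)) <= hi) ->
  mu.-integrable I01 (EFin \o f) /\
  (lo%:E <= \int[mu]_(x in I01) (f x)%:E <= hi%:E)%E.
Proof.
move=> mf fM flh; have m01 := @measurable_I01 R.
have NR : 0 < N%:R :> R by rewrite ltr0n.
have M0 : 0 <= M by rewrite (le_trans _ (fM 0 0%N)).
(* c truncates at M and agrees with the identity almost everywhere for mu. *)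
pose c y := Num.max (- M) (Num.min M y).
have cM y : `|c y| <= M.
  by rewrite ler_norml /c le_max lexx/= ge_max ge_min lexx/= andbT; lra.
have cE y : `|y| <= M -> c y = y.
  by rewrite ler_norml => /andP[y1 y2]; rewrite /c min_r// max_r.
have mc : measurable_fun I01 (c \o f).
  by apply: measurable_maxr => //; apply: measurable_minr.
have aefc : ae_eq mu I01 (EFin \o f) (EFin \o (c \o f)).
  exists (I01 `&` [set x | M < `|f x|]); split.
  - rewrite (_ : _ `&` _ = I01 `&` (fun x => `|f x|) @^-1` `]M, +oo[); last first.
      by apply/seteqP; split => x /=; rewrite in_itv/= andbT.
    have mn : measurable_fun I01 (fun x => `|f x|) by apply: measurableT_comp.
    exact: mn.
  - apply: (etrans (block_measureE W N0 _)); rewrite big1 ?mule0// => j _.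
    rewrite (_ : _ `&` _ = set0) ?measure0//; apply/seteqP; split => // u [_ [_ /=]].
    by rewrite ltNge fM.
  - move=> x /= /not_implyP[x01 fx]; split=> //; rewrite ltNge; apply/negP => xM.
    by apply: fx; rewrite /= cE.
have mufin : (mu I01 < +oo)%E by rewrite block_measure_I01 ltry.
have ic : mu.-integrable I01 (EFin \o (c \o f)).
  apply: measurable_bounded_integrable => //.
  exists M; split; first exact: num_real.
  by move=> M' MM' x _ /=; rewrite (le_trans (cM _))// ltW.
have mEf : measurable_fun I01 (EFin \o f) by exact/measurable_EFinP.
have mEc : measurable_fun I01 (EFin \o (c \o f)) by exact/measurable_EFinP.
split.
  apply/integrableP; split=> //.
  have -> : (\int[mu]_(x in I01) `|(EFin \o f) x| =
      \int[mu]_(x in I01) `|(EFin \o (c \o f)) x|)%E.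
    apply: ae_eq_integral => //; try exact: measurableT_comp.
    by apply: filterS aefc => x h x01; exact: (congr1 abse (h x01)).
  by move/integrableP : ic => [].
have -> : (\int[mu]_(x in I01) (f x)%:E =
    \int[mu]_(x in I01) (EFin \o (c \o f)) x)%E by exact: ae_eq_integral.
have iM : mu.-integrable I01 (EFin \o cst M).
  apply: measurable_bounded_integrable => //; exact: bounded_cst.
have -> : (\int[mu]_(x in I01) (EFin \o (c \o f)) x =
   \int[mu]_(x in I01) (c (f x) + M)%:E - M%:E)%E.
  under [in RHS]eq_integral do rewrite EFinD.
  rewrite (@integralD _ (measurableTypeR R) R mu I01 m01 _ _ ic iM).
  have -> : (\int[mu]_(x in I01) (EFin \o cst M) x = M%:E)%E.
    rewrite (@integral_cst _ (measurableTypeR R) R mu I01 m01 M%:E) -[RHS]mule1.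
    congr (_ * _)%E; exact: block_measure_I01.
  by rewrite addeK.
pose g (j : nat) (u : R) := (f (iter j renyi (code u)) + M)%:E.
have g0 j u : (0 <= g j u)%E.
  by rewrite lee_fin; have := fM u j; rewrite ler_norml => /andP[]; lra.
have mg j : measurable_fun setT (g j).
  apply/measurable_EFinP; apply: measurable_funD => //.
  apply: (@measurable_comp _ _ _ _ _ _ I01 f) => //.
    by move=> _ [u _ <-]; apply: iter_renyi_I01; exact: code_I01.
  exact: measurable_iter_code.
have -> : (\int[mu]_(x in I01) (c (f x) + M)%:E =
    N%:R^-1%:E * \int[@unit_measure R]_u (\sum_(j < N) g j u))%E.
  rewrite ge0_integral_block; last 2 first.
  - by apply/measurable_EFinP; apply: measurable_funD.
  - by move=> x _; rewrite lee_fin; have := cM (f x); rewrite ler_norml => /andP[]; lra.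
  congr (_ * _)%E; rewrite ge0_integral_sum//; last first.
    by move=> j; exact: mg.
  apply: eq_bigr => j _.
  by apply: eq_integral => u _; rewrite /g cE.
have gE u : (\sum_(j < N) g j u = (N%:R * (N%:R^-1 * (\sum_(j < N) f (iter j renyi (code u))) + M))%:E)%E.
  rewrite sumEFin big_split/= sumr_const card_ord mulrDr mulVKf ?gt_eqF//.
  by rewrite mulr_natl.
have bound (a : R) : (\int[@unit_measure R]_u (N%:R * (a + M))%:E = (N%:R * (a + M))%:E)%E.
  by rewrite integral_cst// unit_measureT mule1.
have mG : measurable_fun setT (fun u => \sum_(j < N) g j u)%E.
  exact: emeasurable_sum.
have Glo : ((N%:R * (lo + M))%:E <= \int[@unit_measure R]_u (\sum_(j < N) g j u))%E.
  have [loM|loM] := leP 0 (N%:R * (lo + M)); last first.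
    apply: (@le_trans _ _ 0%E); first by rewrite lee_fin ltW.
    by apply: integral_ge0 => u _; exact: sume_ge0.
  rewrite -bound; apply: ge0_le_integral => //.
  by move=> u _; rewrite gE lee_fin ler_pM2l// lerD2r; have /andP[] := flh u.
have Ghi : (\int[@unit_measure R]_u (\sum_(j < N) g j u) <= (N%:R * (hi + M))%:E)%E.
  rewrite -bound; apply: ge0_le_integral => //.
    by move=> u _; exact: sume_ge0.
  by move=> u _; rewrite gE lee_fin ler_pM2l// lerD2r; have /andP[] := flh u.
move: Glo Ghi; move: (\int[_]_u _)%E => [r||]//.
move=> h1 h2; have {}h1 : N%:R * (lo + M) <= r := h1.
have {}h2 : r <= N%:R * (hi + M) := h2.
rewrite -(ler_pdivlMl _ _ NR) in h1; rewrite -(ler_pdivrMl _ _ NR) in h2.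
suff /andP[h3 h4] : lo <= N%:R^-1 * r - M <= hi by apply/andP.
by apply/andP; split; [rewrite lerBrDr|rewrite lerBlDr].
Qed.

End BlockMeasureTheory.

Section Cocycle.
Context {R : realType}.
Implicit Types (x y : R).

Lemma phiE x : I01 x -> phi x = - ln (((letter x).+1%:R + renyi x) ^+ 2).
Proof.
move=> x01; rewrite /phi /renyi_deriv -{1}(branch_letter x01) -exprVn branch_inv//.
Qed.

(** The chain rule along an orbit. *)
Lemma sum_phi n x : I01 x ->
  \sum_(j < n) phi (iter j renyi x) = - ln (den (itin n x) (iter n renyi x) ^+ 2).
Proof.
elim: n x => [|n IH] x x01; first by rewrite big_ord0 /= expr1n ln1 oppr0.
rewrite itinS big_ord_recl [iter ord0 _ _]/= phiE//.
under eq_bigr => j _ do rewrite lift0 iterSr.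
have y01 := renyi_I01 x; have /I01E/andP[y0 _] := y01.
rewrite IH// [den (_ :: _) _]/= -iterS iterSr word_map_itin//.
have /I01E/andP[z0 _] := iter_renyi_I01 n y01.
by rewrite exprMn -opprD -lnM ?posrE ?exprn_gt0 ?branch_den_gt0 ?den_gt0.
Qed.

Lemma phi_le0 x : I01 x -> phi x <= 0.
Proof.
move=> x01; rewrite phiE// oppr_le0 ln_ge0// exprn_ege1//.
by have /I01E/andP[y0 _] := renyi_I01 x; rewrite -[leLHS]addr0 lerD// ler1n.
Qed.

End Cocycle.

Section BlockMeasureEntropy.
Context {R : realType} (N L K : nat) (W : 'I_K.+1 -> N.-tuple 'I_L).
Hypotheses (N0 : (0 < N)%N) (Winj : injective W).
Implicit Types u x y : R.

Notation code := (@code R N L K W).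
Notation mu := (@block_measure R N L K W N0).

Lemma letter_iter_code u i : (letter (iter i renyi (code u)) < L)%N.
Proof.
have /allP := blocks_bounded (map W (block_indices K i.+1 u)).
rewrite -(itin_code_blocks W N0); apply; apply/mapP; exists i => //.
by rewrite mem_iota add0n/= (leq_trans (ltnSn i))// leq_pmulr.
Qed.

(** A point of the support starts at some unknown phase j < N inside a block.  For
    each j, a name of length (m + 1) N determines m complete blocks, and by
    injectivity of W their indices; so the u with this name and phase have measure at
    most (K + 1)^-m, and so has their average over j. *)
Lemma block_atom_le m (c : {ffun 'I_(m.+1 * N) -> 'I_L.+1}) :
  law mu I01 (name renyi (letter_trunc L) (m.+1 * N)) c <= K.+1%:R ^- m.
Proof.
have NR : 0 < N%:R :> R by rewrite ltr0n.
set S := I01 `&` name renyi (@letter_trunc R L) (m.+1 * N) @^-1` [set c].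
have mS : measurable S.
  apply: (fibers_name measurable_I01 _ renyi_preimage); last exact: fibers_letter_trunc.
  by move=> x _; exact: renyi_I01.
pose Aj j := I01 `&` [set u | S (iter j renyi (code u))].
have mA j : measurable (Aj j).
  apply: measurableI; first exact: measurable_I01.
  have mc := @measurable_iter_code R N L K W N0 j.
  rewrite -[X in measurable X]setTI; exact: (mc measurableT _ mS).
have Ale j : (j < N)%N -> (lebesgue_measure (Aj j) <= (K.+1%:R ^- m)%:E)%E.
  move=> jN.
  have [[u0 Au0]|/forallNP noA] := pselect (exists u, Aj j u); last first.
    rewrite (_ : Aj j = set0) ?measure0 ?lee_fin ?invr_ge0 ?exprn_ge0//.
    by apply/seteqP; split => // u /noA.
  (* The block that contains the phase j is incomplete, hence the shift by [expand]:
     the name is read from the following block on. *)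
  pose s := block_indices K m (expand K u0).
  have lett u v l : Aj j u -> Aj j v -> (l < m * N)%N ->
      letter (iter l renyi (code (expand K u))) = letter (iter l renyi (code (expand K v))).
    move=> [_ [_ /= cu]] [_ [_ /= cv]] lm.
    have jlN : (j <= l + N)%N by rewrite (leq_trans (ltnW jN)) ?leq_addl.
    have il : (l + N - j < m.+1 * N)%N.
      by rewrite mulSn; move: lm; lia.
    have : name renyi (letter_trunc L) (m.+1 * N) (iter j renyi (code u)) (Ordinal il) =
        name renyi (letter_trunc L) (m.+1 * N) (iter j renyi (code v)) (Ordinal il).
      by rewrite cu cv.
    rewrite !ffunE/= -!iterD subnK// !iterD !(iter_code W N0).
    have lL w i := minn_idPl (ltnW (letter_iter_code w i)).
    by move=> /(congr1 (@nat_of_ord _)); rewrite /letter_trunc !inordK ?ltnS ?geq_minr// !lL.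
  have sub : Aj j `<=` I01 `&` [set u | [set v | block_indices K m v = s] (expand K u)].
    move=> u Au; split; first by case: Au.
    rewrite /= /s; apply: (block_indices_inj N0 Winj); apply/eq_in_map => l.
    by rewrite mem_iota add0n => /andP[_ lm]; exact: lett.
  have ms := @measurable_block_indices R K m s.
  apply: (@le_trans _ _ (lebesgue_measure (I01 `&`
      [set u | [set v | block_indices K m v = s] (expand K u)]))).
    apply: le_measure => //; rewrite inE//; first exact: mA.
    exact: (measurableI _ _ measurable_I01 (measurable_expand K ms)).
  have sm : size s = m by rewrite size_map size_iota.
  by rewrite (lebesgue_expand_inv K ms) -{1}sm lebesgue_block_indices sm.
have muS : (mu S <= (K.+1%:R ^- m)%:E)%E.
  rewrite block_measureE.
  apply: (@le_trans _ _ (N%:R^-1%:E * \sum_(j < N) (K.+1%:R ^- m)%:E)%E).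
    by rewrite lee_wpmul2l ?lee_fin ?invr_ge0//; apply: lee_sum => j _; exact: Ale.
  rewrite sumEFin -EFinM lee_fin sumr_const card_ord -[X in _ * X]mulr_natl.
  by rewrite mulKf// gt_eqF.
rewrite /law -lee_fin fineK//; exact: fin_num_measure.
Qed.

Lemma block_entropy : ((ln K.+1%:R / N%:R)%:E <= ks_entropy I01 renyi mu)%E.
Proof.
have NR : 0 < N%:R :> R by rewrite ltr0n.
have h := ks_entropy_ge (measurable_I01 : measurable (I01 : set (measurableTypeR R)))
  (block_measure_I01 W N0) (fun x _ => renyi_I01 x) (@renyi_preimage R)
  (@block_measure_inv R N L K W N0).
apply: (h _ (letter_trunc L) (fun m => m.+1 * N)%N _ (ln K.+1%:R)).
- exact: fibers_letter_trunc.
- by move=> m; rewrite leq_pmulr.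
- by rewrite ln_ge0// ler1n.
move=> m; apply: (@le_trans _ _ (- ln (K.+1%:R ^- m))).
  rewrite lnV ?posrE ?exprn_gt0// opprK lnXn// -[ln _ *+ m]mulr_natl natrM.
  rewrite -[m.+1%:R]natr1 (_ : _ * _ - _ = m%:R * ln K.+1%:R)//.
  by field; rewrite gt_eqF.
apply: entropy_ge_max.
- exact: block_measure_I01.
- apply: (fibers_name measurable_I01 _ (@renyi_preimage R)); last exact: fibers_letter_trunc.
  by move=> x _; exact: renyi_I01.
- by rewrite invr_gt0 exprn_gt0.
- exact: block_atom_le.
Qed.

End BlockMeasureEntropy.

Section BlockMeasureEnergy.
Context {R : realType} (N L K : nat) (W : 'I_K.+1 -> N.-tuple 'I_L).
Hypotheses (N0 : (0 < N)%N) (Winj : injective W).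
Implicit Types u x y : R.

Notation code := (@code R N L K W).
Notation mu := (@block_measure R N L K W N0).

Lemma phi_iter_code_norm u j : `|phi (iter j renyi (code u))| <= 2 * ln L.+1%:R.
Proof.
set x := iter j renyi (code u).
have x01 : I01 x by apply: iter_renyi_I01; exact: code_I01.
rewrite ler0_norm ?phi_le0// phiE// opprK.
have /I01E/andP[y0 y1] := renyi_I01 x.
have A0 := branch_den_gt0 (letter x) y0.
rewrite lnXn// -[ln _ *+ 2]mulr_natl ler_pM2l// ler_ln ?posrE//.
rewrite -[L.+1%:R]natr1 lerD ?(ltW y1)// ler_nat; exact: letter_iter_code.
Qed.

Lemma phi_sum_code (B : R) u : (forall i, expR (- B) <= len (tword (W i))) ->
  - (B + ln N.+1%:R) <= \sum_(j < N) phi (iter j renyi (code u)).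
Proof.
move=> WB; rewrite sum_phi; last exact: code_I01.
rewrite (itin_code W N0) (iter_code W N0) lerN2 -[B]expRK -lnM ?posrE ?expR_gt0//.
have /I01E/andP[y0 y1] := code_I01 W N0 (expand K u).
rewrite ler_ln ?posrE ?mulr_gt0 ?expR_gt0 ?exprn_gt0 ?den_gt0//.
rewrite (le_trans (den_sqr_le _ y0 (ltW y1)))// size_block_word mulrC ler_wpM2r//.
rewrite -[expR B]invrK -expRN lef_pV2 ?posrE ?expR_gt0 ?len_gt0//.
exact: WB.
Qed.

Lemma block_measure_invariant : invariant_measures_phi mu.
Proof.
split; first by split; [exact: block_measure_I01|exact: block_measure_inv].
have h u : - (2 * ln L.+1%:R) <= N%:R^-1 * \sum_(j < N) phi (iter j renyi (code u))
    <= 2 * ln L.+1%:R.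
  rewrite -ler_norml normrM normfV [`|N%:R|]ger0_norm// ler_pdivrMl ?ltr0n//.
  rewrite (le_trans (ler_norm_sum _ _ _))//.
  apply: (@le_trans _ _ (\sum_(j < N) 2 * ln L.+1%:R)).
    by apply: ler_sum => j _; exact: phi_iter_code_norm.
  by rewrite sumr_const card_ord -[leLHS]mulr_natl.
exact: (block_integral_bounds N0 (@measurable_phi R) phi_iter_code_norm h).1.
Qed.

(** Entropy at least ln (K + 1) / N, and an exponent at most (B + ln (N + 1)) / N because
    every block has length at least exp(- B). *)
Lemma block_free_energy (B : R) : (forall i, expR (- B) <= len (tword (W i))) ->
  (((ln K.+1%:R - B - ln N.+1%:R) / N%:R)%:E <= free_energy mu)%E.
Proof.
move=> WB; have NR : 0 < N%:R :> R by rewrite ltr0n.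
have h u : - ((B + ln N.+1%:R) / N%:R) <=
    N%:R^-1 * \sum_(j < N) phi (iter j renyi (code u)) <= 0.
  apply/andP; split.
    by rewrite -mulNr mulrC ler_pM2l ?invr_gt0//; exact: phi_sum_code.
  rewrite pmulr_rle0 ?invr_gt0//; apply: sumr_le0 => j _; apply: phi_le0.
  by apply: iter_renyi_I01; exact: code_I01.
have [_ /andP[h1 h2]] :=
  block_integral_bounds N0 (@measurable_phi R) phi_iter_code_norm h.
rewrite /free_energy /lyapunov oppeK.
have -> : (ln K.+1%:R - B - ln N.+1%:R) / N%:R =
  ln K.+1%:R / N%:R - (B + ln N.+1%:R) / N%:R.
  by rewrite -mulrBl opprD addrA.
rewrite EFinB; apply: leeD => //; exact: block_entropy.
Qed.

Lemma digit_sum_code (psi : nat -> R) u :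
  \sum_(j < N) psi (digit 1 (iter j renyi (code u))) = word_sum psi (block_word W u).
Proof.
rewrite sum_digit_fun ?(itin_code W N0)//; exact: code_I01.
Qed.

Lemma block_digit_integral (psi : nat -> R) (a1 a2 : R) :
  (forall i, a1 <= N%:R^-1 * word_sum psi (tword (W i)) <= a2) ->
  mu.-integrable I01 (fun x => (psi (digit 1 x))%:E) /\
  (a1%:E <= \int[mu]_(x in I01) (psi (digit 1 x))%:E <= a2%:E)%E.
Proof.
move=> Wa; apply: (@block_integral_bounds R N L K W N0 (fun x => psi (digit 1 x))
  (\sum_(a < L) `|psi a.+2|)).
- exact: measurable_digit_fun.
- move=> u j; rewrite (digitE 0) ?[iter 0 _ _]/=; last first.
    by apply: iter_renyi_I01; exact: code_I01.
  have lL := letter_iter_code W N0 u j.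
  by rewrite (bigD1 (Ordinal lL))//= lerDl sumr_ge0.
- by move=> u; rewrite digit_sum_code; exact: Wa.
Qed.

End BlockMeasureEnergy.

(** * Upper bound: an invariant measure from the measure of an average set *)

Section UpperBound.
Context {R : realType}.
Implicit Types (psi : nat -> R) (J : interval R).

(** The form in which distortion errors ln (n + 1) are absorbed in small multiples of n. *)
Lemma ln_lin_le (e : R) (n : nat) : 0 < e -> ln n.+1%:R <= e * n%:R + (e - ln e).
Proof.
move=> e0; rewrite -(mulKf (lt0r_neq0 e0) n.+1%:R) mulrC.
rewrite ln_div ?posrE ?mulr_gt0// addrA lerD2r.
rewrite (le_trans (ltW (ln_sublinear _)))// ?mulr_gt0//.
by rewrite -natr1 mulrDr mulr1.
Qed.

Lemma itv_convex J (a b x : R) : a \in J -> b \in J -> a <= x -> x <= b -> x \in J.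
Proof.
by move=> aJ bJ ax xb; apply: (@interval_is_interval R J a b aJ bJ); rewrite ax xb.
Qed.

Definition bounded_avg_set psi J n L : set R :=
  avg_set psi J n `&` [set x | all (fun a => a < L)%N (itin n x)].

Lemma bounded_avg_setE psi J n L : bounded_avg_set psi J n L =
  \bigcup_(t in [set` [pred t : n.-tuple 'I_L | n%:R^-1 * word_sum psi (tword t) \in J]])
    cyl (tword t).
Proof.
apply/seteqP; split => [x [[x01 xJ] /= xL]|x [t /= tJ [x01]]].
  have [t tx] := tword_surj (size_itin n x) xL; exists t => /=.
    by rewrite inE tx -digit_averageE.
  by split=> //; rewrite size_tword.
rewrite size_tword => xt; split; last by rewrite /= xt tword_bounded.
by split=> //; rewrite digit_averageE// xt.
Qed.

Lemma lebesgue_bounded_avg_set psi J n L : lebesgue_measure (bounded_avg_set psi J n L) =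
  (\sum_(t : n.-tuple 'I_L | n%:R^-1 * word_sum psi (tword t) \in J) len (tword t))%:E.
Proof.
rewrite bounded_avg_setE measure_bigcup_fin//.
- by rewrite -sumEFin; apply: eq_bigr => t _; exact: lebesgue_cyl.
- by move=> t; exact: measurable_cyl.
- by move=> t t' _ _ /cyl_disjoint; rewrite !size_tword => /(_ erefl)/tword_inj.
Qed.

Lemma avg_set_le1 psi J n : (lebesgue_measure (avg_set psi J n) <= 1)%E.
Proof.
rewrite -(@lebesgue_I01 R); apply: le_measure; rewrite ?inE.
- exact: measurable_avg_set.
- exact: measurable_I01.
- by move=> x [].
Qed.

(** Continuity from below: bounding the letters by a large L loses at most half of
    the measure, and leaves finitely many words. *)
Lemma bounded_avg_set_half psi J n (Z : R) : 0 < Z ->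
  lebesgue_measure (avg_set psi J n) = Z%:E ->
  exists L, Z / 2 <=
    \sum_(t : n.-tuple 'I_L | n%:R^-1 * word_sum psi (tword t) \in J) len (tword t).
Proof.
move=> Z0 ZE.
have cv : lebesgue_measure (bounded_avg_set psi J n L) @[L --> \oo] -->
    lebesgue_measure (\bigcup_L bounded_avg_set psi J n L).
  apply: nondecreasing_cvg_mu.
  - move=> L; rewrite bounded_avg_setE; apply: fin_bigcup_measurable => // t _.
    exact: measurable_cyl.
  - apply: bigcup_measurable => L _; rewrite bounded_avg_setE.
    by apply: fin_bigcup_measurable => // t _; exact: measurable_cyl.
  - move=> L L' LL'; apply/subsetPset => x [xJ /= xL]; split=> //=.
    by apply: sub_all xL => a /leq_trans; apply.
have E : \bigcup_L bounded_avg_set psi J n L = avg_set psi J n.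
  apply/seteqP; split => [x [L _ []]//|x xJ].
  exists (\max_(a <- itin n x) a).+1 => //; split=> //=.
  by apply/allP => a ax; rewrite ltnS; exact: leq_bigmax_seq.
rewrite E ZE in cv.
have /fine_cvgP[_ /cvgrPdist_lt/(_ _ (divr_gt0 Z0 (ltr0Sn R 1)))] := cv.
move=> [L _ /(_ L (leqnn L))]/=; rewrite lebesgue_bounded_avg_set/= => h.
exists L; move: h; set S := \sum_(t | _) _; rewrite ltr_distlC => /andP[]; lra.
Qed.

End UpperBound.

Section TypicalBlocks.
Context {R : realType} (n L : nat) (V : pred (n.-tuple 'I_L)).
Hypothesis n0 : (0 < n)%N.
Let Z : R := \sum_(t | V t) len (tword t).
Hypothesis Z0 : 0 < Z.

Lemma block_tuple_subproof k (w : {ffun 'I_k -> n.-tuple 'I_L}) :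
  size (flatten [seq tval t | t <- ffun_seq w]) == (k * n)%N.
Proof.
rewrite -(size_map val) map_flatten -map_comp.
have := size_blocks (ffun_seq w); rewrite size_ffun_seq => <-.
by apply/eqP; congr (size (flatten _)); apply: eq_map.
Qed.

Definition block_tuple k (w : {ffun 'I_k -> n.-tuple 'I_L}) : (k * n).-tuple 'I_L :=
  Tuple (block_tuple_subproof w).

Lemma tword_block_tuple k (w : {ffun 'I_k -> n.-tuple 'I_L}) :
  tword (block_tuple w) = blocks (ffun_seq w).
Proof. by rewrite /tword/= map_flatten -map_comp; congr flatten; apply: eq_map. Qed.

Lemma block_tuple_inj k : injective (@block_tuple k).
Proof.
move=> w w' /(congr1 (@tword _ _)); rewrite !tword_block_tuple.
by move=> /blocks_inj; rewrite !size_ffun_seq => /(_ erefl)/ffun_seq_inj.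
Qed.

(** Draw k words independently, with probability [len] / Z.  A typical
    concatenation has a product of lengths about exp(k m), m being the mean of
    [ln \o len], and probability about exp(k (m - ln Z)); since typical ones have total probability
    at least 1/2, there are at least exp(k (ln Z - m - e)) / 2 of them. *)
Lemma typical_blocks (e : R) : 0 < e -> \forall k \near \oo,
  exists (K : nat) (W : 'I_K.+1 -> (k * n).-tuple 'I_L) (B : R),
  [/\ injective W,
      forall i, expR (- B) <= len (tword (W i)),
      k%:R * (ln Z - ln n.+1%:R - 2 * e) - ln 2 <= ln K.+1%:R - B &
      forall i, exists2 w : {ffun 'I_k -> n.-tuple 'I_L},
        (forall j, V (w j)) & tword (W i) = blocks (ffun_seq w)].
Proof.
move=> e0; pose p t : R := if V t then len (tword t) / Z else 0.
have p0 t : 0 <= p t.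
  by rewrite /p; case: ifP => // _; rewrite divr_ge0 ?(ltW Z0)// ltW ?len_gt0.
have p1 : \sum_t p t = 1.
  by rewrite -big_mkcond/= -mulr_suml divff// gt_eqF.
pose f (t : n.-tuple 'I_L) : R := ln (len (tword t)); set m := mean p f.
near=> k.
have half : 1 / 2 <= \sum_(w : {ffun 'I_k -> n.-tuple 'I_L} |
    near_mean p f e w && near_mean p f e w) prodp p w.
  by near: k; exact: weak_law2.
pose T := [pred w : {ffun 'I_k -> n.-tuple 'I_L} | near_mean p f e w & [forall j, V (w j)]].
have halfT : 1 / 2 <= \sum_(w | T w) prodp p w.
  apply: (le_trans half); rewrite [leRHS]big_mkcond [leLHS]big_mkcond/=.
  apply: ler_sum => w _; rewrite andbb.
  have [//|/forallPn[j /negbTE Vj]] := boolP [forall j, V (w j)].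
    by rewrite andbT.
  by rewrite andbF; case: ifP => // _; rewrite /prodp (bigD1 j)//= /p Vj mul0r.
have lnP w : T w -> prodp p w = expR (\sum_j f (w j) - k%:R * ln Z).
  move=> /andP[_ /forallP Vw].
  have -> : \sum_j f (w j) - k%:R * ln Z = \sum_j (f (w j) - ln Z).
    by rewrite sumrB sumr_const card_ord mulr_natl.
  rewrite expR_sum; apply: eq_bigr => j _; rewrite /p Vw expRB !lnK ?posrE//.
  exact: len_gt0.
have fT w : T w -> k%:R * m - k%:R * e <= \sum_j f (w j) <= k%:R * m + k%:R * e.
  by move=> /andP[+ _]; rewrite /near_mean ler_distl.
have cardT : 1 / 2 <= #|T|%:R * expR (k%:R * m + k%:R * e - k%:R * ln Z).
  rewrite (le_trans halfT)// mulr_natl -sumr_const; apply: ler_sum => w Tw.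
  by rewrite lnP// ler_expR lerD2r; have /andP[] := fT w Tw.
have [K cK] : exists K, #|T| = K.+1.
  by move: cardT; case: #|T| => [|K _]; [rewrite mul0r; lra|exists K].
pose W (i : 'I_K.+1) := block_tuple (enum_val (cast_ord (esym cK) i)).
have TW i : T (enum_val (cast_ord (esym cK) i)).
  have h := enum_valP (cast_ord (esym cK) i); exact: h.
exists K, W, (- (k%:R * m - k%:R * e - k%:R * ln n.+1%:R)); split.
- by move=> i j /block_tuple_inj/enum_val_inj/cast_ord_inj.
- move=> i; rewrite opprK tword_block_tuple.
  set w := enum_val _.
  have := @len_blocks R _ _ (ffun_seq w) [::]; rewrite cats0 big_ffun_seq.
  rewrite {2}/len/= mulr1 invr1 mulr1; apply: le_trans.
  have -> : \prod_j (len (tword (w j)) / n.+1%:R) =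
      expR (\sum_j f (w j) - k%:R * ln n.+1%:R) :> R.
    have -> : \sum_j f (w j) - k%:R * ln n.+1%:R = \sum_j (f (w j) - ln n.+1%:R).
      by rewrite sumrB sumr_const card_ord mulr_natl.
    rewrite expR_sum; apply: eq_bigr => j _; rewrite expRB !lnK ?posrE//.
    exact: len_gt0.
  by rewrite ler_expR lerD2r; have /andP[] := fT w (TW i).
- move: cardT; rewrite cK => cardT.
  have : ln (1 / 2) <= ln (K.+1%:R * expR (k%:R * m + k%:R * e - k%:R * ln Z)).
    by rewrite ler_ln ?posrE ?mulr_gt0 ?expR_gt0.
  rewrite lnM ?posrE ?expR_gt0// expRK div1r lnV ?posrE//; lra.
- move=> i; exists (enum_val (cast_ord (esym cK) i)); last exact: tword_block_tuple.
  by have /andP[_ /forallP] := TW i.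
Unshelve. all: by end_near. Qed.

End TypicalBlocks.

Section UpperBoundMeasure.
Context {R : realType} (psi : nat -> R) (J : interval R).

(** The average over a block word is a convex combination of the averages over its
    parts. *)
Lemma block_average_bounds n L k (w : {ffun 'I_k -> n.-tuple 'I_L}) (a1 a2 : R) :
  (0 < n)%N -> (0 < k)%N ->
  (forall j, a1 <= n%:R^-1 * word_sum psi (tword (w j)) <= a2) ->
  a1 <= (k * n)%:R^-1 * word_sum psi (blocks (ffun_seq w)) <= a2.
Proof.
move=> n0 k0 wa; rewrite word_sum_blocks big_ffun_seq natrM invfM -mulrA.
have kR : 0 < k%:R :> R by rewrite ltr0n.
have c (a : R) : k%:R * a = \sum_(j < k) a.
  by rewrite sumr_const card_ord mulr_natl.
rewrite ler_pdivlMl// ler_pdivrMl// mulr_sumr !c.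
by apply/andP; split; apply: ler_sum => j _; have /andP[] := wa j.
Qed.

(** The error terms have three sources: ln 2 from keeping half of the measure,
    ln (n + 1) from concatenating words of length n, and e from the law of large numbers
    together with the distortion of words of length k n, the latter two vanishing as k
    grows. *)
Lemma measure_of_avg_set n (Z e : R) : (0 < n)%N -> 0 < Z -> 0 < e ->
  lebesgue_measure (avg_set psi J n) = Z%:E ->
  exists mu : probability (measurableTypeR R) R,
  exists alpha : R,
  [/\ invariant_measures_phi mu,
      mu.-integrable I01 (fun x => (psi (digit 1 x))%:E),
      alpha \in J,
      (\int[mu]_(x in I01) (psi (digit 1 x))%:E = alpha%:E)%E &
      ((n%:R^-1 * (ln Z - ln 2 - ln n.+1%:R) - e)%:E <= free_energy mu)%E].
Proof.
move=> n0 Z0 e0 ZE; have [L ZL] := bounded_avg_set_half Z0 ZE.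
pose A (t : n.-tuple 'I_L) := n%:R^-1 * word_sum psi (tword t).
pose V := [pred t | A t \in J]; set ZL' := \sum_(t | _) _ in ZL.
have ZL0 : 0 < ZL' by rewrite (lt_le_trans _ ZL)// divr_gt0.
have [t0 Vt0] : exists t0, V t0.
  apply: contrapT => /forallNP noV; move: ZL0; rewrite /ZL' big1 ?ltxx// => t tJ.
  by have := noV t.
(* The extreme averages among the words kept are both in J, and the integral of [psi]
   lies between them. *)
pose t1 := [arg min_(t < t0 | V t) A t]%O.
pose t2 := [arg max_(t > t0 | V t) A t]%O.
have [Vt1 A1] : V t1 /\ forall t, V t -> A t1 <= A t.
  by rewrite /t1; case: Order.TotalTheory.arg_minP => // t Vt tA; split.
have [Vt2 A2] : V t2 /\ forall t, V t -> A t <= A t2.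
  by rewrite /t2; case: Order.TotalTheory.arg_maxP => // t Vt tA; split.
have nR : 0 < n%:R :> R by rewrite ltr0n.
have n1 : 1 <= n%:R :> R by rewrite ler1n.
have e4 : 0 < e / 4 by rewrite divr_gt0.
near \oo => k.
have [K [W [B [Winj WB WZ WT]]]] : exists (K : nat) (W : 'I_K.+1 -> (k * n).-tuple 'I_L) (B : R),
  [/\ injective W,
      forall i, expR (- B) <= len (tword (W i)),
      k%:R * (ln ZL' - ln n.+1%:R - 2 * (e / 4)) - ln 2 <= ln K.+1%:R - B &
      forall i, exists2 w : {ffun 'I_k -> n.-tuple 'I_L},
        (forall j, V (w j)) & tword (W i) = blocks (ffun_seq w)].
  by near: k; exact: typical_blocks.
have k0 : (0 < k)%N by near: k; exists 1%N.
have N0 : (0 < k * n)%N by rewrite muln_gt0 k0.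
exists (block_measure W N0).
have Wa i : A t1 <= (k * n)%:R^-1 * word_sum psi (tword (W i)) <= A t2.
  have [w Vw ->] := WT i; apply: block_average_bounds => // j.
  by rewrite A1 ?A2.
have [intpsi] := block_digit_integral N0 Wa.
move: (\int[_]_(_ in _) _)%E => [alpha||] /andP[h1 h2] //.
have {}h1 : A t1 <= alpha := h1; have {}h2 : alpha <= A t2 := h2.
exists alpha; split => //.
- exact: block_measure_invariant.
- exact: itv_convex Vt1 Vt2 h1 h2.
apply: le_trans (block_free_energy N0 Winj WB); rewrite lee_fin.
have kR : 0 < k%:R :> R by rewrite ltr0n.
rewrite ler_pdivlMr ?ltr0n// natrM.
have -> : (n%:R^-1 * (ln Z - ln 2 - ln n.+1%:R) - e) * (k%:R * n%:R) =
   k%:R * (ln Z - ln 2 - ln n.+1%:R) - e * (k%:R * n%:R).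
  by field; rewrite gt_eqF.
have h3 : ln (k * n).+1%:R <= e / 4 * (k%:R * n%:R) + (e / 4 - ln (e / 4)).
  by rewrite -natrM; exact: ln_lin_le.
have h4 : ln Z - ln 2 <= ln ZL'.
  by rewrite -ln_div ?posrE// ler_ln ?posrE// divr_gt0.
have h5 : k%:R * (ln Z - ln 2) <= k%:R * ln ZL' by rewrite ler_pM2l.
have h6 : k%:R * (2 * (e / 4)) <= k%:R * n%:R * (e / 2).
  by rewrite -mulrA ler_pM2l//; nra.
have h7 : ln 2 + (e / 4 - ln (e / 4)) <= k%:R * n%:R * (e / 4).
  apply: (@le_trans _ _ (k%:R * (e / 4))); last by rewrite ler_wpM2r ?(ltW e4)// ler_peMr// ltW.
  rewrite -ler_pdivrMr//; near: k; exact: nbhs_infty_ger.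
move: WZ h3 h5 h6 h7; lra.
Unshelve. all: by end_near. Qed.

End UpperBoundMeasure.

(** * Approximation of partitions by functions of the digits *)

Section Approximation.
Context {R : realType} (mu : probability (measurableTypeR R) R).
Implicit Types (x y : R) (B : set R).

(** One parameter governs both the number of digits that are read and the level at which
    they are truncated, so that the codes form a refining sequence. *)
Definition prefix_code n x : {ffun 'I_n -> 'I_n.+1} := name renyi (letter_trunc n) n x.

Lemma fibers_renyi_name (A : finType) (f : R -> A) n :
  fibers_measurable I01 f -> fibers_measurable I01 (name renyi f n).
Proof.
move=> mf; apply: (fibers_name measurable_I01 _ (@renyi_preimage R)) => //.
by move=> x _; exact: renyi_I01.
Qed.

Lemma letter_trunc_minn M M' x : (M <= M')%N ->
  inord (minn (letter_trunc M' x) M) = letter_trunc M x.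
Proof.
move=> MM'; apply: val_inj; rewrite /letter_trunc !inordK ?ltnS ?geq_minr//.
by rewrite -minnA (minn_idPr MM').
Qed.

Definition coded n (b : R -> bool) : Prop :=
  exists S : pred {ffun 'I_n -> 'I_n.+1}, forall x, b x = S (prefix_code n x).

Lemma coded_le m n b : (m <= n)%N -> coded m b -> coded n b.
Proof.
move=> mn [S bS]; exists (fun c : {ffun 'I_n -> 'I_n.+1} => S [ffun j => inord (minn (c (widen_ord mn j)) m)]) => x.
rewrite bS; congr S; apply/ffunP => j; rewrite !ffunE/=.
by rewrite letter_trunc_minn.
Qed.

Lemma codedU n b c : coded n b -> coded n c -> coded n (fun x => b x || c x).
Proof. by move=> [S bS] [S' cS']; exists (fun d => S d || S' d) => x; rewrite bS cS'. Qed.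

Lemma codedC n b : coded n b -> coded n (fun x => ~~ b x).
Proof. by move=> [S bS]; exists (fun d => ~~ S d) => x; rewrite bS. Qed.

Lemma measurable_coded n b : coded n b -> measurable (I01 `&` [set x | b x]).
Proof.
move=> [S bS]; have := measurable_preimage_pred S
  (fibers_renyi_name (n := n) (@fibers_letter_trunc R n)).
by congr (measurable (_ `&` _)); apply/seteqP; split => x /=; rewrite bS.
Qed.

Definition discrepancy B (b : R -> bool) : set R := I01 `&` [set x | ~ (B x <-> b x)].

Lemma measurable_discrepancy n B b : measurable B -> coded n b ->
  measurable (discrepancy B b).
Proof.
move=> mB cb; have mb := measurable_coded cb; have m01 := @measurable_I01 R.
rewrite (_ : discrepancy B b = ((I01 `&` B) `\` (I01 `&` [set x | b x])) `|`
  ((I01 `&` [set x | b x]) `\` (I01 `&` B))).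
  by apply: measurableU; apply: measurableD => //; exact: measurableI.
apply/seteqP; split => x /=.
  move=> [x01 nB]; have [Bx|nBx] := pselect (B x).
    by left; split=> // -[_ bx]; apply: nB.
  right; split; last by case.
  by split=> //; apply: contrapT => nb; apply: nB; split=> // bx.
move=> [[[x01 Bx] nb]|[[x01 bx] nB]]; split=> // -[h1 h2].
  by apply: nb; split=> //; exact: h1.
by apply: nB; split=> //; exact: h2.
Qed.

(** The Borel sets which are close in measure to a set described by finitely many
    truncated digits.  These form a sigma-algebra, and the half-lines x < a
    are countable unions of cylinders. *)
Definition approximable B : Prop := measurable B /\
  forall e : R, 0 < e -> exists n b, coded n b /\ (mu (discrepancy B b) <= e%:E)%E.

Lemma eq_approximable B B' : measurable B' -> I01 `&` B = I01 `&` B' ->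
  approximable B -> approximable B'.
Proof.
move=> mB' BB' [mB aB]; split=> // e e0; have [n [b [cb be]]] := aB e e0.
have h x : I01 x -> B x <-> B' x.
  move=> x01; have hx : (I01 `&` B) x <-> (I01 `&` B') x by rewrite BB'.
  by split=> Bx; [have [] := hx.1 (conj x01 Bx)|have [] := hx.2 (conj x01 Bx)].
exists n, b; split=> //; rewrite (_ : discrepancy B' b = discrepancy B b)//.
by apply/seteqP; split => x [x01 nB]; split=> // Bb; apply: nB; rewrite -Bb; have := h x x01; tauto.
Qed.

Lemma approximableC B : approximable B -> approximable (~` B).
Proof.
move=> [mB aB]; split; first exact: measurableC.
move=> e /aB[n [b [cb be]]]; exists n, (fun x => ~~ b x); split; first exact: codedC.
rewrite (_ : discrepancy _ _ = discrepancy B b)//.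
apply/seteqP; split => x [x01 nB]; split=> //= Bb; apply: nB.
  by split => [nBx|/negP nb Bx]; [apply/negP => bx; apply: nBx; apply/Bb|apply: nb; apply/Bb].
split => [Bx|bx]; apply: contrapT.
  by move=> /negP /Bb.
by move=> nBx; have /negP := (Bb.1 nBx).
Qed.

Lemma approximableU B B' : approximable B -> approximable B' -> approximable (B `|` B').
Proof.
move=> [mB aB] [mB' aB']; split; first exact: measurableU.
move=> e e0; have e2 : 0 < e / 2 by rewrite divr_gt0.
have [n [b [cb be]]] := aB _ e2; have [n' [b' [cb' be']]] := aB' _ e2.
have cb1 := coded_le (leq_maxl n n') cb; have cb2 := coded_le (leq_maxr n n') cb'.
exists (maxn n n'), (fun x => b x || b' x); split; first exact: codedU.
apply: (@le_trans _ _ (mu (discrepancy B b `|` discrepancy B' b'))).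
  apply: le_measure; rewrite ?inE.
  - by apply: measurable_discrepancy (codedU cb1 cb2); exact: measurableU.
  - by apply: measurableU; apply: measurable_discrepancy; eassumption.
  - move=> x [x01 nB]; apply: contrapT => /not_orP[h1 h2]; apply: nB.
    have {}h1 : B x <-> b x by apply: contrapT => h; apply: h1.
    have {}h2 : B' x <-> b' x by apply: contrapT => h; apply: h2.
    by split=> [[/h1 ->//|/h2 ->]|/orP[/h1|/h2]]; [rewrite orbT|left|right].
apply: (le_trans (measureU2 _ _ _)).
- exact: measurable_discrepancy cb.
- exact: measurable_discrepancy cb'.
by rewrite [e]splitr EFinD leeD.
Qed.

Lemma approximable_bigcup (F : nat -> set R) :
  (forall n, approximable (F n)) -> approximable (\bigcup_n F n).
Proof.
move=> aF; pose G n := \bigcup_(i < n) F i.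
have aG n : approximable (G n).
  rewrite /G bigcup_mkord; elim: n => [|n IH]; last by rewrite big_ord_recr/=; exact: approximableU.
  rewrite big_ord0; split=> // e e0; exists 0%N, (fun=> false); split.
    by exists xpred0.
  rewrite (_ : discrepancy _ _ = set0) ?measure0 ?lee_fin ?ltW//.
  by apply/seteqP; split => // x [_ /=]; apply.
have mF n := (aF n).1; have mU : measurable (\bigcup_n F n) by exact: bigcup_measurable.
split=> // e e0; have e2 : 0 < e / 2 by rewrite divr_gt0.
have cv : (mu \o (fun n => (\bigcup_n F n) `\` G n)) n @[n --> \oo] -->
    mu (\bigcap_n ((\bigcup_n F n) `\` G n)).
  apply: nonincreasing_cvg_mu.
  - by rewrite (le_lt_trans (probability_le1 _ _)) ?ltry//; apply: measurableD => //; exact: (aG _).1.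
  - by move=> n; apply: measurableD => //; exact: (aG _).1.
  - by apply: bigcapT_measurable => n; apply: measurableD => //; exact: (aG _).1.
  - move=> m n mn; apply/subsetPset => x [Ux nG]; split=> // -[i im Fi]; apply: nG.
    by exists i => //=; exact: leq_trans im mn.
have E0 : \bigcap_n ((\bigcup_n F n) `\` G n) = set0.
  apply/seteqP; split => // x h; have [[i _ Fix] _] := h 0%N I.
  by have [_] := h i.+1 I; apply; exists i => /=.
rewrite E0 measure0 in cv.
have /fine_cvgP[mfin /cvgrPdist_le/(_ _ e2)] := cv.
move: mfin => [n1 _ hn1] [n2 _ hn2].
(* Past n the finite union G n misses at most e / 2 of the countable union. *)
pose n := maxn n1 n2.
have fin := hn1 n (leq_maxl _ _); have small := hn2 n (leq_maxr _ _).
have [m [b [cb be]]] := (aG n).2 _ e2; exists m, b; split=> //.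
apply: (@le_trans _ _ (mu (((\bigcup_n F n) `\` G n) `|` discrepancy (G n) b))).
  apply: le_measure; rewrite ?inE.
  - exact: measurable_discrepancy cb.
  - apply: measurableU; first by apply: measurableD => //; exact: (aG _).1.
    by apply: measurable_discrepancy cb; exact: (aG _).1.
  - move=> x [x01 nB]; have [Gx|nGx] := pselect (G n x).
      right; split=> // -[h _]; apply: nB; split=> [_|_]; first exact: h.
      by case: Gx => i _ Fi; exists i.
    have [Ux|nUx] := pselect ((\bigcup_n F n) x); first by left.
    right; split=> // -[h1 h2]; apply: nB; split=> [//|bx].
    by exfalso; apply: nGx; exact: h2.
apply: (le_trans (measureU2 _ _ _)).
- by apply: measurableD => //; exact: (aG _).1.
- by apply: measurable_discrepancy cb; exact: (aG _).1.
rewrite [e]splitr EFinD leeD//.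
have {}fin : mu ((\bigcup_n F n) `\` G n) \is a fin_num := fin.
suff : (mu ((\bigcup_n F n) `\` G n) <= (e / 2)%:E)%E by [].
rewrite -(fineK fin) lee_fin; move: small; rewrite sub0r normrN ger0_norm//.
exact: fine_ge0.
Qed.

(** A word is described exactly as soon as n exceeds its size and its letters. *)
Lemma approximable_cyl w : approximable (cyl w).
Proof.
split=> [|e e0]; first exact: measurable_cyl.
pose n := maxn (size w) (\max_(a <- w) a).+1.
pose S := [pred c : {ffun 'I_n -> 'I_n.+1} |
  all (fun j => [forall i : 'I_n, (i == j :> nat) ==> (c i == nth 0 w j :> nat)%N])
    (iota 0 (size w))].
exists n, (fun x => S (prefix_code n x)); split; first by exists S.
rewrite (_ : discrepancy _ _ = set0) ?measure0 ?lee_fin ?ltW//.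
apply/seteqP; split => // x [x01]; apply.
have wn j : (j < size w)%N -> (nth 0 w j < n)%N.
  move=> jw; rewrite leq_max; apply/orP; right; rewrite ltnS.
  by apply: leq_bigmax_seq => //; exact: mem_nth.
have key j : (j < size w)%N ->
    (minn (letter (iter j renyi x)) n == nth 0 w j)%N = (letter (iter j renyi x) == nth 0 w j)%N.
  by move=> /wn; lia.
have jn j : (j < size w)%N -> (j < n)%N by move=> jw; rewrite leq_max jw.
split=> [[_ xw]|/allP Sx].
  apply/allP => j; rewrite mem_iota add0n => /andP[_ jw].
  apply/forallP => i; apply/implyP => /eqP ij.
  rewrite ffunE /letter_trunc inordK ?ltnS ?geq_minr// ij key// -[in eqbRHS]xw.
  by rewrite (nth_map 0%N) ?size_iota// nth_iota.
split=> //; apply: (@eq_from_nth _ 0%N); first by rewrite size_itin.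
move=> j; rewrite size_itin => jw; rewrite (nth_map 0%N) ?size_iota// nth_iota// add0n.
have /forallP/(_ (Ordinal (jn j jw))) : [forall i : 'I_n, (i == j :> nat) ==> (prefix_code n x i == nth 0 w j :> nat)%N].
  by apply: Sx; rewrite mem_iota add0n.
rewrite /= eqxx/= ffunE /letter_trunc inordK ?ltnS ?geq_minr//=.
by rewrite key// => /eqP.
Qed.

(** A point x < a has a cylinder around it that remains below a, since cylinders
    shrink uniformly. *)
Lemma word_cover (a : R) x : I01 x -> x < a -> exists2 w, cyl w x & cyl w `<=` [set y | y < a].
Proof.
move=> x01 xa.
have [n na] : exists n : nat, n.+1%:R^-1 < a - x.
  have ax : 0 < a - x by rewrite subr_gt0.
  exists (Num.truncn (a - x)^-1); rewrite -[ltRHS]invrK ltf_pV2 ?posrE ?invr_gt0//.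
  exact: truncnS_gt.
exists (itin n x); first by split=> //; rewrite size_itin.
move=> y; rewrite cylE /= in_itv/= => /andP[_ y1].
have : cyl (itin n x) x by split=> //; rewrite size_itin.
rewrite cylE /= in_itv/= => /andP[x0 _].
have := len_le_size (itin n x) : len _ <= _ :> R; rewrite lenE size_itin => h.
rewrite /=; move: na h; set c := _^-1; lra.
Qed.

Lemma approximable_measurable B : measurable B -> approximable B.
Proof.
suff h : smallest (sigma_algebra setT) (@RGenCInfty.G R) `<=` approximable.
  move=> mB; have {}mB : (@ocitv R).-sigma.-measurable B := mB.
  by rewrite RGenCInfty.measurableE in mB; exact: h.
apply: smallest_sub.
  split.
  - have := approximableC (approximable_cyl [::]).
    by apply: eq_approximable => //; rewrite setI0; apply/seteqP; split => // x [x01]; apply.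
  - by move=> A aA; rewrite setTD; exact: approximableC.
  - exact: approximable_bigcup.
move=> _ [a ->].
pose F i := if unpickle i is Some w then
  (if `[< cyl w `<=` [set y : R | y < a] >] then cyl w else set0) else set0 : set R.
have a0 : approximable set0.
  have := approximableC (approximable_cyl [::]).
  by apply: eq_approximable => //; rewrite setI0; apply/seteqP; split => // x [x01]; apply.
have aF i : approximable (F i).
  rewrite /F; case: (unpickle i) => [w|//].
  by case: ifP => // _; exact: approximable_cyl.
have := approximableC (approximable_bigcup aF).
apply: eq_approximable; first exact: measurable_itv.
apply/seteqP; split => x [x01] /=; rewrite in_itv/= andbT => h; split=> //.
  rewrite leNgt; apply/negP => xa; apply: h.
  have [w wx wa] := word_cover x01 xa.
  exists (pickle w) => //; rewrite /F pickleK.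
  by case: asboolP.
move=> [i _]; rewrite /F; case: (unpickle i) => [w|//].
case: asboolP => // wa /wa /=; by rewrite ltNge h.
Qed.

End Approximation.

Section EntropyApproximation.
Context {R : realType} (mu : probability (measurableTypeR R) R).
Hypothesis mu01 : mu I01 = 1%E.
Implicit Types (x y : R).

(** Approximate each fiber of f by coded sets within e / k, and relabel by the first
    coded set that contains the code of the point. *)
Lemma approximate_label k (f : R -> 'I_k) (e : R) : fibers_measurable I01 f -> 0 < e ->
  exists n (g : {ffun 'I_n -> 'I_n.+1} -> 'I_k),
    (mu (I01 `&` [set x | f x != g (prefix_code n x)]) <= e%:E)%E.
Proof.
move=> mf e0; have k0 : (0 < k)%N by case: (f 0) => i; exact: leq_ltn_trans.
have kR : 0 < k%:R :> R by rewrite ltr0n.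
have aB i : approximable mu (I01 `&` f @^-1` [set i]) by exact: approximable_measurable.
have ek : 0 < e / k%:R by rewrite divr_gt0.
have /choice[F HF] : forall i, exists nb : nat * (R -> bool), coded nb.1 nb.2 /\
    (mu (discrepancy (I01 `&` f @^-1` [set i]) nb.2) <= (e / k%:R)%:E)%E.
  by move=> i; have [n [b [cb be]]] := (aB i).2 _ ek; exists (n, b).
pose n := \max_i (F i).1.
have /choice[S HS] : forall i, exists S : pred {ffun 'I_n -> 'I_n.+1},
    forall x, (F i).2 x = S (prefix_code n x).
  by move=> i; have [c _] := HF i; apply: coded_le c; exact: leq_bigmax.
exists n, (fun c => odflt (f 0) [pick i | S i c]).
pose B i := discrepancy (I01 `&` f @^-1` [set i]) (F i).2.
have mB i : measurable (B i).
  by have [c _] := HF i; apply: measurable_discrepancy c; exact: mf.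
set A := I01 `&` _.
have mA : measurable A.
  have mfc := fibers_pair mf (fibers_renyi_name (n := n) (@fibers_letter_trunc R n)).
  have := measurable_preimage_pred
    (fun c => c.1 != odflt (f 0) [pick i | S i c.2]) mfc.
  by [].
have sub : A `<=` \bigcup_i B i.
  move=> x [x01 /= fg]; apply: contrapT => noB.
  have fS i : f x = i <-> S i (prefix_code n x).
    have : ~ B i x by move=> Bi; apply: noB; exists i.
    rewrite /B /discrepancy/= => /not_andP[//|nB]; rewrite -HS.
    by have := contrapT nB; rewrite /setI/=; tauto.
  move/eqP : fg; apply; case: pickP => [i /fS//|/(_ (f x))].
  by have /fS -> := erefl (f x).
apply: (@le_trans _ _ (mu (\bigcup_i B i))).
  apply: le_measure => //; rewrite inE//.
  by apply: fin_bigcup_measurable => // i _; exact: mB.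
have h : (mu (\bigcup_i B i) <= (#|'I_k|%:R * (e / k%:R))%:E)%E.
  by apply: measure_bigcup_le => // i; exact: (HF i).2.
apply: (le_trans h).
by rewrite card_ord lee_fin mulrC divfK// gt_eqF.
Qed.

(** A function equal to [None] with probability close to 1 has small entropy.  Compare its
    law with the reference law that gives [None] the mass 1 - e1 and each other value the
    mass e1 / (k + 1): the cross entropy is at most - ln (1 - e1) plus the
    probability of not being [None] times ln ((k + 1) / e1). *)
Lemma small_discrepancy_entropy k (delta : R) : 0 < delta ->
  exists2 e : R, 0 < e & forall D : R -> option 'I_k, fibers_measurable I01 D ->
    (mu (I01 `&` [set x | D x != None]) <= e%:E)%E -> entropy mu I01 D <= delta.
Proof.
move=> d0; have d2 : 0 < delta / 2 by rewrite divr_gt0.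
pose e1 : R := 1 - expR (- (delta / 2)).
have e10 : 0 < e1 by rewrite subr_gt0 expR_lt1 oppr_lt0.
have e11 : e1 < 1 by rewrite gtrBl expR_gt0.
have kR : 0 < k.+1%:R :> R by [].
pose l := - ln (e1 / k.+1%:R).
have l0 : 0 <= l.
  rewrite oppr_ge0 ln_le0// ler_pdivrMr// mul1r (le_trans (ltW e11))//.
  by rewrite ler1n.
have l1 : 0 < l + 1 by rewrite ltr_wpDl.
exists (delta / 2 / (l + 1)); first by rewrite divr_gt0.
move=> D mD De; pose q (o : option 'I_k) := if o is Some _ then e1 / k.+1%:R else 1 - e1.
have q0 o : 0 < q o.
  by case: o => [i|] /=; [rewrite divr_gt0|rewrite subr_gt0].
have sumopt (F : option 'I_k -> R) : \sum_o F o = F None + \sum_(i < k) F (Some i).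
  rewrite (bigD1 None)//=; congr (_ + _).
  rewrite (reindex_omap Some id) => [|[i|]]//=.
  by apply: eq_bigl => i; rewrite eqxx.
have := @entropy_le_cross _ _ _ mu I01 mu01 _ D q mD (fun o => ltW (q0 o)) (fun o _ => q0 o).
have -> : \sum_o q o <= 1.
  rewrite sumopt /= sumr_const card_ord -[_ *+ k]mulr_natr mulrAC -mulrA.
  have : e1 * (k%:R / k.+1%:R) <= e1.
    by rewrite ler_piMr ?(ltW e10)// ler_pdivrMr// mul1r ler_nat.
  by set c := e1 * _; lra.
move=> /(_ isT) /le_trans; apply; rewrite sumopt /=.
have lN : law mu I01 D None <= 1 by exact: law_le1.
have lS : \sum_(i < k) law mu I01 D (Some i) <= delta / 2 / (l + 1).
  rewrite -lee_fin; apply: le_trans De; rewrite (measure_preimage_pred mu (fun o => o != None) mD).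
  by rewrite (big_mkcond (fun o => o != None)) sumopt/= add0r.
have lE : ln (e1 / k.+1%:R) = - l by rewrite opprK.
clearbody l; rewrite -mulr_suml lE.
have -> : ln (1 - e1) = - (delta / 2) by rewrite /e1 opprB addrC subrK expRK.
have h1 : law mu I01 D None * (delta / 2) <= delta / 2 by rewrite ler_piMl// ltW.
have h2 : (\sum_(i < k) law mu I01 D (Some i)) * l <= delta / 2.
  apply: (@le_trans _ _ (delta / 2 / (l + 1) * l)); first by rewrite ler_wpM2r.
  rewrite -mulrA ler_piMr ?(ltW d2)// mulrC ler_pdivrMr// mul1r lerDl//.
rewrite !mulrN -opprD (opprK (_ + _)) (le_trans (lerD h1 h2))//.
by rewrite -splitr.
Qed.

End EntropyApproximation.

Section EntropyOfCodes.
Context {R : realType} (mu : probability (measurableTypeR R) R).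
Hypothesis invmu : invariant_measures mu.
Implicit Types (x y : R).

Let mu01 : mu I01 = 1%E := invmu.1.

Lemma addn_ord_proof n m (j : 'I_n) (i : 'I_m) : (j + i < n + m)%N.
Proof. by have := ltn_ord j; have := ltn_ord i; lia. Qed.

Definition addn_ord n m (j : 'I_n) (i : 'I_m) : 'I_(n + m) := Ordinal (addn_ord_proof j i).

Lemma prefix_code_name n m j x :
  prefix_code m (iter (j : 'I_n) renyi x) =
  [ffun i : 'I_m => name renyi (letter_trunc m) (n + m) x (addn_ord j i)].
Proof. by apply/ffunP => i; rewrite !ffunE -iterD addnC. Qed.

(** Let h be a function of m truncated digits that approximates f, and let D record the
    value of f where f and h differ.  The n-name of f is a function of the n-names of h and
    of D; the former is a function of n + m truncated digits, and the latter has
    entropy at most n times that of D, which is small. *)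
Lemma entropy_code_lower k (f : R -> 'I_k) (v delta : R) :
  fibers_measurable I01 f -> (forall n, n%:R * v <= entropy mu I01 (name renyi f n)) ->
  0 < delta -> exists m, forall n,
    n%:R * (v - delta) <= entropy mu I01 (name renyi (letter_trunc m) (n + m)).
Proof.
move=> mf fv d0; have [e e0 eD] := small_discrepancy_entropy mu01 k d0.
have [m [g ge]] := approximate_label mu mf e0.
pose h x := g (prefix_code m x).
(* D takes the value [None] where h is right. *)
pose D x : option 'I_k := if f x == h x then None else Some (f x).
have mcode n : fibers_measurable I01 (name renyi (@letter_trunc R m) n).
  by apply: fibers_renyi_name; exact: fibers_letter_trunc.
have mh : fibers_measurable I01 h by apply: (fibers_comp g); exact: mcode.
have mD : fibers_measurable I01 D.
  have hD := fibers_comp (fun c => if c.1 == c.2 then None else Some c.1) (fibers_pair mf mh).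
  exact: hD.
have HD : entropy mu I01 D <= delta.
  apply: eD => //; apply: le_trans ge; apply: le_measure; rewrite ?inE.
  - exact: (measurable_preimage_pred (fun o => o != None) mD).
  - exact: (measurable_preimage_pred (fun c => c.1 != c.2) (fibers_pair mf mh)).
  - move=> x [x01 /= Dx]; split=> //=; move: Dx; rewrite /D /h.
    by case: (f x == _).
exists m => n; rewrite mulrBr lerBlDr (le_trans (fv n))//.
have nD : entropy mu I01 (name renyi D n) <= n%:R * delta.
  apply: (@le_trans _ _ (n%:R * entropy mu I01 D)); last by rewrite ler_wpM2l.
  apply: (@entropy_name_le _ (measurableTypeR R) R mu I01 renyi) => //.
  - exact: measurable_I01.
  - by move=> x _; exact: renyi_I01.
  - exact: renyi_preimage.
  - exact: invmu.2.
have fibD : fibers_measurable I01 (name renyi D n) by exact: fibers_renyi_name.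
have fibh : fibers_measurable I01 (name renyi h n) by exact: fibers_renyi_name.
have h1 : entropy mu I01 (name renyi f n) <=
    entropy mu I01 (name renyi h n) + entropy mu I01 (name renyi D n).
  apply: le_trans (entropy_pair mu01 fibh fibD).
  have := entropy_comp mu (fun c : {ffun 'I_n -> 'I_k} * {ffun 'I_n -> option 'I_k} =>
    [ffun j => odflt (c.1 j) (c.2 j)]) (fibers_pair fibh fibD).
  apply: le_trans; rewrite le_eqVlt; apply/orP; left; apply/eqP.
  apply: eq_entropy => x _; apply/ffunP => j; rewrite !ffunE /D.
  by case: eqP => //= ->.
have h2 : entropy mu I01 (name renyi h n) <=
    entropy mu I01 (name renyi (letter_trunc m) (n + m)).
  have := entropy_comp mu (fun c : {ffun 'I_(n + m) -> 'I_m.+1} =>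
    [ffun j : 'I_n => g [ffun i : 'I_m => c (addn_ord j i)]]) (mcode (n + m)%N).
  apply: le_trans; rewrite le_eqVlt; apply/orP; left; apply/eqP.
  apply: eq_entropy => x _; apply/ffunP => j; rewrite !ffunE /h.
  by congr g; exact: prefix_code_name.
by rewrite (le_trans h1)// lerD.
Qed.

End EntropyOfCodes.

(** * Integrals along orbits of an invariant measure *)

Section InvariantIntegrals.
Context {R : realType} (mu : probability (measurableTypeR R) R).
Hypothesis invmu : invariant_measures mu.
Implicit Types (x y : R).

Let mu01 : mu I01 = 1%E := invmu.1.
Let m01 : measurable (I01 : set (measurableTypeR R)) := measurable_I01.

Let mC : measurable (~` I01 : set (measurableTypeR R)).
Proof. exact: measurableC. Qed.

Lemma measure_I01C : mu (~` I01) = 0%E.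
Proof. by rewrite probability_setC// mu01 subee. Qed.

(** The map extended by 0 outside [0, 1), so that image measures can be formed. *)
Definition renyiT : measurableTypeR R -> measurableTypeR R := patch (fun=> 0) I01 renyi.

Lemma renyiTE x : I01 x -> renyiT x = renyi x.
Proof. by move=> x01; rewrite /renyiT patchT// inE. Qed.

Lemma renyiT_I01 x : I01 (renyiT x).
Proof.
have [x01|x01] := pselect (I01 x); first by rewrite renyiTE//; exact: renyi_I01.
rewrite /renyiT patchN ?notin_setE//; apply/I01E; rewrite lexx ltr01//.
Qed.

Lemma measurable_renyiT : measurable_fun setT renyiT.
Proof. by apply/(measurable_restrictT _ m01); exact: measurable_renyi. Qed.

Lemma ge0_integral_renyi (f : R -> \bar R) :
  measurable_fun I01 f -> (forall x, I01 x -> (0 <= f x)%E) ->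
  (\int[mu]_(x in I01) f (renyi x) = \int[mu]_(x in I01) f x)%E.
Proof.
move=> mf f0.
have preT : renyiT @^-1` I01 = setT by apply/seteqP; split => // x _; exact: renyiT_I01.
have -> : (\int[mu]_(x in I01) f x =
    \int[image_measure mu measurable_renyiT]_(x in I01) f x)%E.
  apply: eq_measure_integral => A mA A01.
  rewrite -[LHS](invmu.2 A mA A01) /image_measure/= /pushforward.
  rewrite (_ : renyiT @^-1` A = (I01 `&` renyi @^-1` A) `|` (renyiT @^-1` A `&` ~` I01)).
    apply/esym/measureU0.
    - exact: renyi_preimage.
    - apply: measurableI => //.
      by rewrite -[X in measurable X]setTI; exact: (measurable_renyiT measurableT mA).
    - apply: (subset_measure0 _ _ _ measure_I01C) => //.
      apply: measurableI => //.
      by rewrite -[X in measurable X]setTI; exact: (measurable_renyiT measurableT mA).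
  apply/seteqP; split => x /=.
    have [x01|x01] := pselect (I01 x); last by right.
    by rewrite renyiTE//; left.
  by move=> [[x01 Ax]|[]//]; rewrite renyiTE.
rewrite ge0_integral_pushforward//; last 2 first.
- exact: measurable_renyiT.
- by move=> x /set_mem; exact: f0.
rewrite preT; apply/esym.
have mfT : measurable_fun setT (f \o renyiT).
  apply: (@measurable_comp _ _ _ _ _ _ I01) => //.
    by move=> _ [x _ <-]; exact: renyiT_I01.
  exact: measurable_renyiT.
rewrite -(setUv I01) ge0_integral_setU//=; last 3 first.
- by rewrite setUv.
- by move=> x _; apply: f0; exact: renyiT_I01.
- by apply/disj_setPCl.
rewrite [X in (_ + X)%E](_ : _ = 0%E); last first.
  apply: null_set_integral => //; first exact: measurable_funTS.
  exact: measure_I01C.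
by rewrite adde0; apply: eq_integral => x /set_mem x01; rewrite renyiTE.
Qed.

Lemma measurable_fun_renyi (f : R -> \bar R) :
  measurable_fun I01 f -> measurable_fun I01 (f \o renyi).
Proof.
move=> mf; apply: (@measurable_comp _ _ _ _ _ _ I01) => //.
- by move=> _ [x _ <-]; exact: renyi_I01.
- exact: measurable_renyi.
Qed.

Lemma integral_renyi (f : R -> \bar R) : mu.-integrable I01 f ->
  mu.-integrable I01 (f \o renyi) /\
  (\int[mu]_(x in I01) f (renyi x) = \int[mu]_(x in I01) f x)%E.
Proof.
move=> /integrableP[mf fi]; split.
  apply/integrableP; split; first exact: measurable_fun_renyi.
  rewrite (ge0_integral_renyi (f := fun x => `|f x|%E))//.
  exact: measurableT_comp.
rewrite [RHS]integralE [LHS]integralE; congr (_ - _)%E.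
  rewrite -(ge0_integral_renyi (measurable_funepos mf))//.
  by apply: eq_integral => x _; rewrite !funeposE.
rewrite -(ge0_integral_renyi (measurable_funeneg mf))//.
by apply: eq_integral => x _; rewrite !funenegE.
Qed.

Lemma integral_iter_renyi (f : R -> \bar R) n : mu.-integrable I01 f ->
  mu.-integrable I01 (fun x => f (iter n renyi x)) /\
  (\int[mu]_(x in I01) f (iter n renyi x) = \int[mu]_(x in I01) f x)%E.
Proof.
move=> fi; elim: n => [//|n [IH1 IH2]].
have [h1 h2] := integral_renyi IH1; split.
  by apply: eq_integrable h1 => // x _ /=; rewrite -iterSr.
by rewrite -IH2 -h2; apply: eq_integral => x _; rewrite -iterSr.
Qed.

Lemma integral_birkhoff (f : R -> R) (a : R) n : mu.-integrable I01 (EFin \o f) ->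
  (\int[mu]_(x in I01) (f x)%:E = a%:E)%E ->
  mu.-integrable I01 (EFin \o (fun x => \sum_(j < n) f (iter j renyi x))) /\
  (\int[mu]_(x in I01) (\sum_(j < n) f (iter j renyi x))%:E = (n%:R * a)%:E)%E.
Proof.
move=> fi fa; elim: n => [|n [IH1 IH2]].
  under eq_integral do rewrite big_ord0.
  rewrite integral0 mul0r; split=> //.
  apply: (eq_integrable _ (cst 0%E)) => //; last exact: integrable0.
  by move=> x _ /=; rewrite big_ord0.
have [h1 h2] := integral_iter_renyi n fi; split.
  have hs := @integrableD _ (measurableTypeR R) R mu I01 m01 _ _ IH1 h1.
  by apply: eq_integrable hs => // x _ /=; rewrite big_ord_recr.
under eq_integral do rewrite big_ord_recr/= EFinD.
rewrite (@integralD _ (measurableTypeR R) R mu I01 m01 _ _ IH1 h1).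
rewrite -natr1 mulrDl mul1r EFinD; congr (_ + _)%E; first exact: IH2.
by rewrite -fa; exact: h2.
Qed.

End InvariantIntegrals.

(** * Distribution of the first digits under an invariant measure *)

Section WordDistribution.
Context {R : realType} (mu : probability (measurableTypeR R) R).
Hypothesis mu01 : mu I01 = 1%E.
Variable N : nat.
Implicit Types (x y : R) (h : seq nat -> R).

Let m01 : measurable (I01 : set (measurableTypeR R)) := measurable_I01.

Definition word_prob L (t : N.-tuple 'I_L) : R := fine (mu (cyl (tword t))).

Definition bounded_words L : set R := I01 `&` [set x | all (fun a => a < L)%N (itin N x)].

Lemma fibers_itin : fibers_measurable I01 (@itin R N).
Proof.
move=> w; have [wN|wN] := eqVneq (size w) N.
  rewrite (_ : _ `&` _ = cyl w); first exact: measurable_cyl.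
  by rewrite /cyl wN.
rewrite (_ : _ `&` _ = set0)//; apply/seteqP; split => // x [_ /= xw].
by move: wN; rewrite -xw size_itin eqxx.
Qed.

Lemma measurable_itin_fun h : measurable_fun I01 (fun x : R => h (itin N x)).
Proof. exact: (measurable_fun_fibers h fibers_itin). Qed.

Lemma bounded_wordsE L : bounded_words L =
  \big[setU/set0]_(t <- enum {: N.-tuple 'I_L}) cyl (tword t).
Proof.
rewrite -bigcup_seq; apply/seteqP; split => [x [x01 /= xL]|x [t _ [x01]]].
  have [t tx] := tword_surj (size_itin N x) xL; exists t; first by rewrite /= mem_enum.
  by split=> //; rewrite size_tword.
by rewrite size_tword => xt; split=> //=; rewrite xt tword_bounded.
Qed.

Lemma measurable_bounded_words L : measurable (bounded_words L).
Proof. by rewrite bounded_wordsE; apply: bigsetU_measurable => t _; exact: measurable_cyl. Qed.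

Lemma integral_bounded_words L h :
  (\int[mu]_(x in bounded_words L) (h (itin N x))%:E =
   (\sum_(t : N.-tuple 'I_L) word_prob t * h (tword t))%:E)%E.
Proof.
rewrite bounded_wordsE integral_bigsetU_EFin ?enum_uniq//.
- rewrite -sumEFin big_enum/=; apply: eq_bigr => t _.
  rewrite (eq_integral (cst (h (tword t))%:E)) => [|x /set_mem[_]]; last first.
    by rewrite size_tword => ->.
  rewrite integral_cst; last exact: measurable_cyl.
  rewrite muleC EFinM /word_prob fineK//.
  by apply: fin_num_measure; exact: measurable_cyl.
- by move=> t; exact: measurable_cyl.
- by move=> t t' _ _ /cyl_disjoint; rewrite !size_tword => /(_ erefl)/tword_inj.
- rewrite -bounded_wordsE; apply/measurable_EFinP.
  by apply: measurable_funS (measurable_itin_fun h) => //; exact: subIsetl.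
Qed.

Lemma word_prob_ge0 L (t : N.-tuple 'I_L) : 0 <= word_prob t.
Proof. exact: fine_ge0. Qed.

(** Dominated convergence, as the set of points whose first N letters are below L
    increases to [0, 1). *)
Lemma word_sum_cvg h (a : R) :
  mu.-integrable I01 (fun x => (h (itin N x))%:E) ->
  (\int[mu]_(x in I01) (h (itin N x))%:E = a%:E)%E ->
  (\sum_(t : N.-tuple 'I_L) word_prob t * h (tword t)) @[L --> \oo] --> a.
Proof.
move=> ih ha; set f : R -> \bar R := fun x => (h (itin N x))%:E in ih *.
have mf : measurable_fun I01 f by case/integrableP: ih.
have E01 L : I01 `&` bounded_words L = bounded_words L.
  by apply/setIidPr; exact: subIsetl.
have mE := measurable_bounded_words.
have hm L : measurable_fun I01 (f \_ (bounded_words L)).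
  apply/(measurable_restrict f (mE L) m01).
  by rewrite E01; apply: measurable_funS mf => //; exact: subIsetl.
have hcv : \forall x \ae mu, I01 x -> (f \_ (bounded_words L)) x @[L --> \oo] --> f x.
  apply: aeW => x x01; apply: cvg_near_cst; near=> L.
  rewrite patchT// inE; split=> //=; apply/allP => l lx.
  have : (\max_(l <- itin N x) l < L)%N by near: L; exists (\max_(l <- itin N x) l).+1.
  by apply: leq_ltn_trans; exact: leq_bigmax_seq.
have hb : \forall x \ae mu, forall L, I01 x -> (`|(f \_ (bounded_words L)) x| <= `|f x|)%E.
  apply: aeW => x L x01; rewrite /patch; case: ifP => // _.
  by rewrite abse0.
have ia : mu.-integrable I01 (abse \o f) by exact: integrable_abse.
have [_ _ cv] := @dominated_convergence _ (measurableTypeR R) R mu I01 m01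
  (fun L => f \_ (bounded_words L)) f (abse \o f) hm mf hcv ia hb.
apply: (@fine_cvg _ _ _ _ (fun L => (\sum_(t : N.-tuple 'I_L) word_prob t * h (tword t))%:E)).
rewrite -ha; apply: cvg_trans cv; apply: near_eq_cvg; near=> L => /=.
by rewrite -integral_mkcondr E01 integral_bounded_words.
Unshelve. all: by end_near. Qed.

Lemma word_prob_cvg1 :
  (\sum_(t : N.-tuple 'I_L) word_prob t) @[L --> \oo] --> (1 : R).
Proof.
have muf : (mu I01 < +oo)%E by rewrite mu01 ltry.
have i1 : mu.-integrable I01 (fun x : R => ((fun=> 1) (itin N x))%:E).
  by apply: measurable_bounded_integrable => //; exact: bounded_cst.
have h1 : (\int[mu]_(x in I01) ((fun=> 1) (itin N x))%:E = 1%:E)%E.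
  transitivity (1%:E * mu I01)%E; first exact: integral_cst.
  by rewrite mu01 mule1.
have := @word_sum_cvg (fun=> 1) 1 i1 h1.
by under eq_fun do under eq_bigr do rewrite mulr1.
Qed.

End WordDistribution.

Section WordGain.
Context {R : realType} (mu : probability (measurableTypeR R) R).
Implicit Types (x y : R).
Hypothesis invmu : invariant_measures mu.

Let mu01 : mu I01 = 1%E := invmu.1.
Let m01 : measurable (I01 : set (measurableTypeR R)) := measurable_I01.

Lemma integral_finite_valued (A : finType) (f : R -> A) (F : A -> R) :
  fibers_measurable I01 f ->
  mu.-integrable I01 (fun x => (F (f x))%:E) /\
  (\int[mu]_(x in I01) (F (f x))%:E = (\sum_a law mu I01 f a * F a)%:E)%E.
Proof.
move=> mf; have muf : (mu I01 < +oo)%E by rewrite mu01 ltry.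
have mFf : measurable_fun I01 (F \o f) by exact: measurable_fun_fibers.
split.
  apply: measurable_bounded_integrable => //.
  exists (\sum_a `|F a|); split; first exact: num_real.
  move=> M FM x _ /=; rewrite (le_trans _ (ltW FM))// (bigD1 (f x))//= lerDl.
  exact: sumr_ge0.
have E : I01 = \big[setU/set0]_(a <- enum A) (I01 `&` f @^-1` [set a]).
  rewrite -bigcup_seq; apply/seteqP; split => [x x01|x [a _ []]//].
  by exists (f x) => //=; rewrite mem_enum.
rewrite [X in integral _ X _]E integral_bigsetU_EFin ?enum_uniq//.
- rewrite -sumEFin big_enum/=; apply: eq_bigr => a _.
  rewrite (eq_integral (cst (F a)%:E)) => [|x /set_mem[_ /= ->]//].
  rewrite integral_cst; last exact: mf.
  rewrite muleC EFinM /law fineK//.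
  by apply: fin_num_measure; exact: mf.
- by move=> a b _ _ [x [[_ /= <-] [_ /= <-]]].
- by rewrite -E; apply/measurable_EFinP.
Qed.

Variable N : nat.

(** The energy - ln (len w) of the word read at x exceeds the Birkhoff sum of [- phi] at
    x by at most ln (N + 1), and that sum has integral N a by invariance. *)
Lemma word_energy_le (a : R) L :
  mu.-integrable I01 (EFin \o (fun x => - phi x)) ->
  (\int[mu]_(x in I01) (- phi x)%:E = a%:E)%E ->
  \sum_(t : N.-tuple 'I_L) word_prob mu t * - ln (len (tword t)) <=
    N%:R * a + ln N.+1%:R.
Proof.
move=> iphi aphi; have [ib bE] := integral_birkhoff invmu N iphi aphi.
have muf : (mu I01 < +oo)%E by rewrite mu01 ltry.
have ic : mu.-integrable I01 (EFin \o (fun _ : R => ln N.+1%:R : R)).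
  by apply: measurable_bounded_integrable => //; exact: bounded_cst.
pose G x : R := \sum_(j < N) - phi (iter j renyi x) + ln N.+1%:R.
have GE : (\int[mu]_(x in I01) (G x)%:E = (N%:R * a + ln N.+1%:R)%:E)%E.
  rewrite /G; under eq_integral do rewrite EFinD.
  rewrite (@integralD _ (measurableTypeR R) R mu I01 m01 _ _ ib ic).
  rewrite EFinD; congr (_ + _)%E; first exact: bE.
  transitivity ((ln N.+1%:R)%:E * mu I01)%E; first exact: integral_cst.
  by rewrite mu01 mule1.
have hG x : I01 x -> - ln (len (itin N x)) <= G x.
  move=> x01; rewrite /G sumrN sum_phi// opprK.
  have /I01E/andP[y0 y1] := iter_renyi_I01 N x01.
  have := len_inv_le (itin N x) y0 (ltW y1); rewrite size_itin.
  rewrite -ler_ln ?posrE ?invr_gt0 ?mulr_gt0 ?exprn_gt0 ?len_gt0 ?den_gt0//.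
  by rewrite lnV ?posrE ?len_gt0// lnM ?posrE ?exprn_gt0 ?den_gt0// addrC.
have h0 x : 0 <= - ln (len (itin N x) : R) by rewrite oppr_ge0 ln_le0// len_le1.
have mh : measurable_fun I01 (EFin \o (fun x => - ln (len (itin N x) : R))).
  by apply/measurable_EFinP; exact: (measurable_itin_fun N (fun w => - ln (len w))).
have mG : measurable_fun I01 (EFin \o G).
  apply/measurable_EFinP; apply: measurable_funD => //.
  case/integrableP : ib => mb _.
  by apply/measurable_EFinP; exact: mb.
rewrite -lee_fin -(@integral_bounded_words _ mu N L (fun w => - ln (len w))) -GE.
apply: (@le_trans _ _ (\int[mu]_(x in I01) (- ln (len (itin N x)))%:E)%E).
  apply: ge0_subset_integral => //.
  - exact: measurable_bounded_words.
  - by move=> x _; rewrite lee_fin.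
  - by move=> x [].
apply: ge0_le_integral => //.
by move=> x _; rewrite lee_fin.
Qed.

Definition trunc_code m (w : seq nat) : {ffun 'I_N -> 'I_m.+1} :=
  [ffun j : 'I_N => inord (minn (nth 0%N w j) m)].

Lemma trunc_codeE m x : name renyi (letter_trunc m) N x = trunc_code m (itin N x).
Proof.
apply/ffunP => j; rewrite !ffunE (nth_map 0%N) ?size_iota//.
by rewrite nth_iota.
Qed.

(** The words of letters below L determine the truncated code, so each has probability at
    most that of its code, and the entropy of the code is the limit of the
    cross entropies over these words.  Working with the code avoids assuming that the
    countable partition by digits has finite entropy. *)
Lemma word_entropy_lower m (delta : R) : 0 < delta -> \forall L \near \oo,
  entropy mu I01 (name renyi (letter_trunc m) N) - delta <=
  - \sum_(t : N.-tuple 'I_L) word_prob mu t * ln (word_prob mu t).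
Proof.
move=> d0; pose q := law mu I01 (name renyi (@letter_trunc R m) N).
have mc : fibers_measurable I01 (name renyi (@letter_trunc R m) N).
  by apply: fibers_renyi_name; exact: fibers_letter_trunc.
have [i1 i2] := integral_finite_valued (fun c => - ln (q c)) mc.
have cv := @word_sum_cvg _ mu N (fun w => - ln (q (trunc_code m w)))
  (entropy mu I01 (name renyi (letter_trunc m) N)).
have {}cv : (\sum_(t : N.-tuple 'I_L) word_prob mu t * - ln (q (trunc_code m (tword t))))
    @[L --> \oo] --> entropy mu I01 (name renyi (letter_trunc m) N).
  apply: cv.
    by apply: eq_integrable i1 => // x _; rewrite trunc_codeE.
  under eq_integral do rewrite -trunc_codeE.
  rewrite i2; congr EFin; rewrite /entropy -sumrN; apply: eq_bigr => c _.
  by rewrite mulrN.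
near=> L; have : `|entropy mu I01 (name renyi (letter_trunc m) N) -
   \sum_(t : N.-tuple 'I_L) word_prob mu t * - ln (q (trunc_code m (tword t)))| <= delta.
  by near: L; move/cvgrPdist_le : cv => /(_ _ d0).
rewrite ler_distl => /andP[_ h]; rewrite lerBlDr (le_trans h)// lerD2r.
rewrite -sumrN; apply: ler_sum => t _; rewrite -mulrN.
have := word_prob_ge0 mu t; rewrite le_eqVlt => /predU1P[<-|p0]; first by rewrite !mul0r.
have pq : word_prob mu t <= q (trunc_code m (tword t)).
  apply: fine_le.
  - by apply: fin_num_measure; exact: measurable_cyl.
  - by apply: fin_num_measure; exact: mc.
  apply: le_measure; rewrite ?inE; [exact: measurable_cyl|exact: mc|].
  by move=> x [x01]; rewrite size_tword => xt; split=> //=; rewrite trunc_codeE xt.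
by rewrite ler_pM2l// lerN2 ler_ln ?posrE// (lt_le_trans p0).
Unshelve. all: by end_near. Qed.

End WordGain.

Section TypicalWords.
Context {R : realType} (mu : probability (measurableTypeR R) R) (psi : nat -> R).
Hypothesis invmu : invariant_measures mu.
Implicit Types (x y : R).

Let mu01 : mu I01 = 1%E := invmu.1.

Lemma mean_gain_normalize N L (q : N.-tuple 'I_L -> R) :
  (forall t, 0 <= q t) -> 0 < \sum_t q t ->
  let p t := q t / \sum_t q t in
  mean p (gain p) = (\sum_t q t)^-1 * (\sum_t q t * ln (len (tword t)) - \sum_t q t * ln (q t))
    - ln N.+1%:R + ln (\sum_t q t).
Proof.
move=> q0 Z0 p; set Z := \sum_t q t in Z0 p *.
have qZ : \sum_t Z^-1 * q t = 1 by rewrite -mulr_sumr mulVf ?gt_eqF.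
have E c : c = \sum_t Z^-1 * q t * c by rewrite -mulr_suml qZ mul1r.
rewrite -sumrB mulr_sumr [ln N.+1%:R]E [ln Z]E -sumrB -big_split/=.
apply: eq_bigr => t _; rewrite /p /gain.
have := q0 t; rewrite le_eqVlt => /predU1P[<-|qt]; first by rewrite !(mul0r, mulr0, subr0, addr0).
rewrite !ln_div ?posrE ?len_gt0//; field; rewrite gt_eqF//.
Qed.

(** The probabilities of the words of letters below L have a sum Z that tends to 1 as L
    grows; dividing by Z makes them a distribution at a cost that vanishes in the limit. *)
Lemma normalized_word_prob N m (X M delta : R) : (0 < N)%N -> 0 < delta ->
  mu.-integrable I01 (EFin \o (fun x => - phi x)) ->
  (\int[mu]_(x in I01) (- phi x)%:E = X%:E)%E ->
  mu.-integrable I01 (EFin \o (fun x => psi (digit 1 x))) ->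
  (\int[mu]_(x in I01) (psi (digit 1 x))%:E = M%:E)%E ->
  \forall L \near \oo, exists p : N.-tuple 'I_L -> R,
  [/\ forall t, 0 <= p t, \sum_t p t = 1,
      `|N%:R^-1 * mean p (word_sum psi \o @tword N L) - M| <= delta &
      entropy mu I01 (name renyi (letter_trunc m) N) - N%:R * X - 2 * ln N.+1%:R - delta
        <= mean p (gain p)].
Proof.
move=> N0 d0 iphi phiX ipsi psiM.
have NR : N%:R != 0 :> R by rewrite pnatr_eq0 -lt0n.
set H := entropy _ _ _; pose Z L : R := \sum_(t : N.-tuple 'I_L) word_prob mu t.
have Z1 : Z L @[L --> \oo] --> (1 : R) by exact: word_prob_cvg1.
have [bi bE] := integral_birkhoff invmu N ipsi psiM.
have fM : (\sum_(t : N.-tuple 'I_L) word_prob mu t * word_sum psi (tword t)) @[L --> \oo]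
    --> N%:R * M.
  apply: (@word_sum_cvg _ mu N (word_sum psi)).
    by apply: eq_integrable bi => [|x /set_mem x01]; [exact: measurable_I01|rewrite /= sum_digit_fun].
  rewrite -bE; apply: eq_integral => x /set_mem x01.
  by rewrite sum_digit_fun.
have ZV : (Z L)^-1 @[L --> \oo] --> (1 : R).
  by rewrite -[X in _ --> X]invr1; apply: cvgV => //; exact: oner_neq0.
have meanM : N%:R^-1 * ((Z L)^-1 *
    \sum_(t : N.-tuple 'I_L) word_prob mu t * word_sum psi (tword t)) @[L --> \oo] --> M.
  have -> : M = N%:R^-1 * (1 * (N%:R * M)) by rewrite mul1r mulKf.
  by apply: cvgMl_tmp; apply: cvgM.
pose c := H - N%:R * X - ln N.+1%:R - delta / 4.
have gc : (Z L)^-1 * c + ln (Z L) @[L --> \oo] --> c.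
  rewrite [X in _ --> X](_ : c = 1 * c + ln 1); last by rewrite ln1 mul1r addr0.
  apply: cvgD; first exact: cvgMr_tmp.
  apply: continuous_cvg Z1; exact: (continuous_ln (ltr01 : 0 < (1 : R))).
have d4 : 0 < delta / 4 by rewrite divr_gt0.
near=> L.
have Zpos : 0 < Z L.
  by near: L; exact: (cvgr_gt _ Z1).
exists (fun t => word_prob mu t / Z L); split.
- by move=> t; rewrite divr_ge0 ?word_prob_ge0// ltW.
- by rewrite -mulr_suml mulfV ?gt_eqF.
- have -> : mean (fun t => word_prob mu t / Z L) (word_sum psi \o @tword N L) =
     (Z L)^-1 * \sum_(t : N.-tuple 'I_L) word_prob mu t * word_sum psi (tword t).
    by rewrite /mean mulr_sumr; apply: eq_bigr => t _ /=; ring.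
  by rewrite distrC; near: L; move/cvgrPdist_le : meanM => /(_ _ d0).
rewrite (mean_gain_normalize (@word_prob_ge0 _ mu N L) Zpos) -/(Z L).
have h1 : H - delta / 4 <= - \sum_(t : N.-tuple 'I_L) word_prob mu t * ln (word_prob mu t).
  by near: L; exact: word_entropy_lower.
have h2 := @word_energy_le _ mu invmu N _ L iphi phiX.
have {}h2 : - (N%:R * X + ln N.+1%:R) <=
    \sum_(t : N.-tuple 'I_L) word_prob mu t * ln (len (tword t)).
  by rewrite lerNl -sumrN; under eq_bigr do rewrite -mulrN.
have h3 : `|c - ((Z L)^-1 * c + ln (Z L))| <= delta / 4.
  by near: L; move/cvgrPdist_le : gc => /(_ _ d4).
set S := _ - \sum_t _ * ln (word_prob _ _).
have cS : c <= S by rewrite /c /S; move: h1 h2; lra.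
have : (Z L)^-1 * c <= (Z L)^-1 * S by rewrite ler_wpM2l// invr_ge0 ltW.
move: h3; rewrite ler_distl => /andP[_]; rewrite /c; lra.
Unshelve. all: by end_near. Qed.

End TypicalWords.

(** Choose a partition that has entropy above v + X, X being the exponent of mu, and
    replace it by truncated digits.  The m extra digits and the logarithmic terms
    cost a bounded amount plus a small multiple of N. *)
Lemma free_energy_words {R : realType} (mu : probability (measurableTypeR R) R)
    (psi : nat -> R) (M v e : R) : invariant_measures_phi mu ->
  mu.-integrable I01 (fun x => (psi (digit 1 x))%:E) ->
  (\int[mu]_(x in I01) (psi (digit 1 x))%:E = M%:E)%E ->
  (v%:E < free_energy mu)%E -> 0 < e ->
  \forall N \near \oo, \forall L \near \oo, exists p : N.-tuple 'I_L -> R,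
  [/\ forall t, 0 <= p t, \sum_t p t = 1,
      `|N%:R^-1 * mean p (word_sum psi \o @tword N L) - M| <= e &
      v - e <= N%:R^-1 * mean p (gain p)].
Proof.
move=> [invmu iphi] ipsi psiM vF e0.
have m01 : measurable (I01 : set (measurableTypeR R)) by exact: measurable_I01.
have finphi : (\int[mu]_(x in I01) (phi x)%:E)%E \is a fin_num.
  exact: integrable_fin_num iphi.
pose X := - fine (\int[mu]_(x in I01) (phi x)%:E)%E.
have lyX : lyapunov mu = X%:E by rewrite /lyapunov /X EFinN fineK.
have iphiN : mu.-integrable I01 (EFin \o (fun x => - phi x)).
  by have := integrableN iphi; apply: eq_integrable.
have phiX : (\int[mu]_(x in I01) (- phi x)%:E = X%:E)%E.
  rewrite -lyX /lyapunov -integralN//; last exact: integrable_add_def.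
have vX : ((v + X)%:E < ks_entropy I01 renyi mu)%E.
  by move: vF; rewrite /free_energy lyX lteBrDr// -EFinD.
have [k [f [mf fv]]] := ks_entropy_gt m01 invmu.1 (fun x _ => renyi_I01 x) renyi_preimage invmu.2 vX.
have e4 : 0 < e / 4 by rewrite divr_gt0.
have e8 : 0 < e / 8 by rewrite divr_gt0.
have [m mv] := entropy_code_lower invmu mf fv e4.
pose C := m%:R * (v + X - e / 4) + 2 * (e / 8 - ln (e / 8)) + e.
near=> N.
have N0 : (0 < N)%N by near: N; exists 1%N.
have mN : (m <= N)%N by near: N; exists m.
have CN : C <= N%:R * (e / 4).
  by rewrite -ler_pdivrMr//; near: N; exact: nbhs_infty_ger.
near=> L.
have [p [p0 p1 pM pG]] : exists p : N.-tuple 'I_L -> R,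
  [/\ forall t, 0 <= p t, \sum_t p t = 1,
      `|N%:R^-1 * mean p (word_sum psi \o @tword N L) - M| <= e &
      entropy mu I01 (name renyi (letter_trunc m) N) - N%:R * X - 2 * ln N.+1%:R - e
        <= mean p (gain p)].
  by near: L; exact: normalized_word_prob.
exists p; split => //.
rewrite ler_pdivlMl ?ltr0n// (le_trans _ pG)//.
have := mv (N - m)%N; rewrite subnK// natrB// => h1.
have h2 := ln_lin_le N e8.
have h3 : 0 <= N%:R * e by rewrite mulr_ge0// ltW.
move: h1 h2 h3 CN; rewrite /C; lra.
Unshelve. all: by end_near. Qed.

(** * Moving the average inside the interval *)

Lemma limn_einf_lt {R : realType} (u : (\bar R)^nat) (a : \bar R) N :
  (limn_einf u < a)%E -> exists2 n, (N <= n)%N & (u n < a)%E.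
Proof.
have h : (einfs u N <= limn_einf u)%E.
  rewrite limn_einf_lim (cvg_lim _ (ereal_nondecreasing_cvgn (nondecreasing_einfs u)))//.
  by apply: ereal_sup_ubound; exists N.
move=> /(le_lt_trans h)/ereal_inf_lt[_ [n /= Nn <-] una].
by exists n.
Qed.

Lemma limn_esup_gt {R : realType} (u : (\bar R)^nat) (a : \bar R) N :
  (a < limn_esup u)%E -> exists2 n, (N <= n)%N & (a < u n)%E.
Proof.
have -> : u = -%E \o (-%E \o u) by apply/funext => n; rewrite /= oppeK.
rewrite limn_esupN lteNr => /limn_einf_lt-/(_ N)[n Nn una].
by exists n => //=; rewrite lteNr.
Qed.

Section Mixing.
Context {R : realType} (psi : nat -> R).
Implicit Types (w : seq nat) (J : interval R).

Lemma average_inf_word (a : R) : (average_inf psi < a%:E)%E ->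
  exists2 w, (0 < size w)%N & word_sum psi w < (size w)%:R * a.
Proof.
move=> /ereal_inf_lt[_ [x x01 <-]] /limn_einf_lt-/(_ 1%N)[n n0].
rewrite digit_averageE// lte_fin ltr_pdivrMl ?ltr0n// => ua.
by exists (itin n x); rewrite size_itin.
Qed.

Lemma average_sup_word (a : R) : (a%:E < average_sup psi)%E ->
  exists2 w, (0 < size w)%N & (size w)%:R * a < word_sum psi w.
Proof.
move=> /ereal_sup_gt[_ [x x01 <-]] /limn_esup_gt-/(_ 1%N)[n n0].
rewrite digit_averageE// lte_fin ltr_pdivlMl ?ltr0n// => ua.
by exists (itin n x); rewrite size_itin.
Qed.

Definition repeat_word w k : seq nat := flatten (nseq k w).

Lemma size_repeat_word w k : size (repeat_word w k) = (k * size w)%N.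
Proof. by elim: k => //= k IH; rewrite size_cat -/(repeat_word w k) IH mulSn. Qed.

Lemma word_sum_repeat w k : word_sum psi (repeat_word w k) = k%:R * word_sum psi w.
Proof.
elim: k => [|k IH]; first by rewrite /word_sum big_nil mul0r.
by rewrite /= word_sum_cat -/(repeat_word w k) IH -natr1 mulrDl mul1r addrC.
Qed.

Lemma all_repeat_word (P : pred nat) w k : all P w -> all P (repeat_word w k).
Proof. by move=> Pw; elim: k => //= k IH; rewrite all_cat Pw. Qed.

(** J contains a point alpha strictly between the extreme averages and, being of positive
    measure, another point b.  Every point between alpha and b that is close enough to
    alpha is interior to J and still separates the averages of two words. *)
Lemma interior_average J (alpha : R) : (0 < lebesgue_measure [set` J])%E ->
  alpha \in J -> (average_inf psi < alpha%:E < average_sup psi)%E ->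
  exists beta r : R, exists u v : seq nat,
  [/\ 0 < r, forall x, `|x - beta| < r -> x \in J,
      (0 < size u)%N, (0 < size v)%N &
      word_sum psi u < (size u)%:R * beta /\ (size v)%:R * beta < word_sum psi v].
Proof.
move=> J0 aJ /andP[/average_inf_word[u u0 ua] /average_sup_word[v v0 va]].
have [b bJ ba] : exists2 b, b \in J & b != alpha.
  apply: contrapT => Ja; move: J0; rewrite ltNge => /negP; apply.
  rewrite -(lebesgue_measure_set1 alpha); apply: le_measure; rewrite ?inE//.
  by move=> x /= xJ; apply: contrapT => /eqP xa; apply: Ja; exists x.
have uR : 0 < (size u)%:R :> R by rewrite ltr0n.
have vR : 0 < (size v)%:R :> R by rewrite ltr0n.
move: ua va; rewrite mulrC -ltr_pdivrMr// => ua; rewrite mulrC -ltr_pdivlMr// => va.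
have [ab|ab] := ltP alpha b.
  pose c := Num.min b (word_sum psi v / (size v)%:R).
  have ac : alpha < c by rewrite lt_min ab.
  have cb : c <= b by rewrite ge_min lexx.
  have cv : c <= word_sum psi v / (size v)%:R by rewrite ge_min lexx orbT.
  exists ((alpha + c) / 2), ((c - alpha) / 2), u, v; split => //.
  - by rewrite divr_gt0// subr_gt0.
  - move=> x; rewrite ltr_distl => /andP[x1 x2].
    by apply: (itv_convex aJ bJ); move: x1 x2 cb; lra.
  - split.
      by rewrite mulrC -ltr_pdivrMr// (lt_trans ua)//; move: ac; lra.
    by rewrite mulrC -ltr_pdivlMr// (lt_le_trans _ cv)//; move: ac; lra.
have {}ab : b < alpha by rewrite lt_neqAle ba.
pose c := Num.max b (word_sum psi u / (size u)%:R).
have ac : c < alpha by rewrite gt_max ab.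
have cb : b <= c by rewrite le_max lexx.
have cu : word_sum psi u / (size u)%:R <= c by rewrite le_max lexx orbT.
exists ((alpha + c) / 2), ((alpha - c) / 2), u, v; split => //.
- by rewrite divr_gt0// subr_gt0.
- move=> x; rewrite ltr_distl => /andP[x1 x2].
  by apply: (itv_convex bJ aJ); move: x1 x2 cb; lra.
- split.
    by rewrite mulrC -ltr_pdivrMr// (le_lt_trans cu)//; move: ac; lra.
  by rewrite mulrC -ltr_pdivlMr// (lt_trans _ va)//; move: ac; lra.
Qed.

Lemma mean_mix (T : finType) (p q f : T -> R) (s : R) :
  mean (fun t => (1 - s) * p t + s * q t) f = (1 - s) * mean p f + s * mean q f.
Proof.
by rewrite /mean !mulr_sumr -big_split/=; apply: eq_bigr => t _; ring.
Qed.

(** Concavity of entropy for the weight 1 - s on p, by [gibbs_inequality].  For q only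
    the energy is kept, as - ln of a probability is nonnegative. *)
Lemma gain_mix N L (p q : N.-tuple 'I_L -> R) (s c : R) :
  (forall t, 0 <= p t) -> \sum_t p t = 1 -> (forall t, 0 <= q t) -> \sum_t q t = 1 ->
  0 < s < 1 -> (forall t, 0 < q t -> c <= ln (len (tword t) / N.+1%:R)) ->
  (1 - s) * mean p (gain p) + s * c <=
    mean (fun t => (1 - s) * p t + s * q t) (gain (fun t => (1 - s) * p t + s * q t)).
Proof.
move=> p0 p1 q0 q1 /andP[s0 s1] qc; rewrite mean_mix.
set g := fun t => (1 - s) * p t + s * q t.
have s1' : 0 < 1 - s by rewrite subr_gt0.
have g0 t : 0 <= g t by rewrite addr_ge0// mulr_ge0// ltW.
have g1 : \sum_t g t = 1.
  by rewrite big_split/= -!mulr_sumr p1 q1 !mulr1 subrK.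
have gle t : g t <= 1.
  by rewrite -g1 (bigD1 t)//= lerDl sumr_ge0.
apply: lerD; rewrite ler_pM2l//.
  have gp t : 0 < p t -> 0 < g t.
    by move=> pt; rewrite ltr_pwDl ?mulr_gt0// mulr_ge0// ltW.
  have := gibbs_inequality p0 g0 gp; rewrite g1 p1 => /(_ (lexx _)).
  rewrite /mean /gain => h.
  under eq_bigr do rewrite mulrBr. under [leRHS]eq_bigr do rewrite mulrBr.
  by rewrite !sumrB lerD2l.
rewrite -[c]mul1r -q1 mulr_suml; apply: ler_sum => t _.
have := q0 t; rewrite le_eqVlt => /predU1P[<-|qt]; first by rewrite !mul0r.
rewrite ler_pM2l// (le_trans (qc t qt))// /gain lerDl oppr_ge0 ln_le0//.
Qed.

End Mixing.

Section LowerBoundForIntervals.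
Context {R : realType} (psi : nat -> R).
Implicit Types (w : seq nat) (J : interval R).

(** Repeating u and v gives two words of the same length, and the weights that produce
    the average beta are found by linear interpolation.  The bound B on the letters
    does not depend on k, hence neither does the energy per letter. *)
Lemma balanced_words (beta : R) (u v : seq nat) :
  (0 < size u)%N -> (0 < size v)%N ->
  word_sum psi u < (size u)%:R * beta -> (size v)%:R * beta < word_sum psi v ->
  exists B : nat, forall k L, (0 < k)%N -> (B <= L)%N ->
  exists q : (k * (size u * size v)).-tuple 'I_L -> R,
  [/\ forall t, 0 <= q t, \sum_t q t = 1,
      mean q (word_sum psi \o @tword _ L) = (k * (size u * size v))%:R * beta &
      forall t, 0 < q t -> all (fun a => a < B)%N (tword t)].
Proof.
move=> u0 v0 ub vb; pose B := (\max_(a <- u ++ v) a).+1.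
have allB : all (fun a => a < B)%N (u ++ v).
  by apply/allP => a auv; rewrite ltnS; exact: leq_bigmax_seq.
move: allB; rewrite all_cat => /andP[uB vB].
exists B => k L k0 BL; set N := (k * _)%N.
have kR : 0 < k%:R :> R by rewrite ltr0n.
have uR : 0 < (size u)%:R :> R by rewrite ltr0n.
have vR : 0 < (size v)%:R :> R by rewrite ltr0n.
have word w j : (j * size w)%N = N -> all (fun a => a < B)%N w ->
    exists2 t : N.-tuple 'I_L, all (fun a => a < B)%N (tword t) &
      word_sum psi (tword t) = j%:R * word_sum psi w.
  move=> jN wB.
  have rB : all (fun a => a < B)%N (repeat_word w j) by exact: all_repeat_word.
  have rL : all (fun a => a < L)%N (repeat_word w j).
    by apply: sub_all rB => a /= aB; rewrite (leq_trans aB).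
  have rN : size (repeat_word w j) = N by rewrite size_repeat_word.
  have [t tE] := tword_surj rN rL.
  by exists t; rewrite tE// word_sum_repeat.
have uN : (k * size v * size u)%N = N by rewrite /N mulnAC mulnA.
have vN : (k * size u * size v)%N = N by rewrite /N mulnA.
have [tu tuB tuE] := word u _ uN uB; have [tv tvB tvE] := word v _ vN vB.
have {}tuE : word_sum psi (tword tu) < N%:R * beta.
  by rewrite tuE /N !natrM -!mulrA ltr_pM2l// mulrCA ltr_pM2l.
have {}tvE : N%:R * beta < word_sum psi (tword tv).
  by rewrite tvE /N !natrM -!mulrA !ltr_pM2l.
set su := word_sum psi (tword tu) in tuE; set sv := word_sum psi (tword tv) in tvE.
have uv : 0 < sv - su by move: tuE tvE; clear; lra.
pose th := (sv - N%:R * beta) / (sv - su).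
have th0 : 0 <= th by rewrite divr_ge0// ltW// subr_gt0.
have th1 : 0 <= 1 - th by rewrite subr_ge0 ler_pdivrMr// mul1r; move: tuE; clear; lra.
exists (fun t => th * (t == tu)%:R + (1 - th) * (t == tv)%:R).
have delta (s : N.-tuple 'I_L) (f : N.-tuple 'I_L -> R) : \sum_t (t == s)%:R * f t = f s.
  rewrite (bigD1 s)//= eqxx mul1r big1 ?addr0// => t /negbTE->.
  by rewrite mul0r.
have qf f : mean (fun t => th * (t == tu)%:R + (1 - th) * (t == tv)%:R) f =
    th * f tu + (1 - th) * f tv.
  rewrite -(delta tu f) -(delta tv f) !mulr_sumr -big_split/=.
  by apply: eq_bigr => t _; rewrite mulrDl -!mulrA.
split.
- by move=> t; rewrite addr_ge0// mulr_ge0.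
- transitivity (mean (fun t => th * (t == tu)%:R + (1 - th) * (t == tv)%:R) (fun=> 1)).
    by apply: eq_bigr => t _; rewrite mulr1.
  by rewrite qf; ring.
- rewrite qf /= -/su -/sv /th; field; exact: lt0r_neq0.
- move=> t; have [->//|_] := eqVneq t tu; have [->//|_] := eqVneq t tv.
  by rewrite !mulr0 addr0 ltxx.
Qed.

(** With weight 1 - s on the typical words of mu and s on the balanced words, the average
    is within s r / 2 of (1 - s) alpha + s beta, which by convexity is the center of an
    interval of radius s r contained in J.  The loss is of order s. *)
Lemma avg_set_lower_free_energy J (alpha v : R) :
  (0 < lebesgue_measure [set` J])%E -> alpha \in J ->
  (exists2 a : R, a \in J & (average_inf psi < a%:E < average_sup psi)%E) ->
  (forall e, 0 < e -> exists mu : probability (measurableTypeR R) R, exists M : R,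
    [/\ invariant_measures_phi mu, mu.-integrable I01 (fun x => (psi (digit 1 x))%:E),
        (\int[mu]_(x in I01) (psi (digit 1 x))%:E = M%:E)%E,
        `|M - alpha| < e & (v%:E < free_energy mu)%E]) ->
  forall eta, 0 < eta -> \forall n \near \oo,
    ((expR (n%:R * (v - eta)))%:E <= lebesgue_measure (avg_set psi J n))%E.
Proof.
move=> J0 aJ [a0 a0J a0i] Hmu eta eta0.
have [beta [r [u [w [r0 Jr u0 w0 [ub wb]]]]]] := interior_average J0 a0J a0i.
have [B HB] := balanced_words u0 w0 ub wb.
(* C bounds the energy per letter of the balanced words: 2 ln (B + 1) by [len_bounded],
   and 1 for the distortion, as ln (N + 1) <= N. *)
pose C : R := 2 * ln B.+1%:R + 1.
have C0 : 0 <= C by rewrite /C addr_ge0// mulr_ge0// ln_ge0// ler1n.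
pose s := Num.min (1 / 2) (eta / (4 * (`|v| + C + 1))).
have D0 : 0 < 4 * (`|v| + C + 1) by rewrite mulr_gt0// ltr_wpDl// addr_ge0.
have s0 : 0 < s by rewrite lt_min !divr_gt0.
have s12 : s <= 1 / 2 by rewrite ge_min lexx.
have sD : s * (4 * (`|v| + C + 1)) <= eta.
  by rewrite -ler_pdivlMr// ge_min lexx orbT.
have sr : 0 < s * r by rewrite mulr_gt0.
have sr4 : 0 < s * r / 4 by rewrite divr_gt0.
have [mu [M [mphi mpsi muM Ma vF]]] := Hmu _ sr4.
pose e := Num.min (eta / 4) (s * r / 4).
have e0 : 0 < e by rewrite lt_min !divr_gt0.
have e1 : e <= eta / 4 by rewrite ge_min lexx.
have e2 : e <= s * r / 4 by rewrite ge_min lexx orbT.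
have [k0 _ Hk] := free_energy_words mphi mpsi muM vF e0.
(* N must be a multiple of the length of the balanced words and at least k0. *)
pose k := k0.+1; pose N := (k * (size u * size w))%N.
have N0 : (0 < N)%N by rewrite !muln_gt0 u0 w0.
have k0N : (k0 <= N)%N.
  rewrite (leq_trans (leqnSn k0))// -[X in (X <= _)%N]muln1 leq_mul//.
  by rewrite muln_gt0 u0.
have [l0 _ Hl] := Hk N k0N; pose L := maxn l0 B.
have {Hl Hk} [p [p0 p1 pM pG]] := Hl L (leq_maxl _ _).
have [q [q0 q1 qM qB]] := HB k L isT (leq_maxr _ _).
rewrite -/N in q q0 q1 qM qB.
have NR : 0 < N%:R :> R by rewrite ltr0n.
pose g t := (1 - s) * p t + s * q t.
have s1 : 0 <= 1 - s by move: s12; clear; lra.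
have g0 t : 0 <= g t by rewrite addr_ge0// mulr_ge0// ltW.
have g1 : \sum_t g t = 1 by rewrite big_split/= -!mulr_sumr p1 q1 !mulr1 subrK.
have gM : N%:R^-1 * mean g (word_sum psi \o @tword N L) =
    (1 - s) * (N%:R^-1 * mean p (word_sum psi \o @tword N L)) + s * beta.
  by rewrite mean_mix qM; field; exact: lt0r_neq0.
have gG : v - eta + eta / 4 <= N%:R^-1 * mean g (gain g).
  have qc t : 0 < q t -> - (N%:R * C) <= ln (len (tword t) / N.+1%:R).
    move=> /qB tB; have := @len_bounded R B (tword t) tB; rewrite size_tword => lB.
    have B0 : 0 < B.+1%:R ^+ N :> R by exact: exprn_gt0.
    have BB : 0 < B.+1%:R ^+ N * B.+1%:R ^+ N :> R by exact: mulr_gt0.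
    move: lB; rewrite -ler_ln ?posrE ?len_gt0 ?invr_gt0//.
    rewrite lnV ?posrE// [ln (_ ^+ N * _)]lnM ?posrE// lnXn// -[ln _ *+ N]mulr_natl => lB.
    rewrite ln_div ?posrE ?len_gt0//.
    have lN : ln N.+1%:R <= N%:R :> R.
      by rewrite -ler_expR lnK ?posrE// -natr1 addrC expR_ge1Dx.
    move: lB lN; rewrite /C; clear; lra.
  have s01 : 0 < s < 1 by rewrite s0; move: s12; clear; lra.
  have h := gain_mix p0 p1 q0 q1 s01 qc.
  have pG' : N%:R * (v - e) <= mean p (gain p) by rewrite -ler_pdivlMl.
  rewrite ler_pdivlMl// (le_trans _ h)//.
  apply: (@le_trans _ _ ((1 - s) * (N%:R * (v - e)) + s * - (N%:R * C))); last first.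
    by rewrite lerD2r ler_wpM2l.
  have -> : (1 - s) * (N%:R * (v - e)) + s * - (N%:R * C) =
    N%:R * (v - (1 - s) * e - s * (v + C)) by ring.
  rewrite ler_wpM2l//.
  have h1 : s * (v + C) <= s * (`|v| + C) by rewrite ler_pM2l// lerD2r ler_norm.
  have h2 : 0 <= s * e by rewrite mulr_ge0// ltW.
  have h3 : 0 <= s * (`|v| + C) by apply: mulr_ge0; [exact: ltW|exact: addr_ge0].
  have {}sD : 4 * (s * (`|v| + C)) + 4 * s <= eta by move: sD; clear; lra.
  move: h1 h2 h3 sD e1 eta0 s0; clear; lra.
have xJ x : `|x - N%:R^-1 * mean g (word_sum psi \o @tword N L)| < s * r / 4 -> x \in J.
  rewrite gM => hx.
  (* x = (1 - s) alpha + s y, with y within r of beta. *)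
  pose y := (x - (1 - s) * alpha) / s.
  have yJ : y \in J.
    apply: Jr; rewrite /y.
    have -> : (x - (1 - s) * alpha) / s - beta = (x - (1 - s) * alpha - s * beta) / s.
      by field; exact: lt0r_neq0.
    rewrite normrM normfV (gtr0_norm s0) ltr_pdivrMr//.
    set m := N%:R^-1 * _ in hx pM.
    have h1 : `|(1 - s) * (m - alpha)| <= `|m - M| + `|M - alpha|.
      rewrite normrM (ger0_norm s1) (le_trans (ler_piMl _ _))//.
        by rewrite lerBlDl lerDr ltW.
      by rewrite -{1}(subrK M m) -addrA ler_normD.
    rewrite [r * s]mulrC.
    rewrite (_ : x - _ - _ = (x - ((1 - s) * m + s * beta)) + (1 - s) * (m - alpha)); last by ring.
    rewrite (le_lt_trans (ler_normD _ _))//.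
    move: hx h1 pM Ma e2 sr; clear; lra.
  have xE : x = (1 - s) * alpha + s * y by rewrite /y; field; exact: lt0r_neq0.
  have [ay|ya] := leP alpha y.
    have : 0 <= s * (y - alpha) by rewrite mulr_ge0 ?subr_ge0// ltW.
    have : 0 <= (1 - s) * (y - alpha) by rewrite mulr_ge0// subr_ge0.
    by move=> h1 h2; apply: (itv_convex aJ yJ); rewrite xE; move: h1 h2; clear; lra.
  have : 0 <= s * (alpha - y) by rewrite mulr_ge0 ?subr_ge0// ltW.
  have : 0 <= (1 - s) * (alpha - y) by rewrite mulr_ge0// subr_ge0 ltW.
  by move=> h1 h2; apply: (itv_convex yJ aJ); rewrite xE; move: h1 h2; clear; lra.
have eta4 : 0 < eta / 4 by rewrite divr_gt0.
have := avg_set_lower N0 g0 g1 sr4 eta4 xJ.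
apply: filterS => n; apply: le_trans; rewrite lee_fin ler_expR ler_wpM2l//.
by rewrite lerBrDr.
Qed.

End LowerBoundForIntervals.

(** * Rate function and conclusion *)

(** Convergence to a possibly infinite limit, tested against real bounds on both sides. *)
Lemma cvge_real_bounds {R : realType} (a : (\bar R)^nat) (V : \bar R) :
  (forall v : R, (v%:E < V)%E -> \forall n \near \oo, (v%:E <= a n)%E) ->
  (forall v : R, (V < v%:E)%E -> \forall n \near \oo, (a n <= v%:E)%E) ->
  a n @[n --> \oo] --> V.
Proof.
case: V => [r| |] lo up.
- apply/fine_cvgP.
  have bd (e : R) : 0 < e -> \forall n \near \oo,
      ((r - e)%:E <= a n)%E /\ (a n <= (r + e)%:E)%E.
    move=> e0; near=> n; split; near: n.
      by apply: lo; rewrite lte_fin ltrBlDr ltrDl.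
    by apply: up; rewrite lte_fin ltrDl.
  have fin (e : R) x : ((r - e)%:E <= x)%E /\ (x <= (r + e)%:E)%E -> x \is a fin_num.
    by case: x => [x||] [].
  split; first by apply: filterS (bd 1 ltr01) => n; exact: fin.
  apply/cvgrPdist_le => e e0; apply: filterS (bd e e0) => n /= h.
  move: (h) => /fin/fineK an; move: h; rewrite -an !lee_fin distrC => -[h1 h2].
  by rewrite ler_distl h1.
- by apply/cvgeyPge => v; apply: lo; rewrite ltry.
- by apply/cvgeNyPle => v; apply: up; rewrite ltNyr.
Unshelve. all: by end_near. Qed.

Section RateFunction.
Context {R : realType} (psi : nat -> R).
Implicit Types (alpha v e : R) (J : interval R).

(** The supremum of the free energies decreases with the neighborhood, so the limit is
    an infimum. *)
Lemma rate_functionE alpha : (- rate_function psi alpha)%E =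
  ereal_inf [set local_sup_free_energy psi alpha e | e in [set` `]0, +oo[]].
Proof.
rewrite /rate_function oppeK; apply: cvg_lim => //.
apply: nondecreasing_at_right_cvge => // e e' _ _ ee'.
apply: ereal_sup_le => _ [mu [mphi mpsi h1 h2] <-]; exists mu => //; split => //.
  by rewrite (le_lt_trans _ h1)// lee_fin lerB.
by rewrite (lt_le_trans h2)// lee_fin lerD.
Qed.

Lemma free_energy_le_rate (mu : probability (measurableTypeR R) R) alpha :
  invariant_measures_phi mu -> mu.-integrable I01 (fun x => (psi (digit 1 x))%:E) ->
  (\int[mu]_(x in I01) (psi (digit 1 x))%:E = alpha%:E)%E ->
  (free_energy mu <= - rate_function psi alpha)%E.
Proof.
move=> mphi mpsi mua; rewrite rate_functionE; apply/ereal_infP => _ [e /= e0 <-].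
rewrite in_itv/= andbT in e0.
apply: ereal_sup_ubound; exists mu => //; split=> //; rewrite mua lte_fin.
  by rewrite ltrBlDr ltrDl.
by rewrite ltrDl.
Qed.

Lemma lt_rate_free_energy v alpha e : (v%:E < - rate_function psi alpha)%E -> 0 < e ->
  exists mu : probability (measurableTypeR R) R, exists M : R,
    [/\ invariant_measures_phi mu, mu.-integrable I01 (fun x => (psi (digit 1 x))%:E),
        (\int[mu]_(x in I01) (psi (digit 1 x))%:E = M%:E)%E,
        `|M - alpha| < e & (v%:E < free_energy mu)%E].
Proof.
move=> va e0; have : (v%:E < local_sup_free_energy psi alpha e)%E.
  rewrite (lt_le_trans va)// rate_functionE; apply: ereal_inf_lbound.
  by exists e => //=; rewrite in_itv/= e0.
move=> /ereal_sup_gt[_ [mu [mphi mpsi h1 h2] <-] vF].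
have m01 : measurable (I01 : set (measurableTypeR R)) by exact: measurable_I01.
have fin := integrable_fin_num m01 mpsi.
exists mu, (fine (\int[mu]_(x in I01) (psi (digit 1 x))%:E)%E); split => //.
  by rewrite fineK.
by move: h1 h2; rewrite -(fineK fin) !lte_fin => h1 h2; rewrite ltr_distl h1.
Qed.

Lemma avg_set_upper J n : (0 < n)%N ->
  ((n%:R^-1)%:E * lne (lebesgue_measure (avg_set psi J n)) <=
   - ereal_inf [set rate_function psi alpha | alpha in [set` J]] +
   (n%:R^-1 * (ln 2 + ln n.+1%:R))%:E)%E.
Proof.
move=> n0; have nR : 0 < n%:R :> R by rewrite ltr0n.
set V := (- ereal_inf _)%E.
have [Z0|Z0] := leP (lebesgue_measure (avg_set psi J n)) 0%E.
  by rewrite le0_lneNy// gt0_muleNy ?lte_fin ?invr_gt0// leNye.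
have [Z ZE] : exists Z : R, lebesgue_measure (avg_set psi J n) = Z%:E.
  exists (fine (lebesgue_measure (avg_set psi J n))); rewrite fineK// fin_numElt.
  by rewrite (lt_le_trans _ (ltW Z0))// (le_lt_trans (avg_set_le1 _ _ _))// ltry.
rewrite ZE lte_fin in Z0; rewrite ZE lne_EFin// -leeBlDr// -EFinM -EFinB.
apply/lee_addgt0Pr => e e0; rewrite -leeBlDr// -EFinB.
have [mu [alpha [mphi mpsi aJ mua muF]]] := measure_of_avg_set n0 Z0 e0 ZE.
rewrite (le_trans _ (le_trans muF _))//.
  by rewrite lee_fin -mulrBr opprD addrA.
rewrite (le_trans (free_energy_le_rate mphi mpsi mua))// /V leeN2.
by apply: ereal_inf_lbound; exists alpha.
Qed.

Lemma avg_set_lower_rate J v : (0 < lebesgue_measure [set` J])%E ->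
  (exists2 a : R, a \in J & (average_inf psi < a%:E < average_sup psi)%E) ->
  (v%:E < - ereal_inf [set rate_function psi alpha | alpha in [set` J]])%E ->
  \forall n \near \oo,
    (v%:E <= (n%:R^-1)%:E * lne (lebesgue_measure (avg_set psi J n)))%E.
Proof.
move=> J0 Ja; rewrite lteNr => /ereal_inf_lt[_ [alpha aJ <-]]; rewrite -lteNr => va.
have [w vw wa] : exists2 w : R, v < w & (w%:E < - rate_function psi alpha)%E.
  move: va; case: (- rate_function psi alpha)%E => [r| |]//=.
  - rewrite lte_fin => vr; exists ((v + r) / 2); last rewrite lte_fin; by move: vr; lra.
  - by move=> _; exists (v + 1); [rewrite ltrDl|rewrite ltry].
have vw0 : 0 < w - v by rewrite subr_gt0.
have := avg_set_lower_free_energy J0 aJ Ja (fun e => @lt_rate_free_energy w alpha e wa) vw0.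
rewrite subKr => h; near=> n.
have n0 : (0 < n)%N by near: n; exists 1%N.
have hn : ((expR (n%:R * v))%:E <= lebesgue_measure (avg_set psi J n))%E by near: n.
rewrite lee_pdivlMl ?ltr0n// -EFinM -[n%:R * v]expRK -lne_EFin ?expR_gt0//.
by rewrite lee_lne// in_itv/= leey andbT//.
Unshelve. all: by end_near. Qed.

End RateFunction.

Theorem theoremA (R : realType) (psi : nat -> R) (J : interval R)
    (hpsi : arithmetic_function psi)
    (hJpos : (0 < lebesgue_measure [set` J])%E)
    (hJmeet : exists2 alpha : R, alpha \in J &
       (average_inf psi < alpha%:E < average_sup psi)%E) :
  ((n%:R^-1)%:E * lne (lebesgue_measure
     [set x : R | I01 x /\ digit_average psi n x \in J]))%E @[n --> \oo]
  --> (- ereal_inf [set rate_function psi alpha | alpha in [set` J]])%E.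
Proof.
apply: cvge_real_bounds => v; first exact: avg_set_lower_rate.
set V := (- _)%E => Vv.
have [w wv Vw] : exists2 w : R, w < v & (V < w%:E)%E.
  move: Vv; case: V => [r| |]//=.
  - rewrite lte_fin => rv; exists ((v + r) / 2); last rewrite lte_fin; by move: rv; lra.
  - by move=> _; exists (v - 1); [rewrite ltrBlDr ltrDl|rewrite ltNyr].
pose c := (v - w) / 2; have c0 : 0 < c by rewrite divr_gt0// subr_gt0.
pose C := ln 2 + (c - ln c).
near=> n.
have n0 : (0 < n)%N by near: n; exists 1%N.
rewrite (le_trans (avg_set_upper psi J n0))// (le_trans (leeD2r _ (ltW Vw)))//.
rewrite -EFinD lee_fin -lerBrDl ler_pdivrMl ?ltr0n//.
have Cn : C <= n%:R * c by rewrite -ler_pdivrMr//; near: n; exact: nbhs_infty_ger.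
have := ln_lin_le n c0.
have -> : v - w = c + c by rewrite /c; lra.
by move: Cn; rewrite /C; lra.
Unshelve. all: by end_near. Qed.
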